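(* Let $0\le\alpha\le\frac{N-2}{2}$ and $0<R<\infty$. For $f\in C_0^\infty(\mathbb{H}^N)$, $$\int_{0<\rho(x)<R}|\nabla_{\mathbb{H}}f|^2dV_{\mathbb{H}}-\left(\frac{(N-2)^2}{4}-\alpha^2\right)\int_{0<\rho(x)<R}\frac{|f|^2}{\rho^2(x)}dV_{\mathbb{H}}$$ $$=\frac{z_\alpha^2}{R^2}\int_{0<\rho(x)<R}|f|^2dV_{\mathbb{H}}+\int_{0<\rho(x)<R}\frac{J_\alpha^2\left(\frac{z_\alpha}{R}\rho(x)\right)}{\rho^{N-2}(x)}\left|\nabla_{\mathbb{H}}\left(\frac{f}{\rho^{\frac{2-N}{2}}(x)J_\alpha\left(\frac{z_\alpha}{R}\rho(x)\right)}\right)\right|^2dV_{\mathbb{H}}$$ $$-(N-1)\int_{0<\rho(x)<R}\left(\frac{2-N}{2\rho(x)}+\frac{z_\alpha}{R}\frac{J_\alpha'\left(\frac{z_\alpha}{R}\rho(x)\right)}{J_\alpha\left(\frac{z_\alpha}{R}\rho(x)\right)}\right)\frac{\rho(x)\cosh\rho(x)-\sinh\rho(x)}{\rho(x)\sinh\rho(x)}|f|^2dV_{\mathbb{H}}$$ and $$\int_{0<\rho(x)<R}|\partial_\rho f|^2dV_{\mathbb{H}}-\left(\frac{(N-2)^2}{4}-\alpha^2\right)\int_{0<\rho(x)<R}\frac{|f|^2}{\rho^2(x)}dV_{\mathbb{H}}$$ $$=\frac{z_\alpha^2}{R^2}\int_{0<\rho(x)<R}|f|^2dV_{\mathbb{H}}+\int_{0<\rho(x)<R}\frac{J_\alpha^2\left(\frac{z_\alpha}{R}\rho(x)\right)}{\rho^{N-2}(x)}\left|\partial_\rho\left(\frac{f}{\rho^{\frac{2-N}{2}}(x)J_\alpha\left(\frac{z_\alpha}{R}\rho(x)\right)}\right)\right|^2dV_{\mathbb{H}}$$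 $$-(N-1)\int_{0<\rho(x)<R}\left(\frac{2-N}{2\rho(x)}+\frac{z_\alpha}{R}\frac{J_\alpha'\left(\frac{z_\alpha}{R}\rho(x)\right)}{J_\alpha\left(\frac{z_\alpha}{R}\rho(x)\right)}\right)\frac{\rho(x)\cosh\rho(x)-\sinh\rho(x)}{\rho(x)\sinh\rho(x)}|f|^2dV_{\mathbb{H}}.$$ As a consequence of these identities, $$\int_{0<\rho(x)<R}|\nabla_{\mathbb{H}}f|^2dV_{\mathbb{H}}\ge\int_{0<\rho(x)<R}|\partial_\rho f|^2dV_{\mathbb{H}}$$ $$\ge\left(\frac{(N-2)^2}{4}-\alpha^2\right)\int_{0<\rho(x)<R}\frac{|f|^2}{\rho^2(x)}dV_{\mathbb{H}}+\frac{z_\alpha^2}{R^2}\int_{0<\rho(x)<R}|f|^2dV_{\mathbb{H}}$$ $$-(N-1)\int_{0<\rho(x)<R}\left(\frac{2-N}{2\rho(x)}+\frac{z_\alpha}{R}\frac{J_\alpha'\left(\frac{z_\alpha}{R}\rho(x)\right)}{J_\alpha\left(\frac{z_\alpha}{R}\rho(x)\right)}\right)\frac{\rho(x)\cosh\rho(x)-\sinh\rho(x)}{\rho(x)\sinh\rho(x)}|f|^2dV_{\mathbb{H}}$$ $$\ge\left(\frac{(N-2)^2}{4}-\alpha^2\right)\int_{0<\rho(x)<R}\frac{|f|^2}{\rho^2(x)}dV_{\mathbb{H}}+\frac{z_\alpha^2}{R^2}\int_{0<\rho(x)<R}|f|^2dV_{\mathbb{H}}.$$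
   Context: $\mathbb{H}^N$ is the $N$-dimensional hyperbolic space of constant sectional curvature $-1$, with gradient $\nabla_{\mathbb{H}}$ and volume element $dV_{\mathbb{H}}$; $\rho(x)$ is the geodesic distance from $x$ to a fixed point $O\in\mathbb{H}^N$ (the origin in the Poincaré ball model). $\partial_\rho f(x)=\frac{d}{dt}\big|_{t=\rho(x)}f(\exp_O(tu))$, where $x=\exp_O(\rho(x)u)$ with $u$ a unit tangent vector at $O$, is the radial derivative. $C_0^\infty(\mathbb{H}^N)$ denotes the smooth compactly supported functions on $\mathbb{H}^N$. $J_\alpha$ is the Bessel function of the first kind of order $\alpha$ and $z_\alpha$ is its first (positive) zero.
   Formalization: It is additionally assumed that the (real-valued) f vanishes on the sphere ρ(x)=R; without this the identities and the lower bound fail, e.g. for f=1 on the closed ball of radius R, where the gradient integral is 0 but the lower bound is positive. *)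

(* Defs.v *)
From HB Require Import structures.
From mathcomp Require Import all_boot all_order all_algebra.
From mathcomp Require Import ring lra.
From mathcomp Require Import all_classical all_reals all_analysis.

Set Implicit Arguments.
Unset Strict Implicit.
Unset Printing Implicit Defensive.

Import Order.TTheory GRing.Theory Num.Def Num.Theory.
Import numFieldNormedType.Exports.

Local Open Scope classical_set_scope.
Local Open Scope ring_scope.

Section lebesgue_tuple.
Context {R : realType}.
Notation T n := (n.-tuple (measurableTypeR R)).

Definition tcons n (p : measurableTypeR R * T n) : T n.+1 :=
  [tuple of p.1 :: p.2].

Lemma measurable_tcons n :
  measurable_fun [set: measurableTypeR R * T n] (@tcons n).
Proof. exact: measurable_cons. Qed.

Section step.
Variables (n : nat) (mu : {sigma_finite_measure set (T n) -> \bar R}).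

Definition leb_step : set (T n.+1) -> \bar R :=
  pushforward (@lebesgue_measure R \x mu)%E (@tcons n).

Let mtcons A : measurable A -> measurable (@tcons n @^-1` A).
Proof.
by move=> mA; rewrite -[X in measurable X]setTI; apply: measurable_tcons.
Qed.

Let leb_step0 : leb_step set0 = 0%E.
Proof. by rewrite /leb_step /pushforward preimage_set0 measure0. Qed.

Let leb_step_ge0 A : (0 <= leb_step A)%E.
Proof. by rewrite /leb_step /pushforward measure_ge0. Qed.

Let leb_step_sigma_additive : semi_sigma_additive leb_step.
Proof.
move=> F mF tF mUF; rewrite /leb_step /pushforward preimage_bigcup.
apply: measure_semi_sigma_additive.
- by move=> k; exact: mtcons.
- apply/trivIsetP => /= i j _ _ ij; rewrite -preimage_setI.
  by move/trivIsetP : tF => /(_ _ _ _ _ ij) ->//; rewrite preimage_set0.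
- by rewrite -preimage_bigcup; exact: mtcons.
Qed.

HB.instance Definition _ := isMeasure.Build _ _ _ leb_step
  leb_step0 leb_step_ge0 leb_step_sigma_additive.

Let mtuncons : measurable_fun [set: T n.+1]
  (fun t => (thead t, [tuple of behead t]) : measurableTypeR R * T n).
Proof.
apply: measurable_fun_pair; first exact: measurable_tnth.
exact: measurable_behead.
Qed.

Let leb_step_sigma_finite : sigma_finite setT leb_step.
Proof.
have /sigma_finiteP[F [TF ndF Foo]] := sigma_finiteT (@lebesgue_measure R).
have /sigma_finiteP[G [TG ndG Goo]] := sigma_finiteT mu.
exists (fun k => (fun t : T n.+1 =>
    (thead t, [tuple of behead t]) : measurableTypeR R * T n) @^-1`
  (F k `*` G k)).
  apply/esym; rewrite -subTset => t _.
  have [i _ Fi] : (\bigcup_i F i) (thead t) by rewrite -TF.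
  have [j _ Gj] : (\bigcup_i G i) [tuple of behead t] by rewrite -TG.
  exists (maxn i j) => //; split => /=.
  - by move: Fi; exact/subsetPset/ndF/leq_maxl.
  - by move: Gj; exact/subsetPset/ndG/leq_maxr.
move=> k; have [mF Fk] := Foo k; have [mG Gk] := Goo k.
have mFG := measurableX mF mG.
have mP := mtuncons measurableT mFG; rewrite setTI in mP.
split => //; rewrite /leb_step /pushforward.
rewrite (_ : _ @^-1` _ = F k `*` G k).
  by rewrite product_measure1E// lte_mul_pinfty// ge0_fin_numE.
have bK (x : R) (t : T n) : [tuple of behead (tcons (x, t))] = t by apply: val_inj.
by apply/seteqP; split => -[x t] /=; rewrite theadE bK.
Qed.

HB.instance Definition _ := Measure_isSigmaFinite.Build _ _ _ leb_step
  leb_step_sigma_finite.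

End step.

(* Lebesgue measure on n-tuples, as an iterated product. *)
Fixpoint leb n : {sigma_finite_measure set (T n) -> \bar R} :=
  match n return {sigma_finite_measure set (T n) -> \bar R} with
  | 0 => \d_ [tuple]
  | m.+1 => leb_step (leb m)
  end.

Lemma leb_box n (A : 'I_n -> set (measurableTypeR R)) :
  (forall i, measurable (A i)) ->
  leb n [set t | forall i, A i (tnth t i)] =
    (\prod_(i < n) lebesgue_measure (A i))%E.
Proof.
elim: n A => [|n IH] A mA /=.
  rewrite big_ord0 diracE mem_set//; by case.
rewrite big_ord_recl /= -IH; last by move=> i; exact: mA.
rewrite /leb_step /pushforward -product_measure1E//; last first.
  rewrite (_ : mkset _ = \bigcap_(i in [set: 'I_n])
      ((@tnth _ _)^~ i @^-1` A (lift ord0 i))).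
    apply: fin_bigcap_measurable => // i _.
    by rewrite -[X in measurable X]setTI; exact: measurable_tnth.
  by apply/seteqP; split => [t tA i _|t tA i]; [exact: tA|exact: (tA i)].
congr (product_measure1 _ _ _); apply/seteqP; split => -[x t] /=.
  move=> xA; split; first exact: (xA ord0).
  by move=> i; have := xA (lift ord0 i); rewrite tnthS.
by move=> [xA tA] i; case: (unliftP ord0 i) => [j ->|->//]; rewrite tnthS.
Qed.

End lebesgue_tuple.

Section poincare_ball.
Context {R : realType} {n : nat}.
Implicit Types (x y v w : 'rV[R]_n) (f F : 'rV[R]_n -> R) (D : set 'rV[R]_n).

(* The norm carried by ['rV[R]_n] in the library is the sup norm. *)
Definition dot v w : R := \sum_(i < n) v 0 i * w 0 i.
Definition enorm v : R := Num.sqrt (dot v v).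

Definition hball : set 'rV[R]_n := [set x | enorm x < 1].

(* The metric of curvature -1 on the ball is [conf x ^+ 2] times the Euclidean
   one. Tangent vectors are given by their Euclidean coordinates. *)
Definition conf x : R := 2 / (1 - dot x x).
Definition hmetric x v w : R := conf x ^+ 2 * dot v w.
Definition hnorm x v : R := Num.sqrt (hmetric x v v).

Definition rv_of_tuple (t : n.-tuple (measurableTypeR R)) : 'rV[R]_n :=
  \row_i tnth t i.

(* The volume density of the metric is [conf x ^+ n]. *)
Definition hint D F : \bar R :=
  (\int[leb n]_(t in rv_of_tuple @^-1` (hball `&` D))
    (F (rv_of_tuple t) * conf (rv_of_tuple t) ^+ n)%:E)%E.

Definition partial (i : 'I_n) f : 'rV[R]_n -> R :=
  fun x => 'D_(delta_mx 0 i) f x.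
Definition egrad f x : 'rV[R]_n := \row_i partial i f x.
(* The gradient for [hmetric] (see [hgradP]). *)
Definition hgrad f x : 'rV[R]_n := (conf x) ^- 2 *: egrad f x.

(* All iterated partial derivatives exist and are differentiable on [D], which
   is meant to be open. *)
Definition smooth_on D f :=
  forall (s : seq 'I_n) x, D x -> differentiable (foldr partial f s) x.

(* Only the values of [f] in the ball matter. *)
Definition Cc_infty f :=
  smooth_on hball f /\
  exists K : set 'rV[R]_n, [/\ compact K, K `<=` hball &
    forall x, hball x -> ~ K x -> f x = 0].

(* Curves are defined and C^1 on the whole line, but only [0, 1] matters. *)
Definition hlength (c : R -> 'rV[R]_n) : R :=
  \int[lebesgue_measure]_(t in `[0, 1]) hnorm (c t) (derive1 c t).

Definition hcurve x y (c : R -> 'rV[R]_n) :=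
  [/\ forall t, derivable c t 1, continuous (derive1 c),
      forall t, 0 <= t <= 1 -> hball (c t), c 0 = x & c 1 = y].

(* Riemannian distance; [hrhoE] gives its closed form from the origin. *)
Definition hdist x y : R := inf [set hlength c | c in hcurve x y].

Definition hrho x : R := hdist 0 x.

End poincare_ball.

Section special_functions.
Context {R : realType}.
Implicit Types (t a : R).

Definition sinh t : R := (expR t - expR (- t)) / 2.
Definition cosh t : R := (expR t + expR (- t)) / 2.
Definition tanh t : R := sinh t / cosh t.

Definition Gamma t : R :=
  \int[lebesgue_measure]_(s in `]0, +oo[) (s `^ (t - 1) * expR (- s)).

(* Meant for [0 <= a] and [0 < t]. *)
Definition besselJ a t : R :=
  limn (series (fun m => (-1) ^+ m / (m`!%:R * Gamma (m%:R + a + 1)) *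
    (t / 2) `^ (2 * m%:R + a))).

(* [z] is the first positive zero of [g]. *)
Definition first_zero (g : R -> R) z :=
  [/\ 0 < z, g z = 0 & forall t, 0 < t < z -> g t != 0].

End special_functions.

Section radial.
Context {R : realType} {n : nat}.
Implicit Types (x v : 'rV[R]_n) (f : 'rV[R]_n -> R).

(* Exponential map at the origin: the geodesics from the origin are the
   Euclidean radii, and [v] has length [hnorm 0 v = 2 * enorm v]
   (see [hrho_hexp0]). *)
Definition hexp0 v : 'rV[R]_n := (tanh (hnorm 0 v / 2) / enorm v) *: v.

(* The unit tangent vector [u] at the origin such that
   [x = hexp0 (hrho x *: u)] (see [hnorm_hdir] and [hexp0_hdir]). *)
Definition hdir x : 'rV[R]_n := (hnorm 0 x)^-1 *: x.

Definition hradial f x : R := derive1 (fun t => f (hexp0 (t *: hdir x))) (hrho x).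

End radial.

Section facts.
Context {R : realType} {n : nat}.
Implicit Types (x y v w e : 'rV[R]_n) (f : 'rV[R]_n -> R).

Lemma dotC v w : dot v w = dot w v.
Proof. by apply: eq_bigr => i _; rewrite mulrC. Qed.

Lemma dotDl u v w : dot (u + v) w = dot u w + dot v w.
Proof.
by rewrite -big_split; apply: eq_bigr => i _; rewrite /= mxE mulrDl.
Qed.

Lemma dotZl a v w : dot (a *: v) w = a * dot v w.
Proof. by rewrite mulr_sumr; apply: eq_bigr => i _; rewrite mxE mulrA. Qed.

Lemma dotZr a v w : dot v (a *: w) = a * dot v w.
Proof. by rewrite dotC dotZl dotC. Qed.

Lemma dot_ge0 v : 0 <= dot v v.
Proof. by apply: sumr_ge0 => i _; rewrite -expr2 sqr_ge0. Qed.

Lemma dot0l v : dot 0 v = 0.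
Proof. by apply: big1 => i _; rewrite mxE mul0r. Qed.

Lemma dotvv_eq0 v : (dot v v == 0) = (v == 0).
Proof.
apply/idP/eqP => [|->]; last by rewrite dot0l.
rewrite psumr_eq0; last by move=> i _; rewrite -expr2 sqr_ge0.
move=> /allP h; apply/rowP => i; rewrite mxE; apply/eqP.
by have := h i (mem_index_enum _); rewrite mulf_eq0 orbb.
Qed.

Lemma enorm_ge0 v : 0 <= enorm v. Proof. exact: sqrtr_ge0. Qed.

Lemma enorm_sqr v : enorm v ^+ 2 = dot v v.
Proof. by rewrite sqr_sqrtr// dot_ge0. Qed.

Lemma enorm_eq0 v : (enorm v == 0) = (v == 0).
Proof. by rewrite -dotvv_eq0 -enorm_sqr sqrf_eq0. Qed.

Lemma enormZ a v : enorm (a *: v) = `|a| * enorm v.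
Proof.
by rewrite /enorm dotZl dotZr mulrA -expr2 sqrtrM ?sqr_ge0// sqrtr_sqr.
Qed.

Lemma dot_le v e : dot e e = 1 -> `|dot v e| <= enorm v.
Proof.
move=> e1; rewrite -[leLHS]sqrtr_sqr ler_sqrt ?dot_ge0//.
set s := dot v e.
have := dot_ge0 (v + (- s) *: e).
have -> : dot (v + - s *: e) (v + - s *: e) = dot v v - s ^+ 2.
  rewrite dotDl !(dotC _ (_ + _)) !dotDl !dotZl (dotC v (_ *: e)) !dotZl.
  by rewrite !(dotC e) dotZl e1 -/s; ring.
by rewrite subr_ge0.
Qed.

Lemma hballE x : hball x = (dot x x < 1) :> Prop.
Proof.
rewrite /hball/= -enorm_sqr; congr is_true.
by rewrite -[in RHS](expr1n _ 2) ltr_pXn2r// nnegrE ?enorm_ge0.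
Qed.

Lemma conf_gt0 x : hball x -> 0 < conf x.
Proof. by rewrite hballE => x1; rewrite divr_gt0// subr_gt0. Qed.

Lemma hnormE x v : hball x -> hnorm x v = conf x * enorm v.
Proof.
move=> /conf_gt0 cx.
by rewrite /hnorm /hmetric sqrtrM ?sqr_ge0// sqrtr_sqr gtr0_norm.
Qed.

Lemma hball0 : hball (0 : 'rV[R]_n).
Proof. by rewrite hballE dot0l. Qed.

Lemma hnorm0E v : hnorm 0 v = 2 * enorm v.
Proof. by rewrite hnormE; [rewrite /conf dot0l subr0 divr1|exact: hball0]. Qed.

Lemma hgradP f x v : hball x -> differentiable f x ->
  hmetric x (hgrad f x) v = 'd f x v.
Proof.
move=> /conf_gt0 cx fx.
rewrite /hmetric /hgrad dotZl mulrA mulfV ?mul1r; last by rewrite expf_neq0// gt_eqF.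
rewrite {2}(row_sum_delta v) linear_sum; apply: eq_bigr => i _.
by rewrite mxE linearZ /= /partial deriveE// mulrC.
Qed.

Let G (p : R) : R := ln (1 + p) - ln (1 - p).

Let G_derive (p : R) : -1 < p < 1 -> is_derive p 1 G (2 / (1 - p ^+ 2)).
Proof.
move=> /andP[p1 p2].
have q1 : 0 < 1 + p by lra.
have q2 : 0 < 1 - p by lra.
have D1 : is_derive (1 + p) 1 (@ln R) (1 + p)^-1 by exact: is_derive1_ln.
have D2 : is_derive (1 - p) 1 (@ln R) (1 - p)^-1 by exact: is_derive1_ln.
have E1 : is_derive p 1 (fun p : R => 1 + p) 1.
  have := is_deriveD (is_derive_cst (1 : R) p 1) (is_derive_id p 1).
  by rewrite add0r.
have E2 : is_derive p 1 (fun p : R => 1 - p) (-1).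
  have := is_deriveB (is_derive_cst (1 : R) p 1) (is_derive_id p 1).
  by rewrite add0r.
have H1 := @is_derive1_comp R (@ln R) (fun p => 1 + p) p _ _ D1 E1.
have H2 := @is_derive1_comp R (@ln R) (fun p => 1 - p) p _ _ D2 E2.
have H := is_deriveB H1 H2.
apply: (is_derive_eq H); field.
by rewrite !gt_eqF//= (_ : 1 - p ^+ 2 = (1 + p) * (1 - p)) ?mulr_gt0//; ring.
Qed.

Let dot_derive (c : R -> 'rV[R]_n) e t : derivable c t 1 ->
  is_derive t 1 (fun t => dot (c t) e) (dot (derive1 c t) e).
Proof.
move=> ct.
have H i : is_derive t 1 (fun s => c s 0 i * e 0 i) (derive1 c t 0 i * e 0 i).
  have Hi : derivable (fun s => c s 0 i) t 1 by move/derivable_mxP: ct; exact.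
  rewrite derive1E derive_mx// mxE.
  have := is_deriveM (derivableP Hi) (is_derive_cst (e 0 i) t 1).
  move=> K; apply: (is_derive_eq K).
  by rewrite /GRing.scale/= mulr0 add0r mulrC.
have := is_derive_sum H.
rewrite (_ : \sum_(i < n) _ = (fun t => dot (c t) e))//.
by apply/funext => s; rewrite fct_sumE.
Qed.

Let dot_continuous (T : topologicalType) (a b : T -> 'rV[R]_n) t :
  {for t, continuous a} -> {for t, continuous b} ->
  {for t, continuous (fun t => dot (a t) (b t))}.
Proof.
move=> ca cb.
have -> : (fun t => dot (a t) (b t)) = \sum_(i < n) (fun s => a s 0 i * b s 0 i).
  by apply/funext => s; rewrite fct_sumE.
elim/big_ind : _ => [|f g cf cg|i _].
- exact: cst_continuous.
- exact: continuousD.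
- apply: (@continuousM R T (fun s => a s 0 i) (fun s => b s 0 i) t).
    apply: (@continuous_comp _ _ _ a (fun M : 'rV[R]_n => M 0 i) t ca).
    exact: coord_continuous.
  apply: (@continuous_comp _ _ _ b (fun M : 'rV[R]_n => M 0 i) t cb).
  exact: coord_continuous.
Qed.

Let curve_continuous (c : R -> 'rV[R]_n) (t : R) :
  (forall s, derivable c s 1) -> {for t, continuous c}.
Proof.
by move=> dc; apply: differentiable_continuous; apply/derivable1_diffP.
Qed.

Let itv01 : measurable (`[0, 1] : set (measurableTypeR R)).
Proof. exact: measurable_itv. Qed.

Let conf_continuous (c : R -> 'rV[R]_n) (t : R) :
  {for t, continuous c} -> hball (c t) ->
  {for t, continuous (fun t => conf (c t))}.
Proof.
move=> cc; rewrite hballE => ct.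
apply: continuousM; first exact: cst_continuous.
apply: continuousV; first by rewrite gt_eqF// subr_gt0.
by apply: continuousB; [exact: cst_continuous|exact: dot_continuous].
Qed.

Let speed_integrable x y (c : R -> 'rV[R]_n) : hcurve x y c ->
  (@lebesgue_measure R).-integrable `[0, 1]
     (EFin \o (fun t => hnorm (c t) (derive1 c t))).
Proof.
move=> [dc cc cb _ _].
suff : {within `[0 : R, 1], continuous (fun t => hnorm (c t) (derive1 c t))}.
  by apply: continuous_compact_integrable; exact: segment_compact.
apply: continuous_in_subspaceT => t; rewrite inE/= in_itv/= => /cb ct.
have ctc := conf_continuous (curve_continuous (t := t) dc) ct.
apply: (@continuous_comp _ _ _
  (fun t => conf (c t) ^+ 2 * dot (derive1 c t) (derive1 c t)) Num.sqrt t);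
  last exact: sqrt_continuous.
apply: (@continuousM R R (fun t => conf (c t) ^+ 2)).
  exact: (@continuousM R R (fun t => conf (c t)) (fun t => conf (c t)) t ctc ctc).
by apply: dot_continuous; exact: cc.
Qed.

Let hlength_lb x (c : R -> 'rV[R]_n) : hcurve 0 x c -> G (enorm x) <= hlength c.
Proof.
move=> hc; have [dc cc cb c0 c1] := hc.
have [x0|x0] := eqVneq x 0.
  have -> : G (enorm x) = 0.
    have /eqP -> : enorm x == 0 by rewrite enorm_eq0 x0.
    by rewrite /G addr0 subr0 subrr.
  by apply: Rintegral_ge0 => t _; exact: sqrtr_ge0.
have nx : 0 < enorm x by rewrite lt_neqAle enorm_ge0 eq_sym enorm_eq0 x0.
pose e := (enorm x)^-1 *: x.
have ee : dot e e = 1.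
  by rewrite dotZl dotZr -enorm_sqr; field; rewrite gt_eqF.
pose p t := dot (c t) e.
pose q t := 2 / (1 - p t ^+ 2) * dot (derive1 c t) e.
have p1 (t : R) : 0 <= t <= 1 -> -1 < p t < 1.
  by move=> /cb ct; rewrite -ltr_norml; apply: le_lt_trans (dot_le _ ee) ct.
have dG (t : R) : 0 <= t <= 1 -> is_derive t 1 (G \o p) (q t).
  by move=> t01; apply: is_derive1_comp; [exact/G_derive/p1|exact: dot_derive].
have cq : {within `[0, 1], continuous q}.
  apply: continuous_in_subspaceT => t; rewrite inE/= in_itv/= => t01.
  have /andP[a b] := p1 _ t01.
  have pc : {for t, continuous p}.
    apply: dot_continuous; first exact: curve_continuous.
    exact: cst_continuous.
  apply: (@continuousM R R (fun t => 2 / (1 - p t ^+ 2))); last first.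
    by apply: dot_continuous; [exact: cc|exact: cst_continuous].
  apply: (@continuousM R R (fun=> 2)); first exact: cst_continuous.
  apply: (@continuousV R R (fun t => 1 - p t ^+ 2)).
    rewrite (_ : 1 - _ = (1 + p t) * (1 - p t)); last by ring.
    by rewrite gt_eqF// mulr_gt0//; lra.
  apply: (@continuousB R R R (fun=> 1) (fun t => p t ^+ 2)).
    exact: cst_continuous.
  exact: (@continuousM R R p p t pc pc).
have dGc (t : R) : 0 <= t <= 1 -> {for t, continuous (G \o p)}.
  move=> /dG H; apply: differentiable_continuous; apply/derivable1_diffP.
  exact: ex_derive.
have FTC := @continuous_FTC2 R q (G \o p) 0 1 ltr01 cq.
have pE0 : p 0 = 0 by rewrite /p c0 dot0l.
have pE1 : p 1 = enorm x.
  by rewrite /p c1 dotZr -enorm_sqr; field; rewrite gt_eqF.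
have : \int[lebesgue_measure]_(t in `[0, 1]) q t = G (enorm x).
  rewrite /Rintegral FTC/=.
  - by rewrite pE0 pE1 /G addr0 subr0 subrr subr0.
  - split.
    + by move=> t /[!in_itv]/= /andP[/ltW a /ltW b];
        have := dG t; rewrite a b => /(_ isT) H; exact: ex_derive.
    + by apply: cvg_at_right_filter; apply: dGc; rewrite lexx ler01.
    + by apply: cvg_at_left_filter; apply: dGc; rewrite lexx ler01.
  - move=> t /[!in_itv]/= /andP[/ltW a /ltW b].
    by have := dG t; rewrite a b => /(_ isT) H; rewrite derive1E derive_val.
move=> <-; apply: le_Rintegral => //.
- by apply: continuous_compact_integrable => //; exact: segment_compact.
- exact: speed_integrable hc.
move=> t /=; rewrite in_itv/= => t01.
rewrite hnormE; last exact: cb.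
have ct : dot (c t) (c t) < 1 by rewrite -hballE; exact: cb.
have pt : p t ^+ 2 <= dot (c t) (c t).
  rewrite -enorm_sqr -[p t ^+ 2]real_normK ?num_real//.
  by rewrite ler_pXn2r// ?nnegrE ?enorm_ge0//; exact: dot_le.
apply: (@le_trans _ _ (2 / (1 - p t ^+ 2) * enorm (derive1 c t))).
  apply: ler_wpM2l; first by rewrite divr_ge0//; lra.
  by apply: le_trans (dot_le _ ee); exact: ler_norm.
apply: ler_wpM2r; first exact: enorm_ge0.
by rewrite ler_wpM2l// lef_pV2 ?posrE; lra.
Qed.

Let ray_derive x (t : R) : is_derive t 1 (fun t : R => t *: x) x.
Proof.
have dx : derivable (fun t : R => t *: x) t 1.
  apply/derivable_mxP => i j.
  have H := is_deriveM (is_derive_id t 1) (is_derive_cst (x i j) t 1).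
  have -> : (fun s : R => (s *: x) i j) = (id * cst (x i j))%R.
    by apply/funext => s; rewrite mxE.
  exact: (ex_derive (f := (id * cst (x i j))%R)).
apply: DeriveDef => //; rewrite derive_mx//; apply/matrixP => i j.
rewrite !mxE.
have H := is_deriveM (is_derive_id t 1) (is_derive_cst (x i j) t 1).
have -> : (fun s : R => (s *: x) i j) = (id * cst (x i j))%R.
  by apply/funext => s; rewrite mxE.
by rewrite derive_val /GRing.scale/= mulr0 add0r mulr1.
Qed.

Let ray_hcurve x : hball x -> hcurve 0 x (fun t => t *: x).
Proof.
move=> bx.
have dE : derive1 (fun t : R => t *: x) = cst x.
  by apply/funext => t; have H := ray_derive x t; rewrite derive1E derive_val.
split.
- by move=> t; have := ray_derive x t => H; exact: ex_derive.
- by rewrite dE; exact: cst_continuous.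
- move=> t /andP[t0 t1]; apply: le_lt_trans bx.
  by rewrite enormZ ger0_norm// ler_piMl// enorm_ge0.
- by rewrite scale0r.
- by rewrite scale1r.
Qed.

Let ray_hlength x : hball x -> hlength (fun t => t *: x) = G (enorm x).
Proof.
move=> bx.
pose p (t : R) := t * enorm x.
pose q (t : R) := 2 / (1 - p t ^+ 2) * enorm x.
have dE : derive1 (fun t : R => t *: x) = cst x.
  by apply/funext => t; have H := ray_derive x t; rewrite derive1E derive_val.
have p1 (t : R) : 0 <= t <= 1 -> -1 < p t < 1.
  move=> /andP[t0 t1]; rewrite -ltr_norml; apply: le_lt_trans bx.
  by rewrite /p normrM !ger0_norm ?enorm_ge0// ler_piMl// enorm_ge0.
have dp (t : R) : is_derive t 1 p (enorm x).
  have H := is_deriveM (is_derive_id t 1) (is_derive_cst (enorm x) t 1).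
  by apply: (is_derive_eq H); rewrite /GRing.scale/= mulr0 add0r mulr1.
have cp (t : R) : {for t, continuous p}.
  by apply: differentiable_continuous; apply/derivable1_diffP; exact: ex_derive.
have dG (t : R) : 0 <= t <= 1 -> is_derive t 1 (G \o p) (q t).
  by move=> t01; apply: is_derive1_comp; exact/G_derive/p1.
have cq : {within `[0, 1], continuous q}.
  apply: continuous_in_subspaceT => t; rewrite inE/= in_itv/= => t01.
  have /andP[a b] := p1 _ t01.
  apply: (@continuousM R R (fun t => 2 / (1 - p t ^+ 2))); last first.
    exact: cst_continuous.
  apply: (@continuousM R R (fun=> 2)); first exact: cst_continuous.
  apply: (@continuousV R R (fun t => 1 - p t ^+ 2)).
    rewrite (_ : 1 - _ = (1 + p t) * (1 - p t)); last by ring.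
    by rewrite gt_eqF// mulr_gt0//; lra.
  apply: (@continuousB R R R (fun=> 1) (fun t => p t ^+ 2)).
    exact: cst_continuous.
  exact: (@continuousM R R p p t (cp t) (cp t)).
have dGc (t : R) : 0 <= t <= 1 -> {for t, continuous (G \o p)}.
  move=> /dG H; apply: differentiable_continuous; apply/derivable1_diffP.
  exact: ex_derive.
have FTC := @continuous_FTC2 R q (G \o p) 0 1 ltr01 cq.
rewrite /hlength dE.
have -> : \int[lebesgue_measure]_(t in `[0, 1]) hnorm (t *: x) (cst x t) =
          \int[lebesgue_measure]_(t in `[0, 1]) q t.
  apply: eq_Rintegral => t; rewrite inE/= in_itv/= => /andP[t0 t1].
  rewrite hnormE/=; last first.
    have [_ _ + _ _] := ray_hcurve bx; apply; exact/andP.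
  by rewrite /q /conf dotZl dotZr -enorm_sqr /p; congr (2 / (1 - _) * _); ring.
rewrite /Rintegral FTC/=.
- by rewrite /p mul0r mul1r /G addr0 subr0 subrr subr0.
- split.
  + by move=> t /[!in_itv]/= /andP[/ltW a /ltW b];
      have := dG t; rewrite a b => /(_ isT) H; exact: ex_derive.
  + by apply: cvg_at_right_filter; apply: dGc; rewrite lexx ler01.
  + by apply: cvg_at_left_filter; apply: dGc; rewrite lexx ler01.
- move=> t /[!in_itv]/= /andP[/ltW a /ltW b].
  by have := dG t; rewrite a b => /(_ isT) H; rewrite derive1E derive_val.
Qed.

Lemma hrhoE x : hball x -> hrho x = ln ((1 + enorm x) / (1 - enorm x)).
Proof.
move=> bx; have x0 := enorm_ge0 x; have x1 : 0 < 1 - enorm x by rewrite subr_gt0.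
rewrite ln_div ?posrE//; last by rewrite ltr_wpDr.
rewrite -/(G (enorm x)); apply/eqP; rewrite eq_le; apply/andP; split.
  apply: ge_inf.
    by exists (G (enorm x)) => _ [c hc <-]; exact: hlength_lb.
  by exists (fun t => t *: x); [exact: ray_hcurve|exact: ray_hlength].
apply: lb_le_inf; last by move=> _ [c hc <-]; exact: hlength_lb.
by exists (hlength (fun t => t *: x)), (fun t => t *: x) => //; exact: ray_hcurve.
Qed.

Lemma enorm_hexp0 v : enorm (hexp0 v) = tanh (hnorm 0 v / 2).
Proof.
rewrite enormZ; have [->|v0] := eqVneq v 0.
  have -> : enorm (0 : 'rV[R]_n) = 0 by apply/eqP; rewrite enorm_eq0.
  rewrite hnorm0E.
  have -> : enorm (0 : 'rV[R]_n) = 0 by apply/eqP; rewrite enorm_eq0.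
  by rewrite !mulr0 mul0r /tanh /sinh oppr0 subrr !mul0r.
have nv : enorm v != 0 by rewrite enorm_eq0.
rewrite normrM normfV (ger0_norm (enorm_ge0 _)) -mulrA mulVf// mulr1.
rewrite ger0_norm// /tanh /sinh /cosh hnorm0E.
have v1 := enorm_ge0 v.
have h : expR (- (2 * enorm v / 2)) <= expR (2 * enorm v / 2).
  by rewrite ler_expR; lra.
by rewrite divr_ge0//; rewrite divr_ge0// subr_ge0.
Qed.

Lemma tanhE (t : R) : tanh (t / 2) = (expR t - 1) / (expR t + 1).
Proof.
have e0 := expR_gt0 (t / 2).
have -> : expR t = expR (t / 2) ^+ 2 by rewrite expr2 -expRD; congr expR; field.
rewrite /tanh /sinh /cosh expRN; field.
by rewrite !gt_eqF//= ?addr_gt0 ?exprn_gt0.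
Qed.

Lemma hball_hexp0 v : hball (hexp0 v).
Proof.
rewrite /hball/= enorm_hexp0 tanhE ltr_pdivrMr; have := expR_gt0 (hnorm 0 v); lra.
Qed.

Lemma hrho_hexp0 v : hrho (hexp0 v) = hnorm 0 v.
Proof.
rewrite hrhoE; last exact: hball_hexp0.
rewrite enorm_hexp0 tanhE -[RHS]expRK; congr ln.
have e0 := expR_gt0 (hnorm 0 v); field.
by apply/andP; split; rewrite gt_eqF//; lra.
Qed.

Lemma hnorm_hdir x : x != 0 -> hnorm 0 (hdir x) = 1.
Proof.
move=> x0; have x1 : 0 < enorm x by rewrite lt_neqAle enorm_ge0 eq_sym enorm_eq0 x0.
rewrite hnorm0E /hdir enormZ hnorm0E ger0_norm; last by rewrite invr_ge0; lra.
by field; rewrite gt_eqF.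
Qed.

Lemma hexp0_hdir x : hball x -> hexp0 (hrho x *: hdir x) = x.
Proof.
move=> bx; have [x0|x0] := eqVneq x 0.
  by rewrite /hdir x0 !scaler0 /hexp0 scaler0.
have nx : 0 < enorm x by rewrite lt_neqAle enorm_ge0 eq_sym enorm_eq0 x0.
have x1 : enorm x < 1 by [].
have u : 0 < 1 - enorm x by lra.
have r0 : 0 < hrho x.
  rewrite hrhoE// ln_gt0// ltr_pdivlMr//; lra.
have eE : enorm (hrho x *: hdir x) = hrho x / 2.
  rewrite enormZ gtr0_norm//; congr (_ * _).
  by have := hnorm_hdir x0; rewrite hnorm0E; lra.
rewrite /hexp0 hnorm0E eE.
have -> : 2 * (hrho x / 2) / 2 = hrho x / 2 by field.
rewrite tanhE {1 2}(hrhoE bx) lnK; last by rewrite posrE divr_gt0//; lra.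
rewrite /hdir hnorm0E !scalerA -[RHS]scale1r; congr (_ *: _).
by field; rewrite !gt_eqF//=; lra.
Qed.

End facts.

(* Main.v *)
Require Import Defs.
From HB Require Import structures.
From mathcomp Require Import all_boot all_order all_algebra.
From mathcomp Require Import ring lra.
From mathcomp Require Import all_classical all_reals all_analysis.
From mathcomp Require Import measurable_realfun.
Set Implicit Arguments.
Unset Strict Implicit.
Unset Printing Implicit Defensive.
Import Order.TTheory GRing.Theory Num.Def Num.Theory.
Import numFieldNormedType.Exports.
Local Open Scope classical_set_scope.
Local Open Scope ring_scope.


(* Let [Phi t = t `^ ((2 - N) / 2) * J_alpha (z t / r)] and [psi = Phi' / Phi].
   Bessel's equation is the Riccati equation
     psi' = - psi ^ 2 - (N - 1) / t * psi - c / t ^ 2 - z ^ 2 / r ^ 2,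
   and expanding the square in [|Phi|^2 |(f / Phi)'|^2 = (f' - psi f)^2] shows
   that, along a geodesic ray, the difference of the two sides of the radial
   identity, multiplied by [sinh ^ (N - 1)], is the derivative of
   [f ^ 2 * psi * sinh ^ (N - 1)]. This vanishes at both ends of the ray:
   [f ^ 2 * psi] tends to 0 at [r], where [f = 0] and [psi] has a simple pole,
   and [psi sinh ^ (N - 1)] tends to 0 at 0 ([psi] is bounded there if [N = 2],
   for then [alpha = 0]). The full gradient differs from the radial derivative
   by a tangential part that [Phi] does not see. The last inequality holds
   because [psi <= 0] and [t cosh t >= sinh t]. *)

(** * Derivatives, and the functional equation of Gamma *)

(** The integrals of the statement are extended reals, so their differences are meaningful only once
    each term is finite. Hence the class [admissible]: continuous integrands dominated by the weight
    [sing], which is integrable in every dimension [N >= 2]. The case [N = 2] shapes the bounds: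
    there the Hardy integral may diverge, and only its product with the coefficient, which is then
    0, is finite. Rays are integrated over an annulus [1 < |y| < 2] of directions instead of the
    unit sphere, with the points of a ray written as Euclidean multiples [t *: y]. On the Bessel
    side, [J_alpha] is [(t / 2) ^ alpha] times an entire series in [u = t ^ 2 / 4]. The functional
    equation of Gamma is the recursion of its coefficients; the recursion gives a differential
    equation, and this equation gives the signs of the series and of its derivative up to the first
    zero. Both [psi <= 0] and the order of the pole of [psi] come from these signs. The gradient
    identity is the radial one with the same tangential term added to both sides. *)

Section derive_aux.
Context {R : realType}.

Lemma is_derive_derivable (V : normedModType R) (f : V -> R) (x v : V) (df : R) :
  is_derive x v f df -> derivable f x v.
Proof. by move=> H; exact: ex_derive. Qed.

Lemma is_derive_continuous (f : R -> R) (x df : R) :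
  is_derive x 1 f df -> {for x, continuous f}.
Proof.
move=> H; apply: differentiable_continuous; apply/derivable1_diffP.
exact: ex_derive.
Qed.

Lemma is_derive1E (f : R -> R) (x df : R) : is_derive x 1 f df -> derive1 f x = df.
Proof. by move=> H; rewrite derive1E derive_val. Qed.

End derive_aux.

Section gamma.
Context {R : realType}.
Implicit Types (p s t : R).
Notation mu := (@lebesgue_measure R).

(** The inequality [ln q <= q - 1] at [q = s / (2 p)] gives [q ^ p <= e ^ (s / 2)], whence the
    constant [(2 p) ^ p]. The bound serves the integrability of the Gamma integrand, its decay at
    infinity, and the sign condition in [GammaS]. *)
Lemma powR_expR_bound p : 0 <= p ->
  exists2 C : R, 0 < C & forall s, 0 <= s ->
    s `^ p * expR (- s) <= C * expR (- (s / 2)).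
Proof.
rewrite le_eqVlt => /predU1P[<-|p0].
  exists 1 => // s s0; rewrite powRr0 !mul1r ler_expR; lra.
exists ((2 * p) `^ p); first by rewrite powR_gt0; lra.
move=> s; rewrite le_eqVlt => /predU1P[<-|s0].
  by rewrite powR0 ?gt_eqF// mul0r mulr_ge0 ?powR_ge0 ?expR_ge0.
have -> : s = 2 * p * (s / (2 * p)) by field; lra.
set q := s / (2 * p).
have q0 : 0 < q by rewrite divr_gt0//; lra.
rewrite powRM; [|lra|exact: ltW].
rewrite -mulrA ler_pM2l; last by rewrite powR_gt0; lra.
rewrite {1}/powR gt_eqF// -expRD ler_expR.
have : p * ln q <= p * (q - 1).
  by rewrite ler_pM2l// lerBrDl; have := @le_ln1Dx R (q - 1); rewrite (_ : 1 + (q - 1) = q); lra.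
lra.
Qed.

Lemma powR_continuous_ge0 p : 0 <= p ->
  {within `[0, +oo[, continuous (fun s : R => s `^ p)}.
Proof.
rewrite le_eqVlt => /predU1P[<-|p0].
  rewrite (_ : (fun s : R => s `^ 0) = cst 1); first exact/continuous_subspaceT/cst_continuous.
  by apply/funext => s; rewrite powRr0.
apply/continuous_within_itvcyP; split.
  move=> s; rewrite in_itv/= andbT => s0.
  exact: is_derive_continuous (is_derive1_powR p s0).
by rewrite powR0 ?gt_eqF//; exact: powR_cvg0.
Qed.

Lemma cvg_expR_half_y : expR (- (s / 2)) @[s --> +oo%R] --> (0 : R).
Proof.
apply/cvgrPdist_le => /= e e0; near=> s.
rewrite sub0r normrN ger0_norm ?expR_ge0//.
rewrite -[leRHS](@lnK R)// ler_expR.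
suff : - 2 * ln e <= s by lra.
by near: s; apply: nbhs_pinfty_ge; rewrite num_real.
Unshelve. all: by end_near. Qed.

Lemma is_derive_expR_half (s : R) :
  is_derive s 1 (fun s => expR (- (s / 2))) (- (1 / 2) * expR (- (s / 2))).
Proof.
have H : is_derive s 1 (fun s : R => - (s / 2)) (- (1 / 2)).
  have := is_deriveZ (- (1 / 2)) (is_derive_id s 1).
  rewrite (_ : _ \*: _ = (fun s : R => - (s / 2))); last by apply/funext => x /=; rewrite /GRing.scale/=; lra.
  by move=> K; apply: (is_derive_eq K); rewrite /GRing.scale/= mulr1.
have := @is_derive1_comp R expR (fun s : R => - (s / 2)) s _ _ (is_derive_expR _) H.
by move=> K; apply: (is_derive_eq K); rewrite mulrC.
Qed.

Lemma is_derive_expRN (s : R) :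
  is_derive s 1 (fun s => expR (- s)) (- expR (- s)).
Proof.
have H := @is_derive1_comp R expR -%R s _ _ (is_derive_expR _) (is_deriveN (is_derive_id s 1)).
by apply: (is_derive_eq H); rewrite mulrN1.
Qed.

Lemma continuous_expRN : continuous (fun s : R => expR (- s)).
Proof.
by move=> s; exact: is_derive_continuous (is_derive_expRN s).
Qed.

Lemma continuous_expR_half : continuous (fun s : R => expR (- (s / 2))).
Proof.
by move=> s; exact: is_derive_continuous (is_derive_expR_half s).
Qed.

Lemma within_continuousM (A : set R) (f g : R -> R) :
  {within A, continuous f} -> {within A, continuous g} ->
  {within A, continuous (fun x => f x * g x)}.
Proof. by move=> cf cg x; exact: (@continuousM R (subspace A) f g x (cf x) (cg x)). Qed.

Lemma within_continuousD (A : set R) (f g : R -> R) :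
  {within A, continuous f} -> {within A, continuous g} ->
  {within A, continuous (fun x => f x + g x)}.
Proof. by move=> cf cg x; exact: (@continuousD R R (subspace A) f g x (cf x) (cg x)). Qed.

Lemma gamma_integrand_continuous p : 0 <= p ->
  {within `[0, +oo[, continuous (fun s : R => s `^ p * expR (- s))}.
Proof.
move=> p0; apply: within_continuousM; first exact: powR_continuous_ge0.
exact/continuous_subspaceT/continuous_expRN.
Qed.

Lemma integral_expR_half :
  (\int[mu]_(s in `[0%R, +oo[) (expR (- (s / 2)))%:E = 2%:E)%E.
Proof.
rewrite (@ge0_continuous_FTC2y R _ (fun s => - 2 * expR (- (s / 2))) 0 0).
- by rewrite mul0r oppr0 expR0 -EFinB; congr EFin; lra.
- by move=> x _; exact: expR_ge0.
- exact/continuous_subspaceT/continuous_expR_half.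
- have := @cvgMl_tmp _ _ _ _ _ (- 2) _ cvg_expR_half_y; rewrite mulr0; exact.
- by move=> x x0; have H := is_deriveZ (- 2) (is_derive_expR_half x); exact: is_derive_derivable H.
- apply: cvg_at_right_filter; apply: cvgMl_tmp; exact: continuous_expR_half.
- move=> x _; have H := is_deriveZ (- 2) (is_derive_expR_half x).
  rewrite (is_derive1E H) /GRing.scale/=; lra.
Qed.

Lemma integrable_expR_half :
  mu.-integrable `[0, +oo[ (fun s => (expR (- (s / 2)))%:E).
Proof.
apply/integrableP; split.
  apply/measurable_EFinP; apply: measurable_funTS.
  exact: continuous_measurable_fun continuous_expR_half.
under eq_integral do rewrite gee0_abs ?lee_fin ?expR_ge0//.
by rewrite integral_expR_half ltry.
Qed.

Lemma measurable_gamma_integrand p (D : set (measurableTypeR R)) : measurable D ->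
  measurable_fun D (fun s : R => s `^ p * expR (- s)).
Proof.
move=> mD; apply: measurable_funM.
  by apply: measurable_funTS; exact: measurable_powR.
by apply: measurable_funTS; exact: continuous_measurable_fun continuous_expRN.
Qed.

Lemma integrable_gamma p : 0 <= p ->
  mu.-integrable `[0, +oo[ (fun s => (s `^ p * expR (- s))%:E).
Proof.
move=> /powR_expR_bound[C C0 HC].
apply: (@le_integrable _ _ _ mu _ _ _ (fun s => (C * expR (- (s / 2)))%:E)) => //=.
- by apply/measurable_EFinP; exact: measurable_gamma_integrand.
- move=> s; rewrite in_itv/= andbT => s0; rewrite lee_fin !ger0_norm ?HC//.
    by rewrite mulr_ge0 ?expR_ge0// ltW.
  by rewrite mulr_ge0 ?expR_ge0// powR_ge0.
- rewrite (_ : (fun _ => _) = (fun s => C%:E * (expR (- (s / 2)))%:E)%E)//.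
  by apply: integrableZl => //; exact: integrable_expR_half.
Qed.

Lemma Gamma_cbnd t :
  (Gamma t)  = \int[mu]_(s in `[0, +oo[) (s `^ (t - 1) * expR (- s)).
Proof.
rewrite /Gamma /Rintegral integral_itv_obnd_cbnd//.
by apply/measurable_EFinP; exact: measurable_gamma_integrand.
Qed.

Lemma Gamma_gt0 t : 1 <= t -> 0 < Gamma t.
Proof.
move=> t1; have ? : 0 <= t - 1 by lra.
(* The integrand is at least [e ^ (- 2)] on [[1, 2]], an interval of length 1. *)
rewrite Gamma_cbnd; apply: (@lt_le_trans _ _ (expR (- 2))); first exact: expR_gt0.
have -> : expR (- 2) = \int[mu]_(s in `[(1 : R), 2]) expR (- 2).
  rewrite /Rintegral integral_cst//= lebesgue_measure_itv/= lte_fin ifT; last by lra.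
  by rewrite -EFinB -EFinM/=; lra.
have s12 : `[(1 : R), 2] `<=` `[0, +oo[.
  by move=> x /=; rewrite !in_itv/= andbT; lra.
apply: (@le_trans _ _ (\int[mu]_(s in `[1, 2]) (s `^ (t - 1) * expR (- s)))).
  apply: le_Rintegral => //=.
  - apply/integrableP; split; first exact/measurable_EFinP.
    rewrite integral_cst//= lebesgue_measure_itv/= lte_fin ifT; last by lra.
    by rewrite -EFinB -EFinM ltry.
  - by apply: integrableS (integrable_gamma _).
  move=> s; rewrite in_itv/= => /andP[s1 s2].
  rewrite -[leLHS]mul1r ler_pM ?expR_ge0//; last by rewrite ler_expR; lra.
  by have := @ler_powR R s s1 0 (t - 1) _; rewrite powRr0; apply.
rewrite /Rintegral fine_le//.
- by apply: integrable_fin_num => //; apply: integrableS (integrable_gamma _).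
- by apply: integrable_fin_num => //; exact: integrable_gamma.
apply: ge0_subset_integral => //.
- by apply/measurable_EFinP; exact: measurable_gamma_integrand.
- by move=> s _; rewrite lee_fin mulr_ge0 ?powR_ge0 ?expR_ge0.
Qed.

(** Integration by parts on [[0, +oo[]. The fundamental theorem used, [ge0_continuous_FTC2y], asks
    for a nonnegative integrand, while the derivative of [- s ^ t e ^ (- s)] changes sign. The
    multiple [t * C * e], which dominates the negative part and has a known integral, is therefore
    added, and removed at the end. For [1 <= t] both powers are continuous at 0. *)
Lemma GammaS t : 1 <= t -> Gamma (t + 1) = t * Gamma t.
Proof.
move=> t1; have tp : 0 <= t - 1 by lra.
have [C C0 HC] := powR_expR_bound tp.
have t0 : 0 <= t by lra.
have [C' C'0 HC'] := powR_expR_bound t0.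
pose e s : R := expR (- (s / 2)).
pose w p s : R := s `^ p * expR (- s).
pose f s := w t s + (t * C * e s - t * w (t - 1) s).
pose F s := - w t s - 2 * t * C * e s.
have dF (x : R) : 0 < x -> is_derive x 1 F (f x).
  move=> x0.
  have H1 := is_deriveM (is_derive1_powR t x0) (is_derive_expRN x).
  have H2 := is_deriveB (is_deriveN H1) (is_deriveZ (2 * t * C) (is_derive_expR_half x)).
  apply: (is_derive_eq H2); rewrite /f /w /e /GRing.scale/=; lra.
have we : w t x @[x --> +oo%R] --> (0 : R).
  have c0 : cst (0 : R) x @[x --> (+oo%R : set_system R)] --> (0 : R) by exact: cvg_cst.
  have cC := @cvgMl_tmp _ _ _ _ _ C' _ cvg_expR_half_y; rewrite mulr0 in cC.
  apply: (squeeze_cvgr _ c0 (cC _)).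
  near=> x; rewrite /cst mulr_ge0 ?powR_ge0 ?expR_ge0//=.
  by apply: HC'; near: x; apply: nbhs_pinfty_ge; rewrite num_real.
have If : (\int[mu]_(s in `[0%R, +oo[) (f s)%:E = (2 * t * C)%:E)%E.
  rewrite (@ge0_continuous_FTC2y R f F 0 0).
  - rewrite /F /w /e mul0r oppr0 expR0 powR0; last by rewrite gt_eqF//; lra.
    by rewrite -EFinB; congr EFin; lra.
  - move=> x x0; rewrite addr_ge0 ?mulr_ge0 ?powR_ge0 ?expR_ge0//.
    by rewrite subr_ge0 -mulrA ler_wpM2l// HC.
  - apply: within_continuousD; first exact: gamma_integrand_continuous.
    apply: within_continuousD.
      apply: within_continuousM; first exact/continuous_subspaceT/cst_continuous.
      exact/continuous_subspaceT/continuous_expR_half.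
    rewrite (_ : (fun x => - (t * w (t - 1) x)) = (fun x => - t * w (t - 1) x)); last first.
      by apply/funext => x; rewrite mulNr.
    apply: within_continuousM; first exact/continuous_subspaceT/cst_continuous.
    exact: gamma_integrand_continuous.
  - have := cvgB (cvgN we) (@cvgMl_tmp _ _ _ _ _ (2 * t * C) _ cvg_expR_half_y).
    by rewrite mulr0 subr0 oppr0; exact.
  - by move=> x x0; exact: is_derive_derivable (dF _ x0).
  - have wc : w t x @[x --> 0^'+] --> w t 0.
      by have /continuous_within_itvcyP[_] := gamma_integrand_continuous t0.
    apply: cvgB; first exact: cvgN.
    by apply: cvg_at_right_filter; apply: cvgMl_tmp; exact: continuous_expR_half.
  - move=> x; rewrite in_itv/= andbT => x0.
    by rewrite (is_derive1E (dF _ x0)).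
have i1 : mu.-integrable `[0, +oo[ (EFin \o w t) by exact: integrable_gamma.
have i2 : mu.-integrable `[0, +oo[ (EFin \o w (t - 1)) by exact: integrable_gamma.
have i3 : mu.-integrable `[0, +oo[ (EFin \o e) by exact: integrable_expR_half.
have iZ k (g : R -> R) : mu.-integrable `[0, +oo[ (EFin \o g) ->
    mu.-integrable `[0, +oo[ (EFin \o (fun s => k * g s)).
  by move=> ig; rewrite (_ : _ \o _ = (fun x => k%:E * (EFin \o g) x)%E)//; exact: integrableZl.
have : \int[mu]_(s in `[0%R, +oo[) f s = 2 * t * C by rewrite /Rintegral If.
rewrite RintegralD//=; last exact: integrableB (iZ _ _ i3) (iZ _ _ i2).
rewrite RintegralB//; [|exact: iZ|exact: iZ].
rewrite !RintegralZl//.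
have -> : \int[mu]_(s in `[0%R, +oo[) e s = 2 by rewrite /Rintegral integral_expR_half.
have -> : \int[mu]_(s in `[0%R, +oo[) w t s = Gamma (t + 1).
  by rewrite Gamma_cbnd addrK.
rewrite -/(w _) -Gamma_cbnd; lra.
Unshelve. all: by end_near. Qed.

End gamma.

(** * The power series of the Bessel function *)

Section entire.
Context {R : realType}.
Implicit Types (c : R^nat) (x : R).

(** A domination by the exponential series that survives formal differentiation with the same [A].
    The series and all its formal derivatives then converge everywhere, which is what termwise
    differentiation requires. *)
Definition fact_bounded c := exists2 A : R, 0 <= A & forall m, `|c m| <= A / m`!%:R.

Lemma fact_bounded_diffs c : fact_bounded c -> fact_bounded (pseries_diffs c).
Proof.
move=> [A A0 cA]; exists A => // m.
rewrite /pseries_diffs normrM ger0_norm//.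
apply: (le_trans (ler_wpM2l _ (cA m.+1))) => //.
rewrite factS natrM invfM mulrCA mulrA mulrA mulfK//.
Qed.

Lemma fact_bounded_cvg c x : fact_bounded c -> cvgn (pseries c x).
Proof.
move=> [A A0 cA]; apply: normed_cvg.
apply: (@series_le_cvg _ _ (fun n => A * exp_coeff `|x| n)).
- by move=> n; exact: normr_ge0.
- by move=> n; rewrite mulr_ge0// exp_coeff_ge0.
- move=> n /=; rewrite normrM normrX /exp_coeff/= [X in _ <= _ * X]mulrC mulrA.
  by rewrite ler_wpM2r// exprn_ge0.
- by apply: is_cvg_seriesZ; exact: is_cvg_series_exp_coeff.
Qed.

Lemma is_derive_pseries c x : fact_bounded c ->
  is_derive x 1 (fun x => limn (pseries c x)) (limn (pseries (pseries_diffs c) x)).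
Proof.
move=> fc; apply: (@pseries_snd_diffs _ _ (`|x| + 1)).
- exact: fact_bounded_cvg.
- by apply: fact_bounded_cvg; exact: fact_bounded_diffs.
- by apply: fact_bounded_cvg; do 2 apply: fact_bounded_diffs.
- by rewrite [ltRHS]ger0_norm ?addr_ge0// ltrDl.
Qed.

End entire.

Section bessel.
Context {R : realType}.
Implicit Types (a u t : R) (m : nat).

Definition bcoef a m : R := (-1) ^+ m / (m`!%:R * Gamma (m%:R + a + 1)).

Lemma bcoef0_gt0 a : 0 <= a -> 0 < bcoef a 0.
Proof.
move=> a0; rewrite /bcoef expr0 fact0 divr_gt0// mul1r; apply: Gamma_gt0; lra.
Qed.

(** This is the functional equation of Gamma at [m + a + 1 >= 1]. With the sign of [bcoef a 0], it
    is all that the study of the series takes from Gamma. *)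
Lemma bcoefS a m : 0 <= a ->
  bcoef a m.+1 = - bcoef a m / (m.+1%:R * (m.+1%:R + a)).
Proof.
move=> a0; have m0 : 0 <= m%:R :> R by [].
have G0 : 0 < Gamma (m%:R + a + 1) :> R by apply: Gamma_gt0; lra.
rewrite /bcoef (_ : m.+1%:R + a + 1 = m%:R + a + 1 + 1); last by rewrite -natr1; ring.
rewrite GammaS; last lra.
rewrite factS natrM exprS -natr1; field.
have f0 : m`!%:R != 0 :> R by rewrite pnatr_eq0 -lt0n fact_gt0.
by rewrite f0 !lt0r_neq0//; lra.
Qed.

Lemma bcoef_bounded a : 0 <= a -> fact_bounded (bcoef a).
Proof.
move=> a0; exists `|bcoef a 0| => //; elim=> [|m IH]; first by rewrite fact0 divr1.
have m0 : 0 <= m%:R :> R by [].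
have -> : `|bcoef a 0| / (m.+1)`!%:R = `|bcoef a 0| / m`!%:R * m.+1%:R^-1.
  by rewrite factS [(_ * _)%:R]natrM invfM [in LHS]mulrCA [in LHS]mulrC.
rewrite bcoefS// normrM normrN normfV.
apply: ler_pM => //; rewrite ger0_norm; last by rewrite mulr_ge0// addr_ge0.
rewrite lef_pV2 ?posrE ?ltr0n//; first by rewrite ler_peMr// -natr1; lra.
by rewrite mulr_gt0// -natr1; lra.
Qed.

(** The entire factor of the Bessel function: [besselJ a t] is [(t / 2) ^ a] times its value at
    [u = t ^ 2 / 4] (see [besselJE]). In this variable nothing is singular at 0. *)
Definition bser a u : R := limn (pseries (bcoef a) u).
Definition bser1 a u : R := limn (pseries (pseries_diffs (bcoef a)) u).
Definition bser2 a u : R := limn (pseries (pseries_diffs (pseries_diffs (bcoef a))) u).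

Lemma is_derive_bser a u : 0 <= a -> is_derive u 1 (bser a) (bser1 a u).
Proof. by move=> a0; apply: is_derive_pseries; exact: bcoef_bounded. Qed.

Lemma is_derive_bser1 a u : 0 <= a -> is_derive u 1 (bser1 a) (bser2 a u).
Proof.
by move=> a0; apply: is_derive_pseries; apply: fact_bounded_diffs; exact: bcoef_bounded.
Qed.

Lemma continuous_bser a : 0 <= a -> continuous (bser a).
Proof. by move=> a0 u; exact: is_derive_continuous (is_derive_bser u a0). Qed.

Lemma continuous_bser1 a : 0 <= a -> continuous (bser1 a).
Proof. by move=> a0 u; exact: is_derive_continuous (is_derive_bser1 u a0). Qed.

Lemma pseries0 (c : R^nat) : limn (pseries c 0) = c 0.
Proof.
apply/cvg_lim => //; rewrite -cvg_shiftS /=.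
rewrite (_ : (fun n => _) = cst (c 0)); first exact: cvg_cst.
apply/funext => n; rewrite /pseries /series/= big_nat_recl//= expr0 mulr1 big1 ?addr0//.
by move=> i _; rewrite expr0n/= mulr0.
Qed.

Lemma bser_0 a : bser a 0 = bcoef a 0. Proof. exact: pseries0. Qed.

Lemma bser1_0 a : 0 <= a -> bser1 a 0 = - bcoef a 0 / (1 + a).
Proof. by move=> a0; rewrite /bser1 pseries0 /pseries_diffs bcoefS// mul1r mul1r. Qed.

(** Bessel's equation in the variable [u]. The second derivative is taken in the unshifted form
    [i * c_i * u ^ (i - 1)], so that multiplying by [u] restores [u ^ i]; the coefficient of [u ^ i]
    then vanishes by [bcoefS]. *)
Lemma bser_ode a u : 0 <= a ->
  u * bser2 a u + (a + 1) * bser1 a u + bser a u = 0.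
Proof.
move=> a0; have f0 := bcoef_bounded a0; have f1 := fact_bounded_diffs f0.
have f2 := fact_bounded_diffs f1.
have c0 := fact_bounded_cvg (x := u) f0; have c1 := fact_bounded_cvg (x := u) f1.
have c2 := pseries_diffs_equiv (fact_bounded_cvg (x := u) f2).
have H := cvgD (cvgD (@cvgMl_tmp _ _ _ _ _ u _ c2) (@cvgMl_tmp _ _ _ _ _ (a + 1) _ c1)) c0.
have := cvg_unique (@norm_hausdorff _ _) (H _ _ _ _).
rewrite -/(bser2 _ _) -/(bser1 _ _) -/(bser _ _); apply.
rewrite (_ : _ + _ = cst 0); first exact: cvg_cst.
apply/funext => n; rewrite !fctE /pseries /series/= !mulr_sumr -!big_split/= big1// => i _.
rewrite /pseries_diffs bcoefS//.
have i0 : 0 <= i%:R :> R by [].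
(* At [i = 0] the exponent [i.-1] is 0 instead of [- 1], but the factor [i%:R] cancels that term. *)
case: i i0 => [|i] i0; rewrite ?expr0 ?exprS -?natr1/=; field; rewrite !gt_eqF//; lra.
Qed.

Lemma besselJE a t : 0 <= a -> 0 < t ->
  besselJ a t = (t / 2) `^ a * bser a (t ^+ 2 / 4).
Proof.
move=> a0 t0; have c0 := fact_bounded_cvg (x := t ^+ 2 / 4) (bcoef_bounded a0).
apply/cvg_lim => //.
have := @cvgMl_tmp _ _ _ _ _ ((t / 2) `^ a) _ c0; rewrite -/(bser _ _).
rewrite (_ : (fun _ => _) = series (fun m => (-1) ^+ m / (m`!%:R * Gamma (m%:R + a + 1)) *
    (t / 2) `^ (2 * m%:R + a))); first by move=> H; exact: (H _).
apply/funext => n; rewrite /pseries /series/= mulr_sumr; apply: eq_bigr => m _.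
rewrite powRD; last by apply/implyP => _; rewrite gt_eqF// divr_gt0.
rewrite -natrM powR_mulrn; last by rewrite divr_ge0// ltW.
rewrite /bcoef exprM (_ : (t / 2) ^+ 2 = t ^+ 2 / 4); last by field.
by ring.
Qed.

Lemma is_derive_besselJ a t : 0 <= a -> 0 < t ->
  is_derive t 1 (besselJ a)
    ((t / 2) `^ a * (a / t * bser a (t ^+ 2 / 4) + t / 2 * bser1 a (t ^+ 2 / 4))).
Proof.
move=> a0 t0.
have H1 : is_derive t 1 (fun t : R => t / 2) (1 / 2).
  have := is_deriveZ (1 / 2) (is_derive_id t 1).
  rewrite (_ : _ \*: _ = (fun t : R => t / 2)); last by apply/funext => x /=; rewrite /GRing.scale/=; lra.
  by move=> K; apply: (is_derive_eq K); rewrite /GRing.scale/= mulr1.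
have t20 : 0 < t / 2 by rewrite divr_gt0.
have H2 := @is_derive1_comp R (fun x => x `^ a) _ t _ _ (is_derive1_powR a t20) H1.
have H3 : is_derive t 1 (fun t : R => t ^+ 2 / 4) (t / 2).
  have := is_deriveM H1 H1.
  rewrite (_ : _ * _ = (fun t : R => t ^+ 2 / 4)); last by apply/funext => x /=; rewrite !fctE; field.
  by move=> K; apply: (is_derive_eq K); rewrite /GRing.scale/=; field.
have H4 := @is_derive1_comp R (bser a) _ t _ _ (is_derive_bser _ a0) H3.
have H := is_deriveM H2 H4.
apply: (@near_eq_is_derive _ _ _ (fun t => (t / 2) `^ a * bser a (t ^+ 2 / 4))) => //.
  near=> s; rewrite besselJE//; near: s; exact: lt_nbhsr.
apply: (is_derive_eq H).
rewrite powRB; last by apply/implyP => _; rewrite gt_eqF.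
rewrite powRr1 ?ltW// /GRing.scale/=; field; rewrite gt_eqF//.
Unshelve. all: by end_near. Qed.

End bessel.

(** * Signs of the Bessel series and of its derivative up to the first zero *)

Section first_zero.
Context {R : realType}.
Variables (a z : R).
Hypotheses (a0 : 0 <= a) (hz : first_zero (besselJ a) z).
Let U := z ^+ 2 / 4.

Let z0 : 0 < z. Proof. by case: hz. Qed.
Let U0 : 0 < U. Proof. by rewrite /U divr_gt0// exprn_gt0. Qed.

Lemma bser_first_zero : bser a U = 0.
Proof.
case: hz => _ + _; rewrite besselJE// => /eqP; rewrite mulf_eq0.
by rewrite gt_eqF/= ?powR_gt0 ?divr_gt0// => /eqP.
Qed.

Let bser_neq0 u : 0 < u < U -> bser a u != 0.
Proof.
move=> /andP[u0 uU]; case: hz => _ _ /(_ (2 * Num.sqrt u)).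
have s0 : 0 < Num.sqrt u by rewrite sqrtr_gt0.
have sz : 2 * Num.sqrt u < z.
  rewrite -(ltr_pXn2r (n := 2))// ?nnegrE; [|by rewrite mulr_ge0// ltW|exact: ltW].
  by rewrite exprMn sqr_sqrtr ?ltW//; move: uU; rewrite /U; lra.
have t0 : 0 < 2 * Num.sqrt u by rewrite mulr_gt0.
rewrite t0 sz => /(_ isT); rewrite besselJE// => /eqP h; apply/eqP => h'; apply: h.
rewrite exprMn sqr_sqrtr ?ltW// (_ : 2 ^+ 2 * u / 4 = u); last by field.
by rewrite h' mulr0.
Qed.

(** The series is positive at 0, so a nonpositive value would produce a zero in []0, U[] by the
    intermediate value theorem, hence a zero of [besselJ a] before [z]. *)
Lemma bser_gt0 u : 0 <= u < U -> 0 < bser a u.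
Proof.
move=> /andP[u0 uU]; have h0 : 0 < bser a 0 by rewrite bser_0 bcoef0_gt0.
move: u0; rewrite le_eqVlt => /predU1P[<-//|u0].
rewrite ltNge; apply/negP => hu.
have cw : {within `[0, u], continuous (bser a)}.
  by apply: continuous_subspaceT; exact: continuous_bser.
have [|c] := IVT (ltW u0) cw (v := 0).
  rewrite minEle maxEle; case: ifPn; lra.
rewrite in_itv/= => /andP[c0 cu] hc.
have [c00|cn0] := eqVneq c 0; first by move: hc h0; rewrite c00 => ->; rewrite ltxx.
have := @bser_neq0 c; rewrite hc eqxx => /(_ _)/negP; apply => //.
by rewrite lt_neqAle eq_sym cn0 c0 (le_lt_trans cu).
Qed.

(* [u * bser2 + (a + 1) * bser1 + bser = 0] makes [P] decreasing as long as
   [bser a] is positive, which gives the sign of [bser1] up to the zero. *)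
Let P u := u `^ (a + 1) * bser1 a u.

Let is_derive_P (u : R) : 0 < u -> is_derive u 1 P (- (u `^ a * bser a u)).
Proof.
move=> u0; have H := is_deriveM (is_derive1_powR (a + 1) u0) (is_derive_bser1 u a0).
apply: (is_derive_eq H); rewrite /GRing.scale/= addrK.
rewrite powRD; last by apply/implyP => _; rewrite gt_eqF.
rewrite powRr1 ?ltW//; have := bser_ode u a0.
move=> /eqP; rewrite addr_eq0 => /eqP h.
have -> : bser a u = - (u * bser2 a u + (a + 1) * bser1 a u) by rewrite h opprK.
by ring.
Qed.

Lemma bser1_lt0 u : 0 <= u <= U -> bser1 a u < 0.
Proof.
move=> /andP[u0 uU].
have h1 : bser1 a 0 < 0.
  by rewrite bser1_0// mulNr oppr_lt0; apply: divr_gt0; [exact: bcoef0_gt0|exact: ltr_pwDl].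
(* As [P] vanishes at 0, its monotonicity alone gives only a weak inequality. Strictness comes from
   [bser1 a 0 < 0] and continuity on a short interval [[0, e[], from which [P] decreases further. *)
have [e e0 He] : exists2 e, 0 < e & forall x, 0 <= x < e -> bser1 a x < 0.
  have /cvgrPdist_lt/(_ _ _)/nbhs_ballP := @continuous_bser1 R a a0 0.
  move=> /(_ (- bser1 a 0)); rewrite oppr_gt0 => /(_ h1)[e /= e0 He].
  exists e => // x /andP[x0 xe]; have /= := He x.
  rewrite /ball/= sub0r normrN ger0_norm// => /(_ xe); rewrite ltr_norml; lra.
have [ue|eu] := ltP u e; first by rewrite He// u0.
have [x /andP[x0 xe]] : exists x, 0 < x < e by exists (e / 2); lra.
have xu : x < u by lra.
have Px : P x < 0 by rewrite /P pmulr_rlt0 ?powR_gt0// He//; lra.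
have cP : {within `[x, u], continuous P}.
  apply: continuous_in_subspaceT => y; rewrite inE/= in_itv/= => /andP[xy _].
  by apply: is_derive_continuous (is_derive_P _); lra.
have : P u <= P x.
  apply: (@ler0_derive1_nincr R P x u) => //.
  - move=> y; rewrite in_itv/= => /andP[xy _].
    by apply: is_derive_derivable (is_derive_P _); lra.
  - move=> y; rewrite in_itv/= => /andP[xy yu].
    have y0 : 0 < y by lra.
    rewrite (is_derive1E (is_derive_P y0)) oppr_le0 mulr_ge0 ?powR_ge0// ltW// bser_gt0//; lra.
  - exact: ltW.
move=> /le_lt_trans/(_ Px); rewrite /P pmulr_rlt0// powR_gt0//; lra.
Qed.

(** The zero at [U] is simple, since [bser1] is still negative there. The mean value theorem on
    [[u, U]] gives the bound, with [- d] the maximum of [bser1] on [[0, U]]. It controls the pole of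
    [psi] at [r]. *)
Lemma bser_lower_bound :
  exists2 d : R, 0 < d & forall u, 0 <= u <= U -> d * (U - u) <= bser a u.
Proof.
have [|c] := @EVT_max R (bser1 a) 0 U (ltW U0).
  by apply: continuous_subspaceT; exact: continuous_bser1.
rewrite in_itv/= => cU hc.
exists (- bser1 a c); first by rewrite oppr_gt0 bser1_lt0.
move=> u /andP[u0 uU].
have [| |y] := @MVT_segment R (bser a) (bser1 a) u U uU.
- by move=> x _; exact: is_derive_bser.
- by apply: continuous_subspaceT; exact: continuous_bser.
rewrite in_itv/= => /andP[uy yU]; rewrite bser_first_zero sub0r => h.
have -> : bser a u = - bser1 a y * (U - u) by rewrite mulNr -h opprK.
by rewrite ler_wpM2r ?subr_ge0// lerN2 hc// in_itv/=; lra.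
Qed.

End first_zero.

(** * Integration along rays *)

Section euclid_measurable.
Context {R : realType} {n : nat}.
Notation T := (n.-tuple (measurableTypeR R)).
Notation rv := (@rv_of_tuple R n).

(** The sigma-algebra is generated by the coordinates of tuples, the topology is that of row
    vectors. They are linked by writing an open set as the countable union of the boxes with
    rational centre and radius [1 / (k + 1)] that it contains. *)
Lemma open_measurable_rv (O : set 'rV[R]_n) : open O -> measurable (rv @^-1` O : set T).
Proof.
move=> oO.
pose box (p : 'rV[rat]_n * nat) : set 'rV[R]_n :=
  [set x | forall i, `|ratr (p.1 0 i) - x 0 i| < p.2.+1%:R^-1].
pose F k : set 'rV[R]_n := if unpickle k is Some p then
  (if `[< box p `<=` O >] then box p else set0) else set0.
have mbox p : measurable (rv @^-1` box p : set T).
  rewrite (_ : _ @^-1` _ = \bigcap_(i in [set: 'I_n])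
    ((@tnth _ _)^~ i @^-1` [set y : measurableTypeR R | `|ratr (p.1 0 i) - y| < p.2.+1%:R^-1])).
    apply: fin_bigcap_measurable => // i _.
    rewrite -[X in measurable X]setTI; apply: measurable_tnth => //.
    apply: open_measurable; rewrite (_ : mkset _ = ball (ratr (p.1 0 i) : R) p.2.+1%:R^-1)//.
    exact: ball_open.
  apply/seteqP; split => t /= H i; first by move=> _; have := H i; rewrite mxE.
  by rewrite mxE; exact: (H i).
rewrite (_ : O = \bigcup_k F k).
  rewrite preimage_bigcup; apply: bigcupT_measurable => k; rewrite /F.
  case: unpickle => [p|]; last by rewrite preimage_set0.
  by case: asboolP => _; [exact: mbox|rewrite preimage_set0].
apply/seteqP; split => [x Ox|x [k _]]; last first.
  by rewrite /F; case: unpickle => // p; case: asboolP => // pO; exact: pO.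
have /nbhs_ballP[e /= e0 xe] := open_nbhs_nbhs (conj oO Ox).
(* The centre of the box is only within [d] of [x], so points of the box are within [2 * d] of
   [x]. *)
have [k ke] : exists k : nat, 2 * k.+1%:R^-1 <= e.
  exists (truncn (2 / e)); rewrite ler_pdivrMr// -ler_pdivrMl// mulrC.
  by apply/ltW/truncnS_gt.
set d : R := k.+1%:R^-1 in ke.
have d0 : 0 < d by rewrite invr_gt0.
have rx i : exists q : rat, `|ratr q - x 0 i| < d.
  have lt : x 0 i - d < x 0 i + d by lra.
  have [q] := rat_in_itvoo lt.
  by rewrite in_itv/= => H; exists q; rewrite ltr_norml; lra.
pose q : 'rV[rat]_n := \row_i sval (cid (rx i)).
have qx : box (q, k) x by move=> i; rewrite mxE; case: cid.
exists (pickle (q, k)) => //; rewrite /F pickleK; case: asboolP => //; apply.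
move=> y /= qy; apply: xe; split=> // i j; rewrite (ord1 i).
rewrite /ball/= (_ : x 0 j - y 0 j = (x 0 j - ratr (q 0 j)) + (ratr (q 0 j) - y 0 j)); last by ring.
apply: le_lt_trans (ler_normD _ _) _; rewrite [X in X + _]distrC.
have qxj : `|ratr (q 0 j) - x 0 j| < d := qx j.
have qyj : `|ratr (q 0 j) - y 0 j| < d := qy j.
lra.
Qed.

Lemma open_continuous_measurable_rv (D : set 'rV[R]_n) (F : 'rV[R]_n -> R) :
  open D -> (forall x, D x -> {for x, continuous F}) ->
  measurable_fun (rv @^-1` D : set T) (F \o rv).
Proof.
move=> oD cF; apply: (measurability _ (RGenOpens.measurableE R)).
move=> _ [_ [a [b ->] <-]].
rewrite -[X in measurable X]/(rv @^-1` (D `&` F @^-1` `]a, b[%classic)).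
apply: open_measurable_rv.
rewrite openE => x [Dx Fx]; apply: filterI.
  exact: open_nbhs_nbhs.
by apply: cF => //; apply: open_nbhs_nbhs; split.
Qed.

End euclid_measurable.

(** * Behaviour of Lebesgue measure under dilations *)

Section lebesgue_scale.
Context {R : realType}.

Lemma measurable_invr : measurable_fun setT (fun x : measurableTypeR R => x^-1 : measurableTypeR R).
Proof.
have m1 : measurable ([set 0] : set (measurableTypeR R)) by exact: measurable_set1.
rewrite -(setUv [set (0 : measurableTypeR R)]).
apply/measurable_funU => //; first exact: measurableC.
split; first exact: measurable_fun_set1.
apply: open_continuous_measurable_fun.
  by rewrite openC; apply: closed_eq.
by move=> x; rewrite inE/= => /eqP x0; exact: inv_continuous.
Qed.

Notation mu := (@lebesgue_measure R).
Notation T n := (n.-tuple (measurableTypeR R)).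
Local Open Scope ereal_scope.

Lemma integral_lebS n (H : T n.+1 -> \bar R) :
  measurable_fun setT H -> (forall t, 0 <= H t) ->
  \int[leb n.+1]_t H t = \int[mu]_x \int[leb n]_t H (tcons (x, t)).
Proof.
move=> mH H0; rewrite [LHS]/= /leb_step.
rewrite ge0_integral_pushforward//=; last exact: measurable_tcons.
rewrite preimage_setT fubini_tonelli1//=.
by apply: measurableT_comp => //; exact: measurable_tcons.
Qed.

(** The image of Lebesgue measure under multiplication by [s], multiplied by [s], gives half-open
    intervals their length, so it is Lebesgue measure by uniqueness. *)
Lemma integral_scale1 (s : R) (H : measurableTypeR R -> \bar R) : (0 < s)%R ->
  measurable_fun setT H -> (forall t, 0 <= H t) ->
  s%:E * \int[mu]_x H (s * x)%R = \int[mu]_x H x.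
Proof.
move=> s0 mH H0.
have ms : measurable_fun setT ( *%R s : measurableTypeR R -> measurableTypeR R).
  exact: mulrl_measurable.
pose phi : {mfun measurableTypeR R >-> measurableTypeR R} :=
  HB.pack ( *%R s : measurableTypeR R -> measurableTypeR R) (isMeasurableFun.Build _ _ _ _ _ ms).
have s0' : (0 <= s)%R by exact: ltW.
pose m1f : {measure set (measurableTypeR R) -> \bar R} := pushforward mu phi.
pose m1 := m1f ms.
pose m2 : {measure set (measurableTypeR R) -> \bar R} := mscale (NngNum s0') m1.
have E A : measurable A -> mu A = m2 A.
  move=> mA; apply: lebesgue_measure_unique mA => X [[a b] /= _ <-].
  rewrite /mscale/= /pushforward/=.
  rewrite (_ : _ @^-1` _ = `](a / s)%R, (b / s)%R]%classic); last first.
    apply/seteqP; split => x /=; rewrite !in_itv/= ltr_pdivrMr// ler_pdivlMr// ![(x * s)%R]mulrC//.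
  rewrite !lebesgue_measure_itv/= !lte_fin ltr_pM2r ?invr_gt0//.
  case: ifPn => _; last by rewrite mule0.
  by rewrite -!EFinB -EFinM; congr EFin; field; rewrite gt_eqF.
transitivity (\int[m2]_x H x); last first.
  by apply: eq_measure_integral => A mA _; exact/esym/E.
by rewrite ge0_integral_mscale//= ge0_integral_pushforward.
Qed.

Definition tscale n (s : R) (t : T n) : T n := [tuple of map ( *%R s) t].

Lemma tnth_tscale n s (t : T n) i : tnth (tscale s t) i = (s * tnth t i)%R.
Proof. by rewrite tnth_map. Qed.

Lemma tscale_tcons n s x (t : T n) :
  tscale s (tcons (x, t)) = tcons ((s * x)%R, tscale s t).
Proof. exact: val_inj. Qed.

Lemma measurable_tscale n d (X : measurableType d) (s : X -> measurableTypeR R) (f : X -> T n) :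
  measurable_fun setT s -> measurable_fun setT f ->
  measurable_fun setT (fun x => tscale (s x) (f x)).
Proof.
move=> ms mf; apply/measurable_fun_tnthP => i.
rewrite (_ : _ \o _ = (fun x => s x * tnth (f x) i)%R); last first.
  by apply/funext => x /=; rewrite tnth_tscale.
apply: measurable_funM => //.
by apply: (@measurableT_comp _ _ _ _ _ _ (fun t : T n => tnth t i)) => //; exact: measurable_tnth.
Qed.

Lemma integral_tscale n (s : R) (H : T n -> \bar R) : (0 < s)%R ->
  measurable_fun setT H -> (forall t, 0 <= H t) ->
  (s ^+ n)%:E * \int[leb n]_t H (tscale s t) = \int[leb n]_t H t.
Proof.
move=> s0; elim: n H => [|n IH] H mH H0.
  rewrite expr0 mul1e; apply: eq_integral => t _; congr H.
  by apply: val_inj; case: t => [[]].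
have mHs : measurable_fun setT (fun t => H (tscale s t)).
  by apply: measurableT_comp => //; apply: measurable_tscale.
have mHc : measurable_fun setT (fun p : measurableTypeR R * T n => H (tcons p)).
  by apply: measurableT_comp => //; exact: measurable_tcons.
rewrite !integral_lebS// -[RHS](integral_scale1 s0); last 2 first.
- exact: (@measurable_fun_fubini_tonelli_F _ _ _ _ _ (leb n) _ mHc (fun p => H0 (tcons p))).
- by move=> x; apply: integral_ge0.
rewrite exprS EFinM -muleA; congr (_ * _).
rewrite -ge0_integralZl//; last 3 first.
- have mHsc : measurable_fun setT (fun p : measurableTypeR R * T n => H (tscale s (tcons p))).
    exact: measurableT_comp mHs (@measurable_tcons R n).
  exact: (@measurable_fun_fubini_tonelli_F _ _ _ _ _ (leb n) _ mHsc (fun p => H0 _)).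
- by move=> x _; exact: integral_ge0.
- by rewrite lee_fin exprn_ge0// ltW.
apply: eq_integral => x _.
under eq_integral do rewrite tscale_tcons.
apply: (IH (fun t => H (tcons ((s * x)%R, t)))) => //.
exact: measurableT_comp mHc _.
Qed.

End lebesgue_scale.

Lemma measurable_fun_slice d1 d2 d3 (X : measurableType d1) (Y : measurableType d2)
    (Z : measurableType d3) (G : X * Y -> Z) :
  measurable_fun setT G -> forall t, measurable_fun setT (fun x => G (t, x)).
Proof. by move=> mG t; exact: (measurableT_comp mG (@pair1_measurable _ _ X Y t)). Qed.

(** * Polar coordinates, with an annulus in place of the sphere *)

Section polar.
Context {R : realType} {n : nat}.
Notation mu := (@lebesgue_measure R).
Notation T := (n.-tuple (measurableTypeR R)).
Local Open Scope ereal_scope.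

Definition tnorm (t : T) : R := enorm (rv_of_tuple t).

Lemma tnorm_ge0 t : (0 <= tnorm t)%R. Proof. exact: enorm_ge0. Qed.

Lemma rv_of_tuple_tscale s (t : T) : rv_of_tuple (tscale s t) = (s *: rv_of_tuple t)%R.
Proof. by apply/rowP => i; rewrite !mxE tnth_tscale. Qed.

Lemma tnorm_tscale s (t : T) : (0 <= s)%R -> tnorm (tscale s t) = (s * tnorm t)%R.
Proof. by move=> s0; rewrite /tnorm rv_of_tuple_tscale enormZ ger0_norm. Qed.

Lemma measurable_tnorm : measurable_fun setT tnorm.
Proof.
apply: (measurableT_comp (f := @Num.sqrt R)).
  by apply: continuous_measurable_fun; exact: sqrt_continuous.
rewrite (_ : (fun _ => _) = (fun t : T => \sum_(i < n) tnth t i * tnth t i)%R).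
  apply: measurable_sum => i; apply: measurable_funM; exact: measurable_tnth.
by apply/funext => t; apply: eq_bigr => i _; rewrite !mxE.
Qed.

(** The measure [dt / t] is invariant under dilations, so the value does not depend on [a]. It is
    the mass of the [t] for which [x / t] lies in the annulus, the same for every nonzero [x]. *)
Lemma integral_inv_half (a : R) : (0 < a)%R ->
  \int[mu]_(t in `](a / 2)%R, a[) (t^-1)%:E = (ln 2)%:E.
Proof.
move=> a0; have a2 : (0 < a / 2)%R by rewrite divr_gt0.
have mi D : measurable D -> measurable_fun D (fun t : measurableTypeR R => (t^-1)%:E).
  by move=> mD; apply/measurable_EFinP; apply: measurable_funTS; exact: measurable_invr.
rewrite integral_itv_bndo_bndc ?integral_itv_obnd_cbnd; [|exact: mi|exact: mi].
have c (x : R) : (0 < x)%R -> {for x, continuous (fun t : R => t^-1)%R}.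
  by move=> x0; apply: continuousV => //; rewrite gt_eqF.
have cl (x : R) : (0 < x)%R -> {for x, continuous (@ln R)}.
  by move=> x0; exact: continuous_ln.
rewrite (@continuous_FTC2 R _ (@ln R)).
- rewrite lnM ?posrE ?invr_gt0// lnV ?posrE// -EFinB; congr EFin; lra.
- lra.
- by apply: continuous_in_subspaceT => x; rewrite inE/= in_itv/= => /andP[ax _]; apply: c; lra.
- split.
  + move=> x; rewrite in_itv/= => /andP[ax _].
    have x0 : (0 < x)%R by lra.
   by exact: is_derive_derivable (is_derive1_ln x0).
  + by apply: cvg_at_right_filter; apply: cl.
  + by apply: cvg_at_left_filter; apply: cl.
- move=> x; rewrite in_itv/= => /andP[ax _].
  have x0 : (0 < x)%R by lra.
   by exact: is_derive1E (is_derive1_ln x0).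
Qed.

(* Both sides are the integral of [H x / t] over the [(t, x)] with
   [t < |x| < 2 t], so the annulus plays the role of the unit sphere. *)
Lemma integral_polar (H : T -> \bar R) :
  measurable_fun setT H -> (forall t, 0 <= H t) ->
  (forall t, tnorm t = 0%R -> H t = 0) ->
  (ln 2)%:E * \int[leb n]_x H x =
  \int[leb n]_(y in [set y | (1 < tnorm y < 2)%R])
    \int[mu]_(t in `]0%R, +oo[) (H (tscale t y) * (t ^+ n / t)%:E).
Proof.
move=> mH H0 Hz.
pose S : set (measurableTypeR R * T) := [set p | (0 < p.1)%R && (p.1 < tnorm p.2 < 2 * p.1)%R].
have mn : measurable_fun setT (fun p : measurableTypeR R * T => tnorm p.2).
  exact: measurableT_comp measurable_tnorm measurable_snd.
have mS : measurable S.
  rewrite (_ : S = [set p | (0 < p.1)%R] `&` ([set p | (p.1 < tnorm p.2)%R] `&`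
     [set p | (tnorm p.2 < 2 * p.1)%R])); last first.
    by apply/seteqP; split => p /=; [move/and3P => [? ? ?]|case=> ? [? ?]; apply/and3P].
  apply: measurableI; last apply: measurableI.
  - rewrite -[X in measurable X]setTI; exact: measurable_fun_ltr.
  - rewrite -[X in measurable X]setTI; exact: measurable_fun_ltr.
  - rewrite -[X in measurable X]setTI; apply: measurable_fun_ltr => //.
    by apply: measurable_funM.
pose G (p : measurableTypeR R * T) : \bar R := H p.2 * (\1_S p / p.1)%:E.
have mG : measurable_fun setT G.
  apply: emeasurable_funM; first exact: measurableT_comp mH measurable_snd.
  apply/measurable_EFinP; apply: measurable_funM => //.
  exact: measurableT_comp measurable_invr measurable_fst.
have S0 p : (0 <= (\1_S p / p.1 : R))%R.
  rewrite indicE; have [|_] := boolP (p \in S); last by rewrite mul0r.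
  by rewrite inE => /andP[p0 _]; rewrite mul1r invr_ge0 ltW.
have G0 p : 0 <= G p by rewrite mule_ge0// lee_fin.
transitivity (\int[leb n]_x \int[mu]_t G (t, x)).
  rewrite -ge0_integralZl//; last by rewrite lee_fin ln_ge0// ler1n.
  apply: eq_integral => x _; rewrite /G/= ge0_integralZl//; last 2 first.
  - apply/measurable_EFinP; apply: measurable_funM; last exact: measurable_invr.
    by apply: measurableT_comp.
  - by move=> t _; rewrite lee_fin (S0 (t, x)).
  have [x0|x0] := eqVneq (tnorm x) 0%R; first by rewrite Hz// mule0 mul0e.
  rewrite muleC; congr (_ * _).
  rewrite -(@integral_inv_half (tnorm x)); last by rewrite lt_neqAle eq_sym x0 tnorm_ge0.
  rewrite [LHS]integral_mkcond; apply: eq_integral => t _.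
  rewrite patchE indicE (_ : (t \in _) = ((t, x) \in S)).
    by case: ifPn => _; rewrite ?mul1r ?mul0r.
  apply/idP/idP; rewrite !inE/= in_itv/= /S/=; last first.
    move=> /and3P[? ? ?]; apply/andP; split => //; rewrite ltr_pdivrMr//; lra.
  by have := tnorm_ge0 x; rewrite ltr_pdivrMr// => ? /andP[? ?]; apply/and3P; split; lra.
pose A : set T := [set y | (1 < tnorm y < 2)%R].
pose K (p : measurableTypeR R * T) : \bar R :=
  if (0 < p.1)%R && (p.2 \in A) then H (tscale p.1 p.2) * (p.1 ^+ n / p.1)%:E else 0.
have mA : measurable A.
  rewrite (_ : A = [set y | (1 < tnorm y)%R] `&` [set y | (tnorm y < 2)%R]); last first.
    by apply/seteqP; split => p /=; [move/andP => []|case=> ? ?; apply/andP].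
  apply: measurableI; rewrite -[X in measurable X]setTI; apply: measurable_fun_ltr => //;
    exact: measurable_tnorm.
have mK : measurable_fun setT K.
  apply: measurable_fun_if => //.
  - apply: measurable_and; first exact: measurable_fun_ltr.
    apply: (@measurableT_comp _ _ _ _ _ _ (fun y => y \in A)) => //.
    rewrite (_ : (fun y => y \in A) = (fun y => (1 < tnorm y)%R && (tnorm y < 2)%R)).
      by apply: measurable_and; apply: measurable_fun_ltr => //; exact: measurable_tnorm.
    by apply/funext => y; apply/idP/idP; rewrite inE.
  - apply: measurable_funTS; apply: emeasurable_funM.
      by apply: measurableT_comp => //; exact: measurable_tscale.
    apply/measurable_EFinP; apply: measurable_funM; first exact: measurable_funX.
    exact: measurableT_comp measurable_invr measurable_fst.
have K0 p : 0 <= K p.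
  rewrite /K; case: ifPn => // /andP[p0 _]; rewrite mule_ge0// lee_fin.
  by rewrite mulr_ge0 ?exprn_ge0 ?invr_ge0// ltW.
transitivity (\int[leb n]_y \int[mu]_t K (t, y)); last first.
  rewrite [RHS]integral_mkcond; apply: eq_integral => y _.
  rewrite patchE; case: ifPn => yA.
    rewrite [RHS]integral_mkcond; apply: eq_integral => t _.
    rewrite patchE /K/= yA andbT (_ : (t \in _) = (0 < t)%R)//.
    by apply/idP/idP; rewrite inE/= in_itv/= andbT.
  by apply: integral0_eq => t _; rewrite /K/= (negbTE yA) andbF.
rewrite -(fubini_tonelli _ mG)// -(fubini_tonelli _ mK)//.
apply: eq_integral => t _; rewrite /fubini_F.
have [t0|t0] := ltP 0%R t; last first.
  rewrite [RHS]integral0_eq; last by move=> x _; rewrite /K/= (le_gtF t0).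
  apply: integral0_eq => x _; rewrite /G/= indicE memNset ?mul0r ?mule0// /S/=.
  by rewrite (le_gtF t0).
have mGt : measurable_fun setT (fun x : T => G (t, x)).
  exact: measurable_fun_slice mG t.
(* At fixed [t], the substitution [x = t y] turns [t < |x| < 2 t] into [1 < |y| < 2] and produces
   the Jacobian [t ^ n]. *)
rewrite -(@integral_tscale _ _ t)//.
rewrite -ge0_integralZl//; last 2 first.
- by apply: (measurableT_comp mGt); exact: measurable_tscale.
- by rewrite lee_fin exprn_ge0// ltW.
apply: eq_integral => y _; rewrite /G /K/= t0/= indicE.
rewrite (_ : (_ \in S) = (y \in A)).
  by case: ifPn => _; rewrite ?mul0r ?mule0// muleCA -EFinM mul1r.
have E : ((t < tnorm (tscale t y) < 2 * t) = (1 < tnorm y < 2))%R.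
  by rewrite tnorm_tscale ?ltW// ltr_pMr// [(2 * t)%R]mulrC ltr_pM2l.
by apply/idP/idP; rewrite !inE /S /A /= t0/= E.
Qed.

End polar.

(** * Radial geometry of the ball *)

Section calculus.
Context {R : realType}.

(** Both difference quotients are the same function of the increment. This carries the one-variable
    chain rule over to directional derivatives. *)
Lemma is_derive_line (V : normedModType R) (F : V -> R) (x v : V) (l : R) :
  is_derive (0 : R) 1 (fun s : R => F (s *: v + x)) l <-> is_derive x v F l.
Proof.
have E : (fun h : R => h^-1 *: (((fun s : R => F (s *: v + x)) \o shift 0) (h *: 1) - F (0 *: v + x)))
   = (fun h : R => h^-1 *: ((F \o shift x) (h *: v) - F x)).
  by apply/funext => h /=; rewrite scale0r add0r addr0 [h *: 1]mulr1.
split=> [[d0 e0]|[d0 e0]].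
  by split; [rewrite /derivable -E|rewrite /derive -E].
by split; [rewrite /derivable E|rewrite /derive E].
Qed.

Lemma is_derive_comp (V : normedModType R) (q : R -> R) (h : V -> R) (x v : V) (l dq : R) :
  is_derive x v h l -> is_derive (h x) 1 q dq -> is_derive x v (q \o h) (dq * l).
Proof.
move=> /is_derive_line Hh Hq; apply/is_derive_line.
apply: (@is_derive1_comp R q (fun s : R => h (s *: v + x))).
by rewrite scale0r add0r.
Qed.

Lemma is_derive_curve (V : normedModType R) (F : V -> R) (c : R -> V) (t : R) (w : V) :
  differentiable F (c t) -> is_derive t 1 c w -> is_derive t 1 (F \o c) ('d F (c t) w).
Proof.
move=> dF dc; have dct : differentiable c t by apply/derivable1_diffP; exact: ex_derive.
have dFc := differentiable_comp dct dF.
apply: DeriveDef; first exact/diff_derivable.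
rewrite deriveE// diff_comp//=; congr ('d F _ _).
by rewrite -deriveE// derive_val.
Qed.

Lemma is_derive_scalel (n : nat) (q : R -> R) (t dq : R) (u : 'rV[R]_n) :
  is_derive t 1 q dq -> is_derive t 1 (fun t => q t *: u) (dq *: u).
Proof.
move=> H.
have Hij i j : is_derive t 1 (fun t => (q t *: u) i j) (dq * u i j).
  have := is_deriveM H (is_derive_cst (u i j) t 1).
  rewrite (_ : _ * _ = (fun t => (q t *: u) i j)); last by apply/funext => s; rewrite mxE.
  by move=> K; apply: (is_derive_eq K); rewrite /GRing.scale/= mulr0 add0r mulrC.
have d : derivable (fun t => q t *: u) t 1.
  by apply/derivable_mxP => i j; exact: is_derive_derivable (Hij i j).
apply: DeriveDef => //; rewrite derive_mx//; apply/matrixP => i j.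
by rewrite !mxE; have K := Hij i j; rewrite derive_val.
Qed.

Lemma is_derive_tanh_half (t : R) :
  is_derive t 1 (fun t => tanh (t / 2)) ((1 - tanh (t / 2) ^+ 2) / 2).
Proof.
have E : (fun t : R => tanh (t / 2)) = (fun t => 1 - 2 * (expR t + 1)^-1).
  apply/funext => s; rewrite tanhE; have := expR_gt0 s => s0; field; rewrite gt_eqF//; lra.
have t0 := expR_gt0 t.
have H1 : is_derive t 1 (fun t : R => expR t + 1) (expR t).
  by have := is_deriveD (is_derive_expR t) (is_derive_cst (1 : R) t 1); rewrite addr0.
have n0 : expR t + 1 != 0 by rewrite gt_eqF//; lra.
have H2 := @is_deriveV _ (fun t : R => expR t + 1) t _ 1 n0 H1.
have H3 := is_deriveB (is_derive_cst (1 : R) t 1) (is_deriveZ 2 H2).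
rewrite E; apply: (is_derive_eq H3); rewrite -[tanh _]/((fun t => tanh (t / 2)) t) E.
rewrite /GRing.scale/=; field; rewrite n0//.
Qed.

Lemma is_derive_lnratio (e : R) : -1 < e < 1 ->
  is_derive e 1 (fun e : R => ln ((1 + e) / (1 - e))) (2 / (1 - e ^+ 2)).
Proof.
move=> /andP[e1 e2].
have q1 : 0 < 1 + e by lra.
have q2 : 0 < 1 - e by lra.
have n2 : 1 - e != 0 by rewrite gt_eqF.
have E1 : is_derive e 1 (fun e : R => 1 + e) 1.
  by have := is_deriveD (is_derive_cst (1 : R) e 1) (is_derive_id e 1); rewrite add0r.
have E2 : is_derive e 1 (fun e : R => 1 - e) (-1).
  by have := is_deriveB (is_derive_cst (1 : R) e 1) (is_derive_id e 1); rewrite add0r.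
have E2' := @is_deriveV _ (fun e : R => 1 - e) e _ 1 n2 E2.
have H := is_deriveM E1 E2'.
have q : 0 < (1 + e) / (1 - e) by rewrite divr_gt0.
have H' := @is_derive1_comp R (@ln R) _ e _ _ (is_derive1_ln q) H.
apply: (is_derive_eq H'); rewrite /GRing.scale/=; field.
rewrite (_ : 1 - e ^+ 2 = (1 + e) * (1 - e)); last by ring.
by rewrite mulf_neq0 ?gt_eqF.
Qed.

End calculus.

Section geometry.
Context {R : realType} {n : nat}.
Implicit Types (x v : 'rV[R]_n) (f : 'rV[R]_n -> R).

Lemma dot_line (s : R) v x :
  dot (s *: v + x) (s *: v + x) = s ^+ 2 * dot v v + 2 * s * dot x v + dot x x.
Proof.
rewrite dotDl !(dotC _ (_ + _)) !dotDl !dotZl !dotZr !(dotC v); ring.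
Qed.

Lemma dot_continuous : continuous (fun x => dot x x).
Proof.
have -> : (fun x => dot x x) = \sum_(i < n) (fun x : 'rV[R]_n => x 0 i * x 0 i).
  by apply/funext => x; rewrite fct_sumE.
move=> x; elim/big_ind : _ => [|f g cf cg|i _].
- exact: cst_continuous.
- exact: continuousD.
- by apply: continuousM; exact: coord_continuous.
Qed.

Lemma enorm_continuous : continuous (@enorm R n).
Proof.
move=> x; apply: (@continuous_comp _ _ _ (fun x => dot x x) Num.sqrt x); first exact: dot_continuous.
exact: sqrt_continuous.
Qed.

Lemma open_hball : open (@hball R n).
Proof.
have -> : @hball R n = enorm @^-1` [set e : R | e < 1] by [].
apply: open_comp; last exact: open_lt.
by move=> x _; exact: enorm_continuous.
Qed.

Lemma conf_continuous x : hball x -> {for x, continuous (@conf R n)}.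
Proof.
rewrite hballE => x1; apply: continuousM; first exact: cst_continuous.
apply: continuousV; first by rewrite gt_eqF// subr_gt0.
by apply: continuousB; [exact: cst_continuous|exact: dot_continuous].
Qed.

Lemma confE x : conf x = 2 / (1 - enorm x ^+ 2).
Proof. by rewrite enorm_sqr. Qed.

Lemma expR_hrho x : hball x -> expR (hrho x) = (1 + enorm x) / (1 - enorm x).
Proof.
move=> bx; have x0 := enorm_ge0 x; have x1 : enorm x < 1 := bx.
by rewrite hrhoE// lnK// posrE divr_gt0//; lra.
Qed.

(** With [d rho = conf * d |x|], this identifies the volume density [conf ^ N * |x| ^ (N - 1) d |x|]
    with [sinh ^ (N - 1) d rho]. *)
Lemma sinh_hrho x : hball x -> sinh (hrho x) = enorm x * conf x.
Proof.
move=> bx; have x0 := enorm_ge0 x; have x1 : enorm x < 1 := bx.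
rewrite /sinh expRN expR_hrho// confE; field.
rewrite (_ : 1 - enorm x ^+ 2 = (1 + enorm x) * (1 - enorm x)); last by ring.
by rewrite !mulf_neq0 ?gt_eqF//; lra.
Qed.

Lemma hrho_gt0 x : hball x -> (0 < hrho x) = (0 < enorm x).
Proof.
move=> bx; have x0 := enorm_ge0 x; have x1 : enorm x < 1 := bx.
rewrite -[LHS](@ltr_expR R) expR0 expR_hrho// ltr_pdivlMr; last lra.
by apply/idP/idP; lra.
Qed.

Lemma hrho_lt x r : hball x -> (hrho x < r) = (enorm x < tanh (r / 2)).
Proof.
move=> bx; have x0 := enorm_ge0 x; have x1 : enorm x < 1 := bx.
rewrite tanhE -(@ltr_expR R) expR_hrho// ltr_pdivrMr ?ltr_pdivlMr; last 2 first.
- by have := expR_gt0 r; lra.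
- by lra.
by apply/idP/idP; lra.
Qed.

(** From [e ^ s <= 1 / (1 - s) <= (1 + s) / (1 - s)] at [s = |x|]. It lets singularities in the
    geodesic distance be dominated by powers of the Euclidean norm. *)
Lemma enorm_le_hrho x : hball x -> enorm x <= hrho x.
Proof.
move=> bx; have x0 := enorm_ge0 x; have x1 : enorm x < 1 := bx.
rewrite -[leLHS](@expRK R) hrhoE// ler_ln ?posrE ?expR_gt0//; last by rewrite divr_gt0//; lra.
rewrite ler_pdivlMr; last lra.
have := @expR_ge1Dx R (- enorm x); rewrite expRN => h.
have e0 := expR_gt0 (enorm x).
have : expR (enorm x) * (1 + - enorm x) <= expR (enorm x) * (expR (enorm x))^-1.
  by rewrite ler_pM2l.
rewrite mulfV ?gt_eqF//; lra.
Qed.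

Lemma hexp0_hdirZ x (t : R) : x != 0 -> 0 < t ->
  hexp0 (t *: hdir x) = (tanh (t / 2)) *: ((enorm x)^-1 *: x).
Proof.
move=> x0 t0; have e0 : enorm x != 0 by rewrite enorm_eq0.
rewrite /hexp0 hnorm0E; have E : enorm (t *: hdir x) = t / 2.
  rewrite enormZ gtr0_norm//; have := hnorm_hdir x0; rewrite hnorm0E => h; congr (_ * _); lra.
rewrite E /hdir hnorm0E !scalerA; congr (_ *: _).
have -> : 2 * (t / 2) = t by field.
by field; rewrite e0 gt_eqF.
Qed.

Lemma diff_dot f x v : differentiable f x -> 'd f x v = dot (egrad f x) v.
Proof.
move=> fx; rewrite {1}(row_sum_delta v) linear_sum; apply: eq_bigr => i _.
by rewrite mxE linearZ /= /partial deriveE// mulrC.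
Qed.

Lemma hnorm_hgrad f x : hball x ->
  hnorm x (hgrad f x) ^+ 2 = dot (egrad f x) (egrad f x) / conf x ^+ 2.
Proof.
move=> bx; have c0 := conf_gt0 bx.
by rewrite hnormE// exprMn enorm_sqr /hgrad dotZl dotZr; field; rewrite gt_eqF.
Qed.

(** The Euclidean radial derivative. Dividing it by [conf] gives the hyperbolic one, because [|x|]
    grows at rate [1 / conf] along a unit-speed geodesic from the origin. *)
Definition rdot f x : R := dot (egrad f x) x / enorm x.

Lemma is_derive_ray f x (t : R) : x != 0 -> 0 < t ->
  differentiable f (hexp0 (t *: hdir x)) ->
  is_derive t 1 (fun t => f (hexp0 (t *: hdir x)))
    (rdot f (hexp0 (t *: hdir x)) / conf (hexp0 (t *: hdir x))).
Proof.
move=> x0 t0; rewrite hexp0_hdirZ// => df.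
set u := (enorm x)^-1 *: x.
have H1 := is_derive_scalel u (is_derive_tanh_half t).
have H := @is_derive_curve _ _ f _ t _ df H1.
have e0 : 0 < enorm x by rewrite lt_neqAle enorm_ge0 eq_sym enorm_eq0 x0.
have u1 : enorm u = 1 by rewrite enormZ normfV ger0_norm ?enorm_ge0// mulVf// gt_eqF.
apply: (@near_eq_is_derive _ _ _ (f \o (fun t => tanh (t / 2) *: u))).
  near=> s; rewrite /= hexp0_hdirZ//; near: s; exact: lt_nbhsr.
apply: (is_derive_eq H); rewrite diff_dot// /rdot confE !(enormZ _ u) u1 mulr1.
have th : 0 < tanh (t / 2).
  rewrite tanhE; have : 1 < expR t by rewrite -[ltLHS](@expR0 R) ltr_expR.
  by move=> t1; rewrite divr_gt0//; lra.
rewrite (gtr0_norm th) !dotZr; field.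
rewrite tanhE; have := expR_gt0 t => et.
apply/and3P; split => //; rewrite gt_eqF//.
  by rewrite subr_gt0 -[ltRHS](expr1n _ 2) ltr_pXn2r ?nnegrE//;
    [rewrite ltr_pdivrMr; lra|rewrite ltW// -tanhE].
by rewrite -tanhE.
Unshelve. all: by end_near. Qed.

Lemma is_derive_hradial f x : hball x -> x != 0 -> differentiable f x ->
  is_derive (hrho x) 1 (fun t => f (hexp0 (t *: hdir x))) (rdot f x / conf x).
Proof.
move=> bx x0 df.
have r0 : 0 < hrho x by rewrite hrho_gt0// lt_neqAle enorm_ge0 eq_sym enorm_eq0 x0.
by have := @is_derive_ray f x (hrho x) x0 r0; rewrite hexp0_hdir//; apply.
Qed.

Lemma hrho_ray x (t : R) : x != 0 -> 0 <= t -> hrho (hexp0 (t *: hdir x)) = t.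
Proof.
move=> x0 t0; rewrite hrho_hexp0 hnorm0E enormZ ger0_norm//.
by have := hnorm_hdir x0; rewrite hnorm0E => h; rewrite mulrCA h mulr1.
Qed.

Lemma rdot_le f x : x != 0 -> rdot f x ^+ 2 <= dot (egrad f x) (egrad f x).
Proof.
move=> x0; have e0 : enorm x != 0 by rewrite enorm_eq0.
have e1 : dot ((enorm x)^-1 *: x) ((enorm x)^-1 *: x) = 1.
  by rewrite dotZl dotZr -enorm_sqr; field.
have := dot_le (egrad f x) e1; rewrite dotZr mulrC -/(rdot f x) => h.
rewrite -enorm_sqr -[leLHS]real_normK ?num_real//.
by rewrite ler_pXn2r ?nnegrE// enorm_ge0.
Qed.

Lemma is_derive_hrho x v : hball x -> x != 0 ->
  is_derive x v (@hrho R n) (conf x / enorm x * dot x v).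
Proof.
move=> bx x0.
have e0 : 0 < enorm x by rewrite lt_neqAle enorm_ge0 eq_sym enorm_eq0 x0.
apply: (@near_eq_is_derive _ _ _ (fun x => ln ((1 + enorm x) / (1 - enorm x)))).
  near=> y; rewrite hrhoE//; near: y; exact: (open_nbhs_nbhs (conj open_hball bx)).
apply/is_derive_line.
(* The squared norm along the line is polynomial in [s], and [P 0 = |x| ^ 2] is positive, so its
   square root is differentiable at 0. *)
pose P (s : R) := s ^+ 2 * dot v v + 2 * s * dot x v + dot x x.
have HP : is_derive (0 : R) 1 P (2 * dot x v).
  have I := is_derive_id (0 : R) 1.
  have H := is_deriveD (is_deriveD (is_deriveM (is_deriveM I I) (is_derive_cst (dot v v) (0 : R) 1))
     (is_deriveZ (2 * dot x v) I)) (is_derive_cst (dot x x) (0 : R) 1).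
  rewrite (_ : _ + _ = P) in H.
    by apply: (is_derive_eq H); rewrite /GRing.scale/= !(mulr0, mul0r, add0r, addr0) mulr1.
  apply/funext => s; rewrite /P.
  rewrite -[LHS]/(s * s * dot v v + 2 * dot x v * s + dot x x); ring.
have P0 : P 0 = dot x x by rewrite /P; ring.
have P1 : 0 < P 0 by rewrite P0 -enorm_sqr exprn_gt0.
have H2 := @is_derive1_comp R Num.sqrt P 0 _ _ (is_derive1_sqrt P1) HP.
have e1 : -1 < (Num.sqrt \o P) 0 < 1.
  by rewrite /= P0 -/(enorm x); have : enorm x < 1 := bx; lra.
have H3 := @is_derive1_comp R (fun e : R => ln ((1 + e) / (1 - e))) (Num.sqrt \o P) 0 _ _
  (is_derive_lnratio e1) H2.
rewrite (_ : (fun s => _) = (fun e : R => ln ((1 + e) / (1 - e))) \o (Num.sqrt \o P)).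
  apply: (is_derive_eq H3); rewrite /= P0 -/(enorm x) confE; field.
  rewrite gt_eqF//= (_ : 1 - enorm x ^+ 2 = (1 + enorm x) * (1 - enorm x)); last by ring.
  have : enorm x < 1 := bx => ?.
  by rewrite !mulf_neq0 ?gt_eqF//; lra.
by apply/funext => s; rewrite /= /enorm !dot_line.
Unshelve. all: by end_near. Qed.

Section quotient.
Variables (F : R -> R) (f : 'rV[R]_n -> R) (x : 'rV[R]_n) (dF : R).
Hypotheses (bx : hball x) (x0 : x != 0) (df : differentiable f x)
  (HF : is_derive (hrho x) 1 F dF) (F0 : F (hrho x) != 0).
Let g y := f y / F (hrho y).

Lemma hradial_quotient :
  hradial g x = (hradial f x - f x * (dF / F (hrho x))) / F (hrho x).
Proof.
have Hf := is_derive_hradial bx x0 df.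
rewrite /hradial (is_derive1E Hf).
have r0 : 0 < hrho x by rewrite hrho_gt0// lt_neqAle enorm_ge0 eq_sym enorm_eq0 x0.
apply: is_derive1E.
have H := is_deriveM Hf (@is_deriveV _ F _ _ 1 F0 HF).
apply: (@near_eq_is_derive _ _ _ ((fun t : R => f (hexp0 (t *: hdir x))) * (fun t => (F t)^-1))).
  near=> s; rewrite /g !fctE/= hrho_ray// ltW//; near: s; exact: lt_nbhsr.
apply: (is_derive_eq H); rewrite /= hexp0_hdir// /GRing.scale/=; field; rewrite F0//=.
by rewrite gt_eqF// conf_gt0.
Unshelve. all: by end_near. Qed.

(** The gradient of [F \o hrho] is a multiple of [x]. Up to the factor [1 / F], the quotient thus
    keeps the tangential part of the gradient of [f], and only its radial part is corrected. *)
Lemma egrad_quotient :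
  egrad g x = (F (hrho x))^-1 *: (egrad f x - (f x * (dF / F (hrho x)) * conf x / enorm x) *: x).
Proof.
apply/rowP => i; rewrite !mxE /partial.
have Hf : is_derive x (delta_mx 0 i) f ('D_(delta_mx 0 i) f x).
  by apply: DeriveDef => //; exact: diff_derivable.
have Hr := is_derive_hrho (delta_mx 0 i) bx x0.
have HFr := is_derive_comp Hr (@is_deriveV _ F _ _ 1 F0 HF).
have H := is_deriveM Hf HFr.
rewrite (_ : _ * _ = g) in H; last by apply/funext.
have -> : x 0 i = dot x (delta_mx 0 i).
  rewrite /dot (bigD1 i)//= mxE !eqxx mulr1 big1 ?addr0// => j ji.
  by rewrite mxE (negbTE ji) mulr0.
rewrite derive_val /GRing.scale/=; field; rewrite F0//=.
by rewrite enorm_eq0 x0.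
Qed.

End quotient.

End geometry.

(** * The logarithmic derivative psi *)

Section ftc.
Context {R : realType}.
Notation mu := (@lebesgue_measure R).

Lemma bounded_integrable (h : R -> R) (C : R) (i : interval R) :
  measurable_fun [set` i] h -> (mu [set` i] < +oo)%E ->
  (forall t, [set` i] t -> `|h t| <= C) ->
  mu.-integrable [set` i] (EFin \o h).
Proof.
move=> mh mi hC; apply: (@le_integrable _ _ _ mu _ _ _ (EFin \o cst C)) => //=.
- exact/measurable_EFinP.
- by move=> t ti; rewrite lee_fin; apply: (le_trans (hC t ti)); exact: ler_norm.
- apply/integrableP; split; first exact/measurable_EFinP.
  rewrite (_ : (fun x => _) = cst (`|C|)%:E)// integral_cst//=.
  by rewrite lte_mul_pinfty// lee_fin.
Qed.

Lemma Rintegral_le_cst (h : R -> R) (C a b : R) : a <= b -> 0 <= C ->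
  measurable_fun `]a, b[ h -> (forall t, a < t < b -> `|h t| <= C) ->
  `|\int[mu]_(t in `]a, b[) h t| <= C * (b - a).
Proof.
move=> ab C0 mh hC.
have mi : (mu `]a, b[ < +oo)%E.
  by rewrite /= lebesgue_measure_itv/= lte_fin; case: ifPn => // _; rewrite -EFinB ltry.
have ih : mu.-integrable `]a, b[ (EFin \o h).
  by apply: (bounded_integrable (C := C)) => // t /=; rewrite in_itv/= => /hC.
apply: (le_trans (le_normr_Rintegral _ ih)) => //.
have -> : C * (b - a) = \int[mu]_(t in `]a, b[) C.
  rewrite Rintegral_cst//= lebesgue_measure_itv/= lte_fin.
  case: ltP => //= ba; congr (_ * _); lra.
apply: le_Rintegral => //=.
- by move/integrable_norm : ih.
- apply: (bounded_integrable (C := C)) => // t _; by rewrite ger0_norm.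
Qed.

(** Nothing is known of [G] and [h] at the endpoints themselves, so a piece of length [d] is cut off
    at each end. The end pieces contribute at most [C * d] each since [h] is bounded, and the middle
    one at most [2 * C * d] by the linear bounds on [G] at [a + d] and [b - d]. *)
Lemma FTC_vanishing (G h : R -> R) (a b C : R) : a < b ->
  (forall t, a < t < b -> is_derive t 1 G (h t)) ->
  (forall t, a < t < b -> {for t, continuous h}) ->
  (forall t, a < t < b -> `|h t| <= C) ->
  (forall t, a < t < b -> `|G t| <= C * (t - a)) ->
  (forall t, a < t < b -> `|G t| <= C * (b - t)) ->
  mu.-integrable `]a, b[ (EFin \o h) /\ \int[mu]_(t in `]a, b[) h t = 0.
Proof.
move=> ab dG ch hC Ga Gb.
have mi : (mu `]a, b[ < +oo)%E.
  by rewrite /= lebesgue_measure_itv/= lte_fin; case: ifPn => // _; rewrite -EFinB ltry.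
have mh : measurable_fun `]a, b[ h.
  apply: open_continuous_measurable_fun => //.
  by move=> t; rewrite inE/= in_itv/=; exact: ch.
have ih : mu.-integrable `]a, b[ (EFin \o h).
  by apply: (bounded_integrable (C := C)) => // t /=; rewrite in_itv/= => /hC.
have C0 : 0 <= C.
  by apply: le_trans (hC ((a + b) / 2) _); [exact: normr_ge0|rewrite midf_lt// midf_lt].
split => //; apply/eqP; rewrite -normr_le0; apply/ler_addgt0Pr => e e0; rewrite add0r.
have [d [d0 dab dC]] : exists d : R, [/\ 0 < d, 2 * d < b - a & 4 * C * d <= e].
  (* The [+ 1] keeps the denominator positive when [C = 0]. *)
  exists (Num.min ((b - a) / 4) (e / (4 * C + 1))).
  have e1 : 0 < e / (4 * C + 1) by rewrite divr_gt0//; lra.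
  split.
  - by rewrite lt_min e1 andbT divr_gt0// subr_gt0.
  - apply: (@le_lt_trans _ _ (2 * ((b - a) / 4))); last lra.
    by rewrite ler_pM2l// ge_min lexx.
  - apply: (@le_trans _ _ (4 * C * (e / (4 * C + 1)))).
      by rewrite ler_wpM2l ?mulr_ge0// ge_min lexx orbT.
    by rewrite mulrCA ger_pMr// ler_pdivrMr; lra.
have E : `]a, b[%classic = `]a, (a + d)[ `|` (`[(a + d), (b - d)] `|` `](b - d), b[) :> set R.
  apply/seteqP; split => t /=; rewrite !in_itv/=.
    move=> /andP[at_ tb]; have [|] := ltP t (a + d); first by left; rewrite at_.
    by right; have [|] := leP t (b - d); [left; apply/andP|right; apply/andP].
  by move=> [|[]]; lra.
have sub1 : `]a, (a + d)[ `<=` `]a, b[.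
  by move=> t /=; rewrite !in_itv/=; lra.
have sub2 : `](b - d), b[ `<=` `]a, b[.
  by move=> t /=; rewrite !in_itv/=; lra.
rewrite E Rintegral_setU//; last 3 first.
- exact: measurableU.
- by rewrite -E.
- by apply/disj_setPLR => t /=; rewrite !in_itv/= => ?; case; lra.
rewrite Rintegral_setU//; last 2 first.
- apply: integrableS ih => //; first exact: measurableU.
  by rewrite E; exact: subsetUr.
- by apply/disj_setPLR => t /=; rewrite !in_itv/= => ?; lra.
have e1 : `|\int[mu]_(t in `]a, (a + d)[) h t| <= C * d.
  rewrite {2}(_ : d = a + d - a); last by ring.
  apply: Rintegral_le_cst => //; first lra.
    exact: measurable_funS mh.
  by move=> t ?; apply: hC; lra.
have e3 : `|\int[mu]_(t in `](b - d), b[) h t| <= C * d.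
  rewrite {2}(_ : d = b - (b - d)); last by ring.
  apply: Rintegral_le_cst => //; first lra.
    exact: measurable_funS mh.
  by move=> t ?; apply: hC; lra.
have e2 : `|\int[mu]_(t in `[(a + d), (b - d)]) h t| <= C * d + C * d.
  have cG t : a < t < b -> {for t, continuous G} by move=> /dG; exact: is_derive_continuous.
  rewrite /Rintegral (@continuous_FTC2 R h G)//=; last 4 first.
  - lra.
  - by apply: continuous_in_subspaceT => t; rewrite inE/= in_itv/= => ?; apply: ch; lra.
  - split.
    + by move=> t; rewrite in_itv/= => ?; apply: is_derive_derivable (dG _ _); lra.
    + by apply: cvg_at_right_filter; apply: cG; lra.
    + by apply: cvg_at_left_filter; apply: cG; lra.
  - by move=> t; rewrite in_itv/= => ?; apply: is_derive1E (dG _ _); lra.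
  apply: (le_trans (ler_normB _ _)); apply: lerD.
    by apply: (le_trans (Gb _ _)); [lra|rewrite subKr].
  by apply: (le_trans (Ga _ _)); [lra|rewrite addrAC subrr add0r].
apply: (le_trans (ler_normD _ _)).
apply: (le_trans (lerD e1 (le_trans (ler_normD _ _) (lerD e2 e3)))); apply: le_trans dC.
by rewrite (_ : 4 * C * d = C * d + (C * d + C * d + C * d))//; ring.
Qed.

End ftc.

(** * Sign, differential equation and growth of the logarithmic derivative *)

Section psi.
Context {R : realType}.
Variables (N : nat) (a r z : R).
Hypotheses (a0 : 0 <= a) (aN : a <= (N%:R - 2) / 2) (r0 : 0 < r)
  (hz : first_zero (besselJ a) z).

Let z0 : 0 < z. Proof. by case: hz. Qed.
(** For [t > 0], [Phi t] is a positive constant times [t ^ (- kappa) * bser a (beta * t ^ 2)], since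
    [(z / r * t) ^ 2 / 4 = beta * t ^ 2]. The two terms of [psi] are the logarithmic derivatives of
    these two factors. *)
Definition kappa : R := (N%:R - 2) / 2 - a.
Definition beta : R := z ^+ 2 / (4 * r ^+ 2).
Let U := z ^+ 2 / 4.

(* The logarithmic derivative of [t `^ ((2 - N) / 2) * besselJ a (z / r * t)]. *)
Definition psi (t : R) : R :=
  - kappa / t + 2 * beta * t * (bser1 a (beta * t ^+ 2) / bser a (beta * t ^+ 2)).

Lemma kappa_ge0 : 0 <= kappa. Proof. by rewrite /kappa subr_ge0. Qed.
Lemma beta_gt0 : 0 < beta.
Proof. by rewrite /beta divr_gt0 ?exprn_gt0// mulr_gt0// exprn_gt0. Qed.

Lemma beta_itv t : 0 <= t < r -> 0 <= beta * t ^+ 2 < U.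
Proof.
move=> /andP[t0 tr]; rewrite mulr_ge0 ?exprn_ge0 ?(ltW beta_gt0)//=.
have -> : U = beta * r ^+ 2 by rewrite /U /beta; field; rewrite gt_eqF.
by rewrite ltr_pM2l ?beta_gt0// ltr_pXn2r ?nnegrE// ltW.
Qed.

Lemma bser_beta_gt0 t : 0 <= t < r -> 0 < bser a (beta * t ^+ 2).
Proof. by move=> /beta_itv; exact: bser_gt0. Qed.

(** Each term is nonpositive: [kappa >= 0] by the upper bound on [a], and [bser1 < 0 < bser] before
    the first zero. *)
Lemma psi_le0 t : 0 < t < r -> psi t <= 0.
Proof.
move=> /andP[t0 tr]; have t1 : 0 <= t < r by rewrite (ltW t0).
have b0 := bser_beta_gt0 t1.
have b1 : bser1 a (beta * t ^+ 2) < 0.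
  by apply: (bser1_lt0 a0 hz); have /andP[-> /ltW ->] := beta_itv t1.
have k : - kappa / t <= 0 by rewrite mulNr oppr_le0 divr_ge0 ?kappa_ge0// ltW.
have : 2 * beta * t * (bser1 a (beta * t ^+ 2) / bser a (beta * t ^+ 2)) <= 0.
  apply: mulr_ge0_le0; first exact: mulr_ge0 (mulr_ge0 (ler0n _ 2) (ltW beta_gt0)) (ltW t0).
  by apply: mulr_le0_ge0; rewrite ?invr_ge0 ltW.
by rewrite /psi; lra.
Qed.

Definition Phi (t : R) : R := t `^ ((2 - N%:R) / 2) * besselJ a (z / r * t).

Let zt t : (z / r * t) ^+ 2 / 4 = beta * t ^+ 2.
Proof. by rewrite /beta; field; rewrite gt_eqF. Qed.

Lemma besselJ_gt0 t : 0 < t < r -> 0 < besselJ a (z / r * t).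
Proof.
move=> /andP[t0 tr]; have zr : 0 < z / r * t by rewrite mulr_gt0// divr_gt0.
rewrite besselJE// zt; apply: mulr_gt0; first by rewrite powR_gt0// divr_gt0.
by rewrite bser_beta_gt0// (ltW t0).
Qed.

Lemma Phi_gt0 t : 0 < t < r -> 0 < Phi t.
Proof. by move=> tr; rewrite mulr_gt0 ?besselJ_gt0// powR_gt0; case/andP: tr. Qed.

Lemma psiE t : 0 < t < r ->
  (2 - N%:R) / (2 * t) + z / r * (derive1 (besselJ a) (z / r * t) / besselJ a (z / r * t)) = psi t.
Proof.
move=> /andP[t0 tr]; have zr : 0 < z / r * t by rewrite mulr_gt0// divr_gt0.
have b0 : 0 < bser a (beta * t ^+ 2) by rewrite bser_beta_gt0// (ltW t0).
have p0 : 0 < (z / r * t / 2) `^ a by rewrite powR_gt0// divr_gt0.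
rewrite (is_derive1E (is_derive_besselJ a0 zr)) besselJE// !zt /psi /kappa.

move: b0 p0; set b := bser _ _; set b1 := bser1 _ _; set p := _ `^ _ => b0 p0.
rewrite /beta; field.
by rewrite !gt_eqF//=.
Qed.

Lemma is_derive_Phi t : 0 < t < r -> is_derive t 1 Phi (psi t * Phi t).
Proof.
move=> tr; have /andP[t0 tr'] := tr; have zr : 0 < z / r * t by rewrite mulr_gt0// divr_gt0.
have H1 := is_derive1_powR ((2 - N%:R) / 2) t0.
have HZ : is_derive t 1 ( *%R (z / r)) (z / r).
  have := is_deriveZ (z / r) (is_derive_id t 1).
  by move=> K; apply: (is_derive_eq K); rewrite /GRing.scale/= mulr1.
have H2 := @is_derive1_comp R (besselJ a) ( *%R (z / r)) t _ _ (is_derive_besselJ a0 zr) HZ.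
have H := is_deriveM H1 H2.
apply: (is_derive_eq H); rewrite -(psiE tr) (is_derive1E (is_derive_besselJ a0 zr)) /Phi.
rewrite powRB; last by apply/implyP => _; rewrite gt_eqF.
rewrite powRr1 ?(ltW t0)//; have J0 := besselJ_gt0 tr.
rewrite /GRing.scale/=; move: J0; set J := besselJ _ _; set b := bser _ _.
set b1 := bser1 _ _; set p := _ `^ a; set p1 := t `^ _ => J0; field.
by rewrite !gt_eqF.
Qed.

Lemma is_derive_psi t : 0 < t < r ->
  is_derive t 1 psi (- psi t ^+ 2 - (N%:R - 1) / t * psi t
     - ((N%:R - 2) ^+ 2 / 4 - a ^+ 2) / t ^+ 2 - z ^+ 2 / r ^+ 2).
Proof.
move=> tr; have /andP[t0 tr'] := tr.
have b0 : 0 < bser a (beta * t ^+ 2) by rewrite bser_beta_gt0// (ltW t0).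
have HS : is_derive t 1 (fun t : R => beta * t ^+ 2) (2 * beta * t).
  have I := is_derive_id t 1.
  have := is_deriveZ beta (is_deriveM I I).
  by move=> K; apply: (is_derive_eq K); rewrite /GRing.scale/= mulr1; ring.
have HV : is_derive t 1 (fun t : R => t^-1) (- t ^- 2).
  have K := @is_deriveV _ id t _ 1 (lt0r_neq0 t0) (is_derive_id t 1).
  by apply: (is_derive_eq K); rewrite /GRing.scale/= mulr1.
have H1 := @is_derive1_comp R (bser a) _ t _ _ (is_derive_bser _ a0) HS.
have H2 := @is_derive1_comp R (bser1 a) _ t _ _ (is_derive_bser1 _ a0) HS.
have H3 := @is_deriveV _ (bser a \o (fun t : R => beta * t ^+ 2)) t _ 1 (lt0r_neq0 b0) H1.
have H := is_deriveD (is_deriveZ (- kappa) HV)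
   (is_deriveM (is_deriveZ (2 * beta) (is_derive_id t 1)) (is_deriveM H2 H3)).
rewrite (_ : _ + _ = psi) in H; last by apply/funext.
apply: (is_derive_eq H); rewrite /psi /GRing.scale/=.
have := bser_ode (beta * t ^+ 2) a0.
move: b0; set b := bser _ _; set b1 := bser1 _ _; set b2 := bser2 _ _ => b0 ode.
have zr : z ^+ 2 / r ^+ 2 = 4 * beta by rewrite /beta; field; rewrite gt_eqF.
rewrite zr.
(* The differential equation of the series eliminates the second derivative; what remains is an
   identity of rational functions. *)
have -> : b2 = - ((a + 1) * b1 + b) / (beta * t ^+ 2).
  have bt : beta * t ^+ 2 != 0 by rewrite mulf_neq0 ?expf_neq0 ?gt_eqF ?beta_gt0.
  by apply: (mulfI bt); rewrite [RHS]mulrC divfK//; move: ode; lra.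
rewrite -[((2 * beta) *: t)]/((2 * beta) * t) !fctE /= -/b -/b1 /kappa; field.
by rewrite !gt_eqF ?beta_gt0.
Qed.

(** Near [r] the denominator is at least [d * (U - beta * t ^ 2)], that is
    [d * beta * (r - t) * (r + t)]. The factor [beta] cancels and [t / (r + t) <= 1], which leaves a
    simple pole; its constant uses the minimum of [bser1] on [[0, U]]. *)
Lemma psi_bound : exists2 C : R, 0 <= C &
  forall t, 0 < t < r -> `|psi t| <= kappa / t + C / (r - t).
Proof.
have [d d0 Hd] := bser_lower_bound a0 hz.
have [| |c] := @EVT_min R (bser1 a) 0 U.
- by rewrite divr_ge0// exprn_ge0// ltW.
- by apply: continuous_subspaceT; exact: continuous_bser1.
rewrite in_itv/= => cU hc.
exists (2 * (- bser1 a c) / d).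
  by rewrite divr_ge0 ?(ltW d0)// mulr_ge0// oppr_ge0 ltW// (bser1_lt0 a0 hz).
move=> t /andP[t0 tr]; have t1 : 0 <= t < r by rewrite (ltW t0).
have b0 := bser_beta_gt0 t1; have /andP[u0 uU] := beta_itv t1.
have b1 : bser1 a (beta * t ^+ 2) < 0.
  by apply: (bser1_lt0 a0 hz); rewrite u0 ltW.
have b1c : bser1 a c <= bser1 a (beta * t ^+ 2).
  by apply: hc; rewrite in_itv/= u0 ltW.
have bl : d * (U - beta * t ^+ 2) <= bser a (beta * t ^+ 2) by apply: Hd; rewrite u0 ltW.
have UE : U - beta * t ^+ 2 = beta * ((r - t) * (r + t)).
  by rewrite /U /beta; field; rewrite gt_eqF.
have be0 := beta_gt0.
have rt : 0 < r - t by lra.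
have rr := r0; have rt' : 0 < r + t by rewrite addr_gt0.
have pos : 0 < d * (beta * ((r - t) * (r + t))).
  exact: mulr_gt0 d0 (mulr_gt0 be0 (mulr_gt0 rt rt')).
rewrite /psi; apply: (le_trans (ler_normD _ _)); apply: lerD.
  by rewrite mulNr normrN ger0_norm// divr_ge0 ?kappa_ge0// ltW.
have bt0 : 0 <= 2 * beta * t := mulr_ge0 (mulr_ge0 (ler0n _ 2) (ltW be0)) (ltW t0).
rewrite normrM (ger0_norm bt0).
rewrite normrM normfV (ltr0_norm b1) (gtr0_norm b0).
apply: (@le_trans _ _ (2 * beta * t * (- bser1 a c / (d * (beta * ((r - t) * (r + t))))))).
  apply: (ler_wpM2l bt0); apply: ler_pM.
  - by rewrite oppr_ge0 ltW.
  - by rewrite invr_ge0 ltW.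
  - by rewrite lerN2.
  - by rewrite lef_pV2 ?posrE// -UE.
have -> : 2 * beta * t * (- bser1 a c / (d * (beta * ((r - t) * (r + t))))) =
    2 * - bser1 a c / d / (r - t) * (t / (r + t)).
  by field; rewrite !gt_eqF//; lra.
rewrite ler_piMr//; last by rewrite ler_pdivrMr; lra.
rewrite !mulr_ge0 ?invr_ge0 ?(ltW d0) ?(ltW rt)//.
by rewrite oppr_ge0; apply: (le_trans b1c); exact: ltW.
Qed.

End psi.

(** * Integrals over the punctured geodesic ball *)

Section compact_support.
Context {R : realType} {n : nat}.
Implicit Types (f : 'rV[R]_n -> R) (x : 'rV[R]_n).

Lemma compact_support_bounded (K : set 'rV[R]_n) (h : 'rV[R]_n -> R) :
  compact K -> K `<=` hball -> (forall x, hball x -> {for x, continuous h}) ->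
  (forall x, hball x -> ~ K x -> h x = 0) ->
  exists2 M : R, 0 <= M & forall x, hball x -> `|h x| <= M.
Proof.
move=> cK Kb ch h0.
have cw : {within K, continuous h}.
  by apply: continuous_in_subspaceT => x; rewrite inE => /Kb; exact: ch.
have /compact_bounded[M [_ HM]] := continuous_compact cw cK.
exists (`|M| + 1) => [|x bx]; first by rewrite addr_ge0.
have [Kx|/(h0 _ bx) ->] := pselect (K x); last by rewrite normr0 addr_ge0.
apply: HM; first by have := ler_norm M; lra.
by exists x.
Qed.

Lemma Cc_bounded f : Cc_infty f ->
  exists2 M : R, 0 < M & forall x, hball x ->
    `|f x| <= M /\ dot (egrad f x) (egrad f x) <= M ^+ 2.
Proof.
move=> [sf [K [cK Kb fK]]].
have df x : hball x -> differentiable f x by move=> bx; exact: (sf [::] x bx).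
have dpf i x : hball x -> differentiable (partial i f) x by move=> bx; exact: (sf [:: i] x bx).
have [M M0 HM] := compact_support_bounded cK Kb (fun x bx => differentiable_continuous (df x bx)) fK.
have clK : closed K by apply: compact_closed => //; exact: norm_hausdorff.
have pK i x : hball x -> ~ K x -> partial i f x = 0.
  move=> bx Kx; transitivity ('D_(delta_mx 0 i) (cst (0 : R)) x); last exact: derive_cst.
  apply: near_eq_derive.
  have oU : open (hball `&` ~` K) by apply: openI; [exact: open_hball|rewrite openC].
  by apply: filterS (open_nbhs_nbhs (conj oU (conj bx Kx))) => y [by_ Ky]; exact: fK.
have Hp i : exists M : R, 0 <= M /\ forall x, hball x -> `|partial i f x| <= M.
  have [M' M'0 H] := compact_support_bounded cK Kb
    (fun x bx => differentiable_continuous (dpf i x bx)) (pK i).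
  by exists M'.
have [Mp HMp] := choice Hp.
pose S := \sum_i Mp i ^+ 2.
have S0 : 0 <= S by apply: sumr_ge0 => i _; exact: sqr_ge0.
(* The bound is at least 1, so that [S] is below its square. *)
exists (M + S + 1) => [|x bx]; first by lra.
split; first by apply: (le_trans (HM x bx)); lra.
apply: (@le_trans _ _ S); last first.
  rewrite expr2; apply: (@le_trans _ _ (1 * (M + S + 1))); first lra.
  by rewrite ler_wpM2r; lra.
apply: ler_sum => i _; rewrite mxE -expr2 -[leLHS]real_normK ?num_real//.
by rewrite ler_pXn2r ?nnegrE// ?(HMp i).1// (HMp i).2.
Qed.

(** The mean value theorem on the Euclidean segment from [x] outwards to the geodesic sphere, where
    [f] vanishes. *)
Lemma Cc_boundary f r M : 0 < r -> Cc_infty f ->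
  (forall x, hball x -> dot (egrad f x) (egrad f x) <= M ^+ 2) -> 0 < M ->
  (forall x, hball x -> hrho x = r -> f x = 0) ->
  forall x, hball x -> 0 < hrho x < r -> `|f x| <= M * (tanh (r / 2) - enorm x).
Proof.
move=> r0 [sf _] fM M0 fr x bx; rewrite hrho_gt0// hrho_lt// => /andP[e0 eT].
set T := tanh (r / 2) in eT *.
have df y : hball y -> differentiable f y by move=> by_; exact: (sf [::] y by_).
have T1 : T < 1.
  by rewrite /T tanhE ltr_pdivrMr; have := expR_gt0 r; lra.
pose u := (enorm x)^-1 *: x.
have u1 : enorm u = 1 by rewrite enormZ normfV ger0_norm ?enorm_ge0// mulVf// gt_eqF.
have nu s : 0 <= s -> enorm (s *: u) = s by move=> s0; rewrite enormZ u1 mulr1 ger0_norm.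
have bu s : 0 <= s <= T -> hball (s *: u).
  by move=> /andP[s0 sT]; rewrite /hball/= nu//; apply: le_lt_trans T1.
have T0 : 0 < T by apply: lt_trans eT.
have xE : x = enorm x *: u by rewrite /u scalerA mulfV ?scale1r// gt_eqF.
have fT : f (T *: u) = 0.
  apply: fr; first by apply: bu; rewrite lexx ltW.
  apply: (@expR_inj R); rewrite expR_hrho; last by apply: bu; rewrite lexx ltW.
  rewrite nu ?(ltW T0)// /T tanhE; have := expR_gt0 r => ?; field.
  by rewrite !gt_eqF//; lra.
have dfu (s : R) : 0 <= s <= T -> is_derive s 1 (fun s => f (s *: u)) (dot (egrad f (s *: u)) u).
  move=> sT; rewrite -diff_dot; last by apply: df; exact: bu.
  have H := is_derive_scalel u (is_derive_id s 1); rewrite scale1r in H.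
  by apply: is_derive_curve => //; apply: df; exact: bu.
have [| |c] := @MVT_segment R (fun s => f (s *: u)) (fun s => dot (egrad f (s *: u)) u) _ _ (ltW eT).
- by move=> s; rewrite in_itv/= => ?; apply: dfu; lra.
- apply: continuous_in_subspaceT => s; rewrite inE/= in_itv/= => ?.
  by apply: is_derive_continuous (dfu _ _); lra.
rewrite in_itv/= fT -xE sub0r => /andP[c0 cT] /eqP; rewrite eqr_oppLR => /eqP ->.
rewrite normrN normrM (ger0_norm (_ : 0 <= T - enorm x)); last by rewrite subr_ge0 ltW.
rewrite ler_wpM2r ?subr_ge0 ?(ltW eT)//.
have uu : dot u u = 1 by rewrite -enorm_sqr u1 expr1n.
apply: (le_trans (dot_le _ uu)).
rewrite -(ler_pXn2r (n := 2)) ?nnegrE ?enorm_ge0 ?(ltW M0)// enorm_sqr.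
by apply: fM; apply: bu; lra.
Qed.

(** The geodesic distance has derivative [2 / (1 - e ^ 2) >= 1] in the Euclidean radius [e].
    Combined with [Cc_boundary] it gives [|f| <= M * (r - rho)], the rate that compensates the pole
    of [psi]. *)
Lemma hrho_upper_gap x r : hball x -> hrho x < r -> tanh (r / 2) - enorm x <= r - hrho x.
Proof.
move=> bx; rewrite hrho_lt// => eT; set T := tanh (r / 2) in eT *.
have e0 := enorm_ge0 x.
have T1 : T < 1.
  by rewrite /T tanhE ltr_pdivrMr; have := expR_gt0 r; lra.
have dl (e : R) : 0 <= e <= T -> is_derive e 1 (fun e : R => ln ((1 + e) / (1 - e))) (2 / (1 - e ^+ 2)).
  by move=> ?; apply: is_derive_lnratio; lra.
have [| |c] := @MVT_segment R (fun e : R => ln ((1 + e) / (1 - e))) (fun e => 2 / (1 - e ^+ 2)) _ _ (ltW eT).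
- by move=> s; rewrite in_itv/= => ?; apply: dl; lra.
- apply: continuous_in_subspaceT => s; rewrite inE/= in_itv/= => ?.
  by apply: is_derive_continuous (dl _ _); lra.
rewrite -hrhoE// in_itv/= => /andP[c0 cT].
have -> : ln ((1 + T) / (1 - T)) = r.
  rewrite -[RHS]expRK; congr ln; rewrite /T tanhE; have := expR_gt0 r => ?; field.
  by rewrite !gt_eqF//; lra.
move=> ->; rewrite -[leLHS]mul1r ler_wpM2r//; first lra.
rewrite ler_pdivlMr; last first.
  by rewrite (_ : 1 - c ^+ 2 = (1 + c) * (1 - c)); [rewrite mulr_gt0; lra|ring].
by have := sqr_ge0 c; lra.
Qed.

End compact_support.

Lemma continuous_expn (R : realType) (V : topologicalType) (k : nat) (x : V) (h : V -> R) :
  {for x, continuous h} -> {for x, continuous (fun y => h y ^+ k)}.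
Proof.
move=> ch; elim: k => [|k IH]; first exact: cst_continuous.
rewrite (_ : (fun y => _) = (fun y => h y * h y ^+ k)); last by apply/funext => y; rewrite exprS.
exact: continuousM.
Qed.

(** Simple functions below [f] are also below [g], so the defining suprema compare. It is applied to
    ray integrals as functions of the ray, about which only pointwise bounds are at hand. *)
Lemma le_integral_ge0 d (T : measurableType d) (R : realType)
    (m : {measure set T -> \bar R}) (D : set T) (f g : T -> \bar R) :
  (forall x, D x -> (0 <= f x)%E) -> (forall x, D x -> (f x <= g x)%E) ->
  (\int[m]_(x in D) f x <= \int[m]_(x in D) g x)%E.
Proof.
move=> f0 fg; rewrite !ge0_integralE//; last by move=> x Dx; apply: le_trans (fg x Dx); exact: f0.
apply: le_ereal_sup => _ [h hf <-]; exists h => // x.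
apply: (le_trans (hf x)); rewrite !patchE; case: ifPn => //; rewrite inE; exact: fg.
Qed.

(** * Integrable densities and their integrals along rays *)

Section punctured_ball.
Context {R : realType} {n : nat}.
Variable r : R.
Hypothesis r0 : 0 < r.
Notation mu := (@lebesgue_measure R).
Notation T := (n.-tuple (measurableTypeR R)).
Notation rv := (@rv_of_tuple R n).
Implicit Types (x y : 'rV[R]_n) (F : 'rV[R]_n -> R).

Definition hpunc : set 'rV[R]_n := hball `&` [set x | 0 < hrho x < r].

Let b := tanh (r / 2).

Lemma tanh_half_itv : 0 < b < 1.
Proof.
have e1 : 1 < expR r by rewrite -[ltLHS](@expR0 R) ltr_expR.
by rewrite /b tanhE divr_gt0 ?ltr_pdivrMr; lra.
Qed.

Lemma hpuncE x : hpunc x <-> 0 < enorm x < b.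
Proof.
have /andP[b0 b1] := tanh_half_itv.
split=> [[bx /=]|/andP[e0 eb]]; first by rewrite hrho_gt0// hrho_lt.
have bx : hball x by exact: lt_trans eb b1.
by split => //=; rewrite hrho_gt0// hrho_lt// e0.
Qed.

Lemma hpunc_neq0 x : hpunc x -> x != 0.
Proof. by move=> /hpuncE/andP[e0 _]; rewrite -enorm_eq0 gt_eqF. Qed.

Lemma open_hpunc : open hpunc.
Proof.
rewrite (_ : hpunc = enorm @^-1` `]0, b[%classic); last first.
  apply/seteqP; split => x; first by move/hpuncE; rewrite /= in_itv.
  by rewrite /= in_itv/= => ?; apply/hpuncE.
apply: open_comp; last exact: interval_open.
by move=> x _; exact: enorm_continuous.
Qed.

Lemma measurable_hpunc : measurable (rv @^-1` hpunc : set T).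
Proof. exact: open_measurable_rv open_hpunc. Qed.

Lemma conf_hpunc x : hpunc x -> 2 <= conf x <= 2 / (1 - b ^+ 2).
Proof.
move=> /hpuncE/andP[e0 eb]; have /andP[b0 b1] := tanh_half_itv.
have h : enorm x ^+ 2 < b ^+ 2 by rewrite ltr_pXn2r ?nnegrE// ltW.
have b2 : b ^+ 2 < 1 by rewrite -[ltRHS](expr1n _ 2) ltr_pXn2r ?nnegrE// ltW.
have e2 := sqr_ge0 (enorm x).
rewrite confE ler_pM2l// lef_pV2 ?posrE ?ler_pdivlMr; lra.
Qed.

Definition vol_density F (t : T) : R := F (rv t) * conf (rv t) ^+ n.

(* [1 + (n - 2) / |x|^2]: for [n = 2] the singular term is absent, since
   [1 / |x|^2] is then not integrable. *)
Definition sing x : R := 1 + (n%:R - 2) / enorm x ^+ 2.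

(** The class is closed under linear combinations, its members are integrable for the volume, and
    their ray integrals are uniformly bounded. All the real-valued computations with integrals take
    place in it. *)
Definition admissible F := (forall x, hpunc x -> {for x, continuous F}) /\
  exists2 C : R, 0 <= C & forall x, hpunc x -> `|F x| <= C * sing x.

Hypothesis n2 : (2 <= n)%N.
Let n2R : 0 <= n%:R - 2 :> R. Proof. by rewrite subr_ge0 ler_nat. Qed.

Lemma sing_ge1 x : 1 <= sing x.
Proof. by rewrite lerDl divr_ge0// exprn_ge0// enorm_ge0. Qed.

Lemma admissible_bounded F (C : R) : (forall x, hpunc x -> {for x, continuous F}) ->
  (forall x, hpunc x -> `|F x| <= C) -> admissible F.
Proof.
move=> cF FC; split => //; exists `|C| => // x Dx; apply: (le_trans (FC x Dx)).
by apply: (le_trans (ler_norm _)); rewrite ler_peMr// sing_ge1.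
Qed.

Lemma admissibleD F G : admissible F -> admissible G -> admissible (fun x => F x + G x).
Proof.
move=> [cF [C C0 FC]] [cG [C' C'0 GC]]; split.
  by move=> x Dx; apply: continuousD; [exact: cF|exact: cG].
exists (C + C') => [|x Dx]; first exact: addr_ge0.
by rewrite mulrDl (le_trans (ler_normD _ _))// lerD ?FC ?GC.
Qed.

Lemma admissibleZ (k : R) F : admissible F -> admissible (fun x => k * F x).
Proof.
move=> [cF [C C0 FC]]; split.
  by move=> x Dx; apply: continuousM; [exact: cst_continuous|exact: cF].
exists (`|k| * C) => [|x Dx]; first by rewrite mulr_ge0.
by rewrite normrM -mulrA ler_wpM2l// FC.
Qed.

Lemma hpunc_ray y (t : R) : 1 < enorm y < 2 -> 0 < t ->
  hpunc (t *: y) <-> t < b / enorm y.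
Proof.
move=> /andP[y1 y2] t0; have y0 : 0 < enorm y by lra.
split=> [/hpuncE|h]; last apply/hpuncE; rewrite enormZ gtr0_norm//.
  by move=> /andP[_]; rewrite (ltr_pdivlMr _ _ y0).
by rewrite mulr_gt0//=; move: h; rewrite (ltr_pdivlMr _ _ y0).
Qed.

(** The factor [t ^ (n - 1)] absorbs the singularity: its product with [1 / t ^ 2] is
    [t ^ (n - 3) <= 1] if [n >= 3], and for [n = 2] the singular term has coefficient 0. In the
    constant, [n - 1 = 1 + (n - 2)] collects the two terms of [sing], and [c] bounds [conf] on the
    ball. *)
Lemma ray_bound F (C : R) : 0 <= C -> (forall x, hpunc x -> `|F x| <= C * sing x) ->
  exists2 C' : R, 0 <= C' & forall y t, 1 < enorm y < 2 -> 0 < t < b / enorm y ->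
    `|F (t *: y) * conf (t *: y) ^+ n * (t ^+ n / t)| <= C'.
Proof.
move=> C0 FC; have /andP[b0 b1] := tanh_half_itv.
set c := 2 / (1 - b ^+ 2).
have b2 : b ^+ 2 < 1 by rewrite -[ltRHS](expr1n _ 2) ltr_pXn2r ?nnegrE// ltW.
have c0 : 0 <= c by rewrite divr_ge0//; lra.
have nn := n2R.
exists (C * (n%:R - 1) * c ^+ n) => [|y t ym /andP[t0 tb]].
  by rewrite !mulr_ge0 ?exprn_ge0//; lra.
have /andP[m1 m2] := ym; set m := enorm y in ym m1 m2 tb.
have Dx : hpunc (t *: y) by apply/hpunc_ray.
have /andP[cf2 cfc] := conf_hpunc Dx.
have t1 : t < 1.
  apply: (lt_trans tb); rewrite ltr_pdivrMr; last lra.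
  by rewrite mul1r; lra.
have cf0 : 0 <= conf (t *: y) by lra.
move: (conf (t *: y)) cf2 cfc cf0 => q cf2 cfc cf0.
rewrite !normrM normrX (ger0_norm cf0) normfV normrX (gtr0_norm t0) -mulrA [_ ^+ n * (_ / _)]mulrC mulrA.
apply: ler_pM; rewrite ?exprn_ge0 ?mulr_ge0 ?invr_ge0 ?exprn_ge0 ?(ltW t0)//; last first.
  by rewrite lerXn2r ?nnegrE.
apply: (@le_trans _ _ (C * sing (t *: y) * (t ^+ n / t))).
  by rewrite ler_wpM2r ?FC// divr_ge0 ?exprn_ge0 ?ltW.
rewrite -mulrA ler_wpM2l// /sing enormZ (gtr0_norm t0) -/m.
have [k nk] : exists k, n = k.+2 by exists n.-2; case: n n2 => [|[]].
have tk : t ^+ n / t = t ^+ k * t by rewrite nk !exprSr mulfK ?gt_eqF.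
have tk1 : t ^+ k <= 1 by rewrite exprn_ile1 ?ltW.
have tk0 : 0 <= t ^+ k by rewrite exprn_ge0 ?ltW.
rewrite mulrDl mul1r (_ : n%:R - 1 = 1 + (n%:R - 2)); last by ring.
apply: lerD; first by rewrite tk -[leRHS]mulr1; apply: ler_pM => //; exact: ltW.
case: k nk tk tk1 tk0 => [|j] nk tk tk1 tk0.
  by rewrite nk subrr !mul0r.
rewrite -mulrA ler_piMr// tk.
have -> : (t * m) ^- 2 * (t ^+ j.+1 * t) = t ^+ j / m ^+ 2.
  by rewrite (exprSr t j); field; rewrite !gt_eqF//; lra.
rewrite ler_pdivrMr ?exprn_gt0//; last lra.
rewrite mul1r (@le_trans _ _ 1)//; first by rewrite exprn_ile1 ?ltW.
by rewrite exprn_ege1// ltW.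
Qed.

Lemma measurable_vol_density F : (forall x, hpunc x -> {for x, continuous F}) ->
  measurable_fun (rv @^-1` hpunc : set T) (vol_density F).
Proof.
move=> cF; apply: (open_continuous_measurable_rv (F := fun x => F x * conf x ^+ n) open_hpunc).
move=> x Dx; apply: continuousM; first exact: cF.
by apply: continuous_expn; apply: conf_continuous; case: Dx.
Qed.

Lemma measurable_annulus : measurable [set y : T | (1 < tnorm y < 2)%R].
Proof.
rewrite (_ : mkset _ = (@tnorm R n) @^-1` `]1, 2[%classic); last first.
  by apply/seteqP; split => t; rewrite /= in_itv.
by rewrite -[X in measurable X]setTI; apply: measurable_tnorm => //; exact: measurable_itv.
Qed.

Lemma leb_annulus_fin : (leb n [set y : T | (1 < tnorm y < 2)%R] < +oo)%E.
Proof.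
pose A (i : 'I_n) : set (measurableTypeR R) := `[(-2 : R), 2]%classic.
have mA i : measurable (A i) by exact: measurable_itv.
apply: (@le_lt_trans _ _ (leb n [set t : T | forall i, A i (tnth t i)])).
  apply: le_measure; rewrite ?inE.
  - exact: measurable_annulus.
  - rewrite (_ : mkset _ = \bigcap_(i in [set: 'I_n]) ((@tnth _ _)^~ i @^-1` A i)).
      apply: fin_bigcap_measurable => // i _.
      by rewrite -[X in measurable X]setTI; exact: measurable_tnth.
    by apply/seteqP; split => [t tA i _|t tA i]; [exact: tA|exact: (tA i)].
  - move=> t /= /andP[_ t2] i; rewrite /A/= in_itv/= -ler_norml.
    apply: le_trans (ltW t2); rewrite /tnorm.
    rewrite -(ler_pXn2r (n := 2)) ?nnegrE ?enorm_ge0// enorm_sqr real_normK ?num_real//.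
    rewrite /dot (bigD1 i)//= !mxE -expr2 lerDl.
    by apply: sumr_ge0 => j _; rewrite -expr2 sqr_ge0.
rewrite leb_box// (eq_bigr (fun=> 4%:E)); last first.
  by move=> i _; rewrite lebesgue_measure_itv/= lte_fin ifT; [rewrite -EFinB; congr EFin|]; lra.
by rewrite prodEFin ltry.
Qed.

Lemma integral_polar_hpunc F : (forall x, hpunc x -> {for x, continuous F}) ->
  (forall x, hpunc x -> 0 <= F x) ->
  (\int[leb n]_(t in rv @^-1` hpunc) (vol_density F t)%:E =
   (ln 2)^-1%:E * \int[leb n]_(y in [set y | (1 < tnorm y < 2)%R])
     \int[mu]_(t in `]0%R, (b / tnorm y)%R[)
       (F (t *: rv y) * conf (t *: rv y) ^+ n * (t ^+ n / t))%:E)%E.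
Proof.
move=> cF F0; have /andP[b0 b1] := tanh_half_itv.
have ln20 : 0 < ln 2 :> R by rewrite ln_gt0// ltr1n.
pose H : T -> \bar R := (EFin \o vol_density F) \_ (rv @^-1` hpunc).
have mH : measurable_fun setT H.
  apply/(measurable_restrictT _ _).1; first exact: measurable_hpunc.
  by apply/measurable_EFinP; exact: measurable_vol_density.
have H0 t : (0 <= H t)%E.
  rewrite /H patchE; case: ifPn => //; rewrite inE => Dt.
  rewrite lee_fin mulr_ge0 ?F0// exprn_ge0//.
  by have /andP[c2 _] := conf_hpunc Dt; lra.
have Hz t : tnorm t = 0 -> H t = 0%E.
  move=> t0; rewrite /H patchE memNset//= => /hpuncE; rewrite -/(tnorm t) t0 ltxx//.
rewrite integral_mkcond -/H.
have -> : (\int[leb n]_t H t = (ln 2)^-1%:E * ((ln 2)%:E * \int[leb n]_t H t))%E.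
  by rewrite muleA -EFinM mulVf ?gt_eqF// mul1e.
congr (_ * _)%E; rewrite integral_polar//.
apply: eq_integral => y; rewrite inE/= => ym.
rewrite [LHS]integral_mkcond [RHS]integral_mkcond; apply: eq_integral => t _.
rewrite !patchE.
have y0 : 0 < tnorm y by lra.
rewrite (_ : (t \in _) = (0 < t)); last first.
  by apply/idP/idP; rewrite inE/= in_itv/= andbT.
have [t0|t0] := ltP 0 t; last first.
  by rewrite memNset//= in_itv/= => /andP[]; rewrite ltNge t0.
rewrite /H patchE.
rewrite (_ : (t \in `]0, _[%classic) = (tscale t y \in (rv @^-1` hpunc : set T))); last first.
  apply/idP/idP; rewrite !inE/= in_itv/= rv_of_tuple_tscale t0/=.
    by move=> tb; apply/hpunc_ray.
  by move=> /hpunc_ray; apply.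
case: ifPn => _; last by rewrite mul0e.
by rewrite /= /vol_density rv_of_tuple_tscale.
Qed.

Lemma ray_continuous F y (t : R) : (forall x, hpunc x -> {for x, continuous F}) ->
  1 < enorm y < 2 -> 0 < t < b / enorm y ->
  {for t, continuous (fun t : R => F (t *: y) * conf (t *: y) ^+ n * (t ^+ n / t))}.
Proof.
move=> cF ym /andP[t0 tb].
have Dx : hpunc (t *: y) by apply/hpunc_ray.
have cs : {for t, continuous (fun t : R => t *: y)} by exact: scalel_continuous.
apply: (@continuousM R R (fun t : R => F (t *: y) * conf (t *: y) ^+ n) (fun t => t ^+ n / t)).
  apply: (@continuousM R R (fun t : R => F (t *: y)) (fun t : R => conf (t *: y) ^+ n)).
    by apply: (continuous_comp cs); exact: cF.
  apply: (@continuous_expn _ _ _ _ (fun t : R => conf (t *: y))).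
  by apply: (continuous_comp cs); apply: conf_continuous; case: Dx.
apply: (@continuousM R R (fun t : R => t ^+ n) (fun t => t^-1)); first exact: exprn_continuous.
by apply: inv_continuous; rewrite gt_eqF.
Qed.

Lemma measurable_ray F y : (forall x, hpunc x -> {for x, continuous F}) ->
  1 < enorm y < 2 ->
  measurable_fun `]0, (b / enorm y)[ (fun t : R => F (t *: y) * conf (t *: y) ^+ n * (t ^+ n / t)).
Proof.
move=> cF ym; apply: open_continuous_measurable_fun => // t; rewrite inE/= in_itv/=.
exact: ray_continuous.
Qed.

Lemma ray_integrable F y : admissible F -> 1 < enorm y < 2 ->
  mu.-integrable `]0, (b / enorm y)[
    (EFin \o (fun t : R => F (t *: y) * conf (t *: y) ^+ n * (t ^+ n / t))).
Proof.
move=> [cF [C C0 FC]] ym; have [C' C'0 HC'] := ray_bound C0 FC.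
apply: (bounded_integrable (C := C')); first exact: measurable_ray.
- by rewrite lebesgue_measure_itv/=; case: ifPn => // _; rewrite ltry.
- by move=> t /=; rewrite in_itv/= => ?; exact: HC'.
Qed.

Lemma sing_continuous x : hpunc x -> {for x, continuous sing}.
Proof.
move=> /hpuncE/andP[e0 _].
apply: continuousD; first exact: cst_continuous.
apply: continuousM; first exact: cst_continuous.
apply: continuousV; first by rewrite expf_neq0// gt_eqF.
by apply: continuous_expn; exact: enorm_continuous.
Qed.

Lemma admissible_sing (C : R) : admissible (fun x => C * sing x).
Proof.
apply: admissibleZ; split; first exact: sing_continuous.
exists 1 => // x _; rewrite mul1r ger0_norm//.
by apply: le_trans (sing_ge1 x).
Qed.

Let annulus_bound F : admissible F -> (forall x, hpunc x -> 0 <= F x) ->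
  (\int[leb n]_(t in rv @^-1` hpunc) (vol_density F t)%:E < +oo)%E.
Proof.
move=> aF F0; have [cF [C C0 FC]] := aF; have [C' C'0 HC'] := ray_bound C0 FC.
have ln20 : 0 < ln 2 :> R by rewrite ln_gt0// ltr1n.
have /andP[b0 b1] := tanh_half_itv.
rewrite integral_polar_hpunc//; apply: lte_mul_pinfty; rewrite ?lee_fin ?invr_ge0 ?(ltW ln20)//.
pose A := [set y : T | (1 < tnorm y < 2)%R].
apply: (@le_lt_trans _ _ (\int[leb n]_(y in A) (cst C'%:E) y)%E).
  apply: le_integral_ge0 => y ym.
    apply: integral_ge0 => t; rewrite /= in_itv/= => /andP[t0 tb].
    have Dx : hpunc (t *: rv y) by apply/(hpunc_ray ym).
    have /andP[c2 _] := conf_hpunc Dx.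
    rewrite lee_fin mulr_ge0 ?divr_ge0 ?exprn_ge0 ?(ltW t0)// mulr_ge0 ?F0// exprn_ge0//.
    by apply: le_trans c2.
  have bm : b / tnorm y <= 1.
    by move: ym => /= /andP[y1 _]; rewrite (ler_pdivrMr _ _ (lt_trans ltr01 y1)) mul1r; lra.
  apply: (@le_trans _ _ (\int[mu]_(t in `]0%R, (b / tnorm y)%R[) (cst C'%:E) t)%E).
    apply: le_integral_ge0 => t; rewrite /= in_itv/= => /andP[t0 tb].
      have Dx : hpunc (t *: rv y) by apply/(hpunc_ray ym).
      have /andP[c2 _] := conf_hpunc Dx.
      rewrite lee_fin mulr_ge0 ?divr_ge0 ?exprn_ge0 ?(ltW t0)// mulr_ge0 ?F0// exprn_ge0//.
      by apply: le_trans c2.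
    rewrite lee_fin; apply: (le_trans (ler_norm _)); apply: HC' => //.
    by rewrite t0.
  rewrite integral_cst//= lebesgue_measure_itv/= lte_fin; case: ifPn => _; last by rewrite mule0 lee_fin.
  by rewrite -EFinB -EFinM lee_fin subr0 ler_piMr.
rewrite integral_cst//; last exact: measurable_annulus.
by apply: lte_mul_pinfty; rewrite ?lee_fin//; exact: leb_annulus_fin.
Qed.

Lemma admissible_integrable F : admissible F ->
  (leb n).-integrable (rv @^-1` hpunc) (EFin \o vol_density F).
Proof.
move=> aF; have [cF [C C0 FC]] := aF.
have aN : admissible (fun x => `|F x|).
  split; last by exists C => // x Dx; rewrite normr_id FC.
  move=> x Dx; apply: (continuous_comp (cF x Dx)); exact: norm_continuous.
apply/integrableP; split; first by apply/measurable_EFinP; exact: measurable_vol_density.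
apply: le_lt_trans (annulus_bound aN (fun x _ => normr_ge0 (F x))).
apply: le_integral_ge0 => t Dt //=.
rewrite /vol_density lee_fin normrM [`|conf _ ^+ n|]ger0_norm//.
by have /andP[c2 _] := conf_hpunc Dt; rewrite exprn_ge0//; lra.
Qed.

(* [integral_polar] is about nonnegative functions, hence it is applied to
   [F + C * sing] and to [C * sing]. *)
Lemma Rintegral_rays_eq0 F : admissible F ->
  (forall y, 1 < enorm y < 2 ->
    \int[mu]_(t in `]0, (b / enorm y)[) (F (t *: y) * conf (t *: y) ^+ n * (t ^+ n / t)) = 0) ->
  \int[leb n]_(t in rv @^-1` hpunc) vol_density F t = 0.
Proof.
move=> aF F0; have [cF [C C0 FC]] := aF.
pose B x := C * sing x.
have aB : admissible B by exact: admissible_sing.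
have B0 x : 0 <= B x by rewrite mulr_ge0//; apply: le_trans (sing_ge1 x).
have aFB : admissible (fun x => F x + B x) by exact: admissibleD.
have iF := admissible_integrable aF; have iB := admissible_integrable aB.
have mD := measurable_hpunc.
have rays y : 1 < enorm y < 2 ->
    (\int[mu]_(t in `]0%R, (b / enorm y)%R[)
      ((F (t *: y) + B (t *: y)) * conf (t *: y) ^+ n * (t ^+ n / t))%:E =
     \int[mu]_(t in `]0%R, (b / enorm y)%R[)
      (B (t *: y) * conf (t *: y) ^+ n * (t ^+ n / t))%:E)%E.
  move=> ym; have i1 := ray_integrable aF ym; have i2 := ray_integrable aB ym.
  rewrite -[LHS]fineK; last by apply: integrable_fin_num => //; exact: ray_integrable aFB ym.
  rewrite -[RHS]fineK; last exact: integrable_fin_num.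
  congr EFin.
  have mI : measurable (`]0, (b / enorm y)[%classic : set (measurableTypeR R)) by exact: measurable_itv.
  have := RintegralD mI i1 i2; rewrite F0// add0r => H; apply: etrans H.
  by rewrite /Rintegral; congr fine; apply: eq_integral => t _; congr EFin; rewrite !mulrDl.
have E : \int[leb n]_(t in rv @^-1` hpunc) vol_density (fun x => F x + B x) t =
         \int[leb n]_(t in rv @^-1` hpunc) vol_density B t.
  rewrite /Rintegral; congr fine; rewrite !integral_polar_hpunc//.
  - congr (_ * _)%E; apply: eq_integral => y; rewrite inE/= => ym.
    exact: rays ym.
  - by case: aB.
  - by case: aFB.
  - move=> x Dx; rewrite -lerBlDr sub0r lerNl; apply: le_trans (FC x Dx).
    by rewrite lerNl; apply: lerNnormlW.
move: E; rewrite (_ : vol_density (fun x => F x + B x) =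
    (fun t => vol_density F t + vol_density B t)); last first.
  by apply/funext => t; rewrite /vol_density mulrDl.
by rewrite RintegralD// => /(canRL (addrK _)); rewrite subrr.
Qed.

End punctured_ball.

Section hpint.
Context {R : realType} {n : nat}.
Variable r : R.
Hypotheses (r0 : 0 < r) (n2 : (2 <= n)%N).
Implicit Types F G : 'rV[R]_n -> R.

Definition hpint F : R :=
  \int[leb n]_(t in @rv_of_tuple R n @^-1` hpunc r) vol_density F t.

Let mD := measurable_hpunc (n := n) r0.
Let iF F (aF : admissible r F) := admissible_integrable r0 n2 aF.

(** The passage from extended to real integrals: an admissible integrand is integrable, so taking
    [fine] loses nothing. *)
Lemma hint_hpint F G : (forall x, hpunc r x -> F x = G x) -> admissible r G ->
  hint [set x | 0 < hrho x < r] F = (hpint G)%:E.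
Proof.
move=> FG aG; rewrite /hpint /Rintegral fineK; last exact: integrable_fin_num (iF aG).
by apply: eq_integral => t; rewrite inE => Dt; rewrite /vol_density FG.
Qed.

Lemma hpintZ q F : admissible r F -> hpint (fun x => q * F x) = q * hpint F.
Proof.
move=> aF; rewrite /hpint -RintegralZl//; last exact: iF.
by apply: eq_Rintegral => t _; rewrite /vol_density mulrA.
Qed.

Lemma hpintD F G : admissible r F -> admissible r G ->
  hpint (fun x => F x + G x) = hpint F + hpint G.
Proof.
move=> aF aG; rewrite /hpint -RintegralD//; [|exact: iF|exact: iF].
by apply: eq_Rintegral => t _; rewrite /vol_density mulrDl.
Qed.

Lemma hpint_ge0 F : (forall x, hpunc r x -> 0 <= F x) -> 0 <= hpint F.
Proof.
move=> F0; apply: Rintegral_ge0 => t Dt.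
by rewrite mulr_ge0 ?F0// exprn_ge0// ltW// conf_gt0//; case: Dt.
Qed.

Lemma le_hpint F G : admissible r F -> admissible r G ->
  (forall x, hpunc r x -> F x <= G x) -> hpint F <= hpint G.
Proof.
move=> aF aG FG; rewrite -subr_ge0 -mulN1r -hpintZ// -hpintD//; last exact: admissibleZ.
by apply: hpint_ge0 => x /FG; rewrite mulN1r subr_ge0.
Qed.

End hpint.

(** * The radial identity *)

Section hyperbolic.
Context {R : realType}.
Implicit Types t : R.

Lemma is_derive_sinh t : is_derive t 1 (@sinh R) (cosh t).
Proof.
have := is_deriveZ (1 / 2) (is_deriveB (is_derive_expR t) (is_derive_expRN t)).
rewrite (_ : _ \*: _ = @sinh R).
  by move=> K; apply: (is_derive_eq K); rewrite /GRing.scale/= /cosh; lra.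
by apply/funext => s; rewrite /sinh /GRing.scale/= mul1r mulrC.
Qed.

Lemma is_derive_cosh t : is_derive t 1 (@cosh R) (sinh t).
Proof.
have := is_deriveZ (1 / 2) (is_deriveD (is_derive_expR t) (is_derive_expRN t)).
rewrite (_ : _ \*: _ = @cosh R).
  by move=> K; apply: (is_derive_eq K); rewrite /GRing.scale/= /sinh; lra.
by apply/funext => s; rewrite /cosh /GRing.scale/= mul1r mulrC.
Qed.

Lemma sinh_ge t : 0 <= t -> t * expR (- t) <= sinh t.
Proof.
move=> t0; have e0 := expR_gt0 (- t).
have h := @expR_ge1Dx R (2 * t).
have -> : sinh t = (expR (2 * t) - 1) / 2 * expR (- t).
  have -> : expR (2 * t) = expR t * expR t by rewrite -expRD; congr expR; ring.
  rewrite /sinh expRN; field; rewrite gt_eqF ?expR_gt0//.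
by rewrite ler_pM2r//; lra.
Qed.

Lemma sinh_gt0 t : 0 < t -> 0 < sinh t.
Proof. by move=> t0; rewrite /sinh divr_gt0// subr_gt0 ltr_expR; lra. Qed.

(** This is [coth t - 1 / t], the logarithmic derivative of [sinh t / t]; [N - 1] times it is that
    of the ratio of the hyperbolic to the Euclidean radial volume density. *)
Definition curv_factor t : R := (t * cosh t - sinh t) / (t * sinh t).

(** For the lower bound, the numerator vanishes at 0 and has derivative [s * sinh s]. For the upper
    one, [cosh t = sinh t + e ^ (- t)] reduces the claim to [sinh_ge]. The former decides the sign
    of the curvature term, the latter its integrability. *)
Lemma curv_factor_itv t : 0 < t -> 0 <= curv_factor t <= 1.
Proof.
move=> t0; have s0 := sinh_gt0 t0; have ts : 0 < t * sinh t by rewrite mulr_gt0.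
apply/andP; split.
  rewrite divr_ge0 ?(ltW ts)//.
  have dk (s : R) : is_derive s 1 (fun s => s * cosh s - sinh s) (s * sinh s).
    have := is_deriveB (is_deriveM (is_derive_id s 1) (is_derive_cosh s)) (is_derive_sinh s).
    by move=> K; apply: (is_derive_eq K); rewrite /GRing.scale/= mulr1; ring.
  have [|c] := @MVT_segment R _ _ 0 t (ltW t0) (fun s _ => dk s).
    by apply: continuous_subspaceT => s; exact: is_derive_continuous (dk s).
  rewrite in_itv/= mul0r sub0r => /andP[c0 _].
  have -> : sinh 0 = 0 :> R by rewrite /sinh oppr0 subrr mul0r.
  move=> h; have -> : t * cosh t - sinh t = c * sinh c * t by lra.
  rewrite mulr_ge0 ?(ltW t0)// mulr_ge0//.
  by move: c0; rewrite le_eqVlt => /predU1P[<-|/sinh_gt0/ltW//]; rewrite /sinh oppr0 subrr mul0r.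
rewrite ler_pdivrMr// mul1r lerBlDr.
have := sinh_ge (ltW t0); have : cosh t = sinh t + expR (- t) by rewrite /cosh /sinh; lra.
by move=> -> h; rewrite mulrDr lerD2l.
Qed.

Lemma curv_factor_continuous t : 0 < t -> {for t, continuous curv_factor}.
Proof.
move=> t0; have s0 := sinh_gt0 t0.
have cs : {for t, continuous (@sinh R)} by exact: is_derive_continuous (is_derive_sinh t).
have cc : {for t, continuous (@cosh R)} by exact: is_derive_continuous (is_derive_cosh t).
apply: (@continuousM R R (fun t => t * cosh t - sinh t) (fun t => (t * sinh t)^-1)).
  apply: (@continuousB R R R (fun t => t * cosh t) (@sinh R)) => //.
  exact: (@continuousM R R id (@cosh R) t).
apply: (@continuousV R R (fun t => t * sinh t)); first by rewrite mulf_neq0 ?gt_eqF.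
exact: (@continuousM R R id (@sinh R) t).
Qed.

Lemma is_derive_pow (h : R -> R) t (dh : R) k : is_derive t 1 h dh ->
  is_derive t 1 (fun s => h s ^+ k.+1) (k.+1%:R * h t ^+ k * dh).
Proof.
move=> H; elim: k => [|k IH].
  by rewrite expr0 !mul1r.
rewrite (_ : (fun s => _) = h * (fun s => h s ^+ k.+1)); last by apply/funext => s; rewrite exprS.
have := is_deriveM H IH; move=> K; apply: (is_derive_eq K).
by rewrite /GRing.scale/= -[k.+2%:R]natr1 exprS; ring.
Qed.

End hyperbolic.

Lemma continuous_sum (R : realType) (T : topologicalType) (I : Type) (s : seq I)
    (h : I -> T -> R) (p : T) :
  (forall i, {for p, continuous (h i)}) ->
  {for p, continuous (fun q => \sum_(i <- s) h i q)}.
Proof.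
move=> ch; elim: s => [|i s IH].
  rewrite (_ : (fun q => _) = cst 0); first exact: cst_continuous.
  by apply/funext => q; rewrite big_nil.
rewrite (_ : (fun q => _) = (fun q => h i q + \sum_(j <- s) h j q)).
  by apply: continuousD => //; exact: ch.
by apply/funext => q; rewrite big_cons.
Qed.

(** Here [F], [W], [P] stand for [f], [rdot f], [psi], then [q] is [conf], [m] is [|y|], [h] the
    geodesic distance, [ch] its [cosh], [t * m * q] its [sinh], and the dimension is [j + 2]. The
    left side is the product rule for [ray_flux] after the Riccati equation. The [- (N - 1) / h] of
    that equation and the [(N - 1) coth h] from the power of [sinh] add up to the curvature
    factor. *)
Lemma ray_algebra (R : realType) (F W P q m t h ch c k : R) (j : nat) :
  0 < q -> 0 < m -> 0 < t -> 0 < h ->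
  (m ^+ j.+2)^-1 * (F ^+ 2 * P * ((j%:R + 1) * (t * m * q) ^+ j * (ch * (q * m))) +
    (t * m * q) ^+ j.+1 * (F ^+ 2 * ((- P ^+ 2 - (j%:R + 2 - 1) / h * P - c / h ^+ 2 - k) * (q * m))
       + P * (2 * F ^+ 1 * (m * W)))) =
  ((W / q) ^+ 2 - c * (F ^+ 2 / h ^+ 2) - k * F ^+ 2 - (W / q - F * P) ^+ 2 +
    (j%:R + 2 - 1) * (P * ((h * ch - t * m * q) / (h * (t * m * q))) * F ^+ 2)) *
  q ^+ j.+2 * (t ^+ j.+2 / t).
Proof.
move=> q0 m0 t0 h0; rewrite !exprMn !exprS expr0.
have tj := exprn_gt0 j t0; have mj := exprn_gt0 j m0; have qj := exprn_gt0 j q0.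
(* With the powers of symbolic exponent turned into variables, the identity is one of rational
   functions. *)
move: (t ^+ j) (m ^+ j) (q ^+ j) tj mj qj => T M Q T0 M0 Q0; field.
by rewrite !gt_eqF.
Qed.

Section radial_identity.
Context {R : realType}.
Variables (N : nat) (a r z : R) (f : 'rV[R]_N -> R).
Hypotheses (a0 : 0 <= a) (aN : a <= (N%:R - 2) / 2) (r0 : 0 < r)
  (hz : first_zero (besselJ a) z) (hf : Cc_infty f)
  (hfr : forall x, hball x -> hrho x = r -> f x = 0).
Implicit Types x y : 'rV[R]_N.
Notation mu := (@lebesgue_measure R).
Notation D := (@hpunc R N r).
Let ps x := psi N a r z (hrho x).
Let w x := rdot f x / conf x.
Let kp := kappa N a.
Let b := tanh (r / 2).
Let c := (N%:R - 2) ^+ 2 / 4 - a ^+ 2.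
Let k := z ^+ 2 / r ^+ 2.

Lemma dim_ge2 : (2 <= N)%N.
Proof.
by have := le_trans a0 aN; rewrite pmulr_lge0 ?invr_gt0// subr_ge0 ler_nat.
Qed.

Lemma Cc_differentiable x : hball x -> differentiable f x.
Proof. by move=> bx; case: hf => + _ => /(_ [::] x bx). Qed.

Lemma Cc_continuous x : hball x -> {for x, continuous f}.
Proof. by move=> /Cc_differentiable; exact: differentiable_continuous. Qed.

Lemma hrho_continuous x : hball x -> {for x, continuous (@hrho R N)}.
Proof.
move=> bx; have e0 := enorm_ge0 x; have e1 : enorm x < 1 := bx.
have e01 : -1 < enorm x < 1 by lra.
have cl : {for x, continuous (fun y => ln ((1 + enorm y) / (1 - enorm y)))}.
  apply: (@continuous_comp _ _ _ (@enorm R N) (fun e => ln ((1 + e) / (1 - e))) x).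
    exact: enorm_continuous.
  exact: is_derive_continuous (is_derive_lnratio e01).
rewrite /prop_for /continuous_at (hrhoE bx); apply: cvg_trans cl; apply: (@near_eq_cvg _ _ (nbhs x)).
by apply: (filterS _ (open_nbhs_nbhs (conj (@open_hball R N) bx))) => y by_; rewrite hrhoE.
Qed.

Lemma partial_continuous i x : hball x -> {for x, continuous (partial i f)}.
Proof.
by move=> bx; apply: differentiable_continuous; case: hf => + _ => /(_ [:: i] x bx).
Qed.

Lemma radial_continuous x : D x -> {for x, continuous w}.
Proof.
move=> Dx; have bx : hball x by case: Dx.
have e0 : enorm x != 0 by rewrite enorm_eq0; exact: hpunc_neq0 Dx.
apply: continuousM; last first.
  by apply: continuousV; [rewrite gt_eqF// conf_gt0|exact: conf_continuous].
apply: continuousM; last by apply: continuousV => //; exact: enorm_continuous.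
rewrite /dot; apply: continuous_sum => i.
apply: continuousM; last exact: coord_continuous.
rewrite (_ : (fun y => _) = partial i f); first exact: partial_continuous.
by apply/funext => y; rewrite mxE.
Qed.

Lemma grad_density_continuous x : D x ->
  {for x, continuous (fun x => dot (egrad f x) (egrad f x) / conf x ^+ 2)}.
Proof.
move=> Dx; have bx : hball x by case: Dx.
apply: continuousM; last first.
  apply: continuousV; first by rewrite expf_neq0// gt_eqF// conf_gt0.
  by apply: continuous_expn; exact: conf_continuous.
rewrite /dot; apply: continuous_sum => i.
rewrite (_ : (fun y => _) = (fun y => partial i f y * partial i f y)).
  by apply: continuousM; exact: partial_continuous.
by apply/funext => y; rewrite mxE.
Qed.

Lemma psi_hrho_continuous x : D x -> {for x, continuous ps}.
Proof.
move=> [bx xr]; apply: (@continuous_comp _ _ _ (@hrho R N) (psi N a r z) x).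
  exact: hrho_continuous.
exact: is_derive_continuous (is_derive_psi N a0 r0 hz xr).
Qed.

Lemma curv_factor_hrho_continuous x : D x -> {for x, continuous (fun x => curv_factor (hrho x))}.
Proof.
move=> [bx /andP[x0 xr]]; apply: (@continuous_comp _ _ _ (@hrho R N) curv_factor x).
  exact: hrho_continuous.
exact: curv_factor_continuous.
Qed.

Definition radial_density x := w x ^+ 2.
(** The coefficient belongs to the density: for [N = 2] the quotient alone need not be integrable,
    but then [a = 0] and [c = 0]. *)
Definition hardy_density x := c * (f x ^+ 2 / hrho x ^+ 2).
Definition mass_density x := f x ^+ 2.
Definition remainder_density x := (w x - f x * ps x) ^+ 2.
Definition curv_density x := ps x * curv_factor (hrho x) * f x ^+ 2.
Definition grad_density x := dot (egrad f x) (egrad f x) / conf x ^+ 2.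

(** In the last bound, [|f| <= M * (r - rho)] cancels the term [C / (r - rho)] of [psi_bound] down
    to [M * C]; only the singularity [kappa / rho] at the centre survives. The comparison of [w ^ 2]
    with the gradient is the Cauchy-Schwarz inequality. *)
Lemma f_psi_bound : exists2 P : R, 0 <= P & forall x, D x ->
  [/\ `|f x| <= P, `|f x| <= P * (b - enorm x), grad_density x <= P ^+ 2, w x ^+ 2 <= grad_density x &
      `|f x * ps x| <= P * (kp / hrho x + 1)].
Proof.
have [M M0 HM] := Cc_bounded hf.
have [C C0 HC] := psi_bound a0 aN r0 hz.
have MC : M <= M * (1 + C) by rewrite ler_peMr ?(ltW M0)//; lra.
have k0 := kappa_ge0 aN.
exists (M * (1 + C)) => [|x Dx]; first by rewrite mulr_ge0 ?(ltW M0)//; lra.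
have [bx xr] := Dx; have /= /andP[x0 x1] := xr; have [fM gM] := HM x bx.
have fb : `|f x| <= M * (b - enorm x).
  by apply: (Cc_boundary r0 hf) => // y by_; case: (HM y by_).
have ge := hrho_upper_gap bx x1.
have eb : 0 <= b - enorm x by have /(hpuncE r0)/andP[_ /ltW] := Dx; rewrite subr_ge0.
have /andP[c2 _] := conf_hpunc r0 Dx.
have cc : 1 <= conf x ^+ 2 by rewrite exprn_ege1//; lra.
split.
- exact: le_trans MC.
- by apply: (le_trans fb); rewrite ler_wpM2r.
- apply: (@le_trans _ _ (M ^+ 2)); last by rewrite ler_pXn2r ?nnegrE ?(ltW M0)//; lra.
  apply: le_trans gM; rewrite /grad_density ler_pdivrMr ?(lt_le_trans ltr01 cc)//.
  by rewrite ler_peMr// dot_ge0.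
- rewrite /w /grad_density expr_div_n ler_wpM2r ?invr_ge0 ?exprn_ge0//; first lra.
  by apply: rdot_le; exact: hpunc_neq0 Dx.
- have hp := HC _ xr; rewrite normrM.
  apply: (le_trans (ler_wpM2l (normr_ge0 _) hp)); rewrite mulrDr [leRHS]mulrDr.
  apply: lerD; first by rewrite ler_wpM2r ?divr_ge0 ?(ltW x0)//; exact: le_trans MC.
  have rx : 0 < r - hrho x by rewrite subr_gt0.
  apply: (@le_trans _ _ (M * (r - hrho x) * (C / (r - hrho x)))).
    rewrite ler_wpM2r ?divr_ge0 ?(ltW rx)//; apply: (le_trans fb).
    by rewrite ler_wpM2l ?(ltW M0).
  rewrite (_ : M * (r - hrho x) * (C / (r - hrho x)) = M * C); last by field; rewrite gt_eqF.
  by rewrite mulr1 ler_wpM2l ?(ltW M0)//; lra.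
Qed.

(** Since [kappa <= (N - 2) / 2], its square is at most [N * (N - 2)]. Both vanish for [N = 2], as
    the singular part of [sing] does. *)
Lemma kappa_sing x : D x -> (kp / hrho x) ^+ 2 <= N%:R * sing x.
Proof.
move=> Dx; have [bx xr] := Dx; have /= /andP[x0 x1] := xr.
have /(hpuncE r0)/andP[e0 _] := Dx; have eh := enorm_le_hrho bx.
have k0 := kappa_ge0 aN; have aa := a0; have aaN := aN.
rewrite expr_div_n.
apply: (@le_trans _ _ (kp ^+ 2 / enorm x ^+ 2)).
  rewrite ler_wpM2l ?sqr_ge0// lef_pV2 ?posrE ?exprn_gt0// ler_pXn2r ?nnegrE// ltW//.
rewrite /sing mulrDr mulr1 mulrA -[leLHS]add0r; apply: lerD => //.
rewrite ler_wpM2r ?invr_ge0 ?sqr_ge0// expr2; apply: ler_pM => //; rewrite /kp /kappa; lra.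
Qed.

Lemma admissible_radial_density : admissible r radial_density.
Proof.
have [P P0 HP] := f_psi_bound.
apply: (admissible_bounded dim_ge2 (C := P ^+ 2)).
  by move=> x Dx; apply: continuous_expn; exact: radial_continuous.
move=> x /HP[_ _ gP wg _]; rewrite ger0_norm ?sqr_ge0//; exact: le_trans gP.
Qed.

Lemma admissible_grad_density : admissible r grad_density.
Proof.
have [P P0 HP] := f_psi_bound.
apply: (admissible_bounded dim_ge2 (C := P ^+ 2)); first exact: grad_density_continuous.
by move=> x /HP[_ _ gP _ _]; rewrite ger0_norm// divr_ge0 ?dot_ge0// sqr_ge0.
Qed.

Lemma admissible_mass_density : admissible r mass_density.
Proof.
have [P P0 HP] := f_psi_bound.
apply: (admissible_bounded dim_ge2 (C := P ^+ 2)).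
  by move=> x [bx _]; apply: continuous_expn; exact: Cc_continuous.
by move=> x /HP[fP _ _ _ _]; rewrite normrX ler_pXn2r ?nnegrE.
Qed.

Lemma admissible_remainder_density : admissible r remainder_density.
Proof.
have [P P0 HP] := f_psi_bound.
split.
  move=> x Dx; apply: continuous_expn; apply: continuousB; first exact: radial_continuous.
  by apply: continuousM; [apply: Cc_continuous; case: Dx|exact: psi_hrho_continuous].
(* From [(w - v) ^ 2 <= 2 w ^ 2 + 2 v ^ 2] with [v = f * psi], and [(u + 1) ^ 2 <= 2 (u ^ 2 + 1)]
   with [u = kappa / rho], whose square is at most [N * sing]. *)
exists (2 * P ^+ 2 + 4 * P ^+ 2 * (N%:R + 1)) => [|x Dx].
  by rewrite addr_ge0 ?mulr_ge0 ?sqr_ge0// addr_ge0.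
have [_ _ gP wg fp] := HP x Dx; have s1 := sing_ge1 dim_ge2 x; have ks := kappa_sing Dx.
rewrite ger0_norm ?sqr_ge0// /remainder_density.
have k0 : 0 <= kp / hrho x.
  by case: Dx => _ /= /andP[x0 _]; rewrite divr_ge0 ?(kappa_ge0 aN)// ltW.
have f2 : (f x * ps x) ^+ 2 <= 2 * P ^+ 2 * (N%:R + 1) * sing x.
  apply: (@le_trans _ _ (P ^+ 2 * (kp / hrho x + 1) ^+ 2)).
    by rewrite -exprMn -[leLHS]real_normK ?num_real// ler_pXn2r ?nnegrE// mulr_ge0//; lra.
  rewrite (_ : 2 * P ^+ 2 * (N%:R + 1) * sing x = P ^+ 2 * (2 * ((N%:R + 1) * sing x))); last by ring.
  rewrite ler_wpM2l ?sqr_ge0//; move: (kp / hrho x) ks => u ks.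
  have := sqr_ge0 (u - 1); lra.
apply: (@le_trans _ _ (2 * w x ^+ 2 + 2 * (f x * ps x) ^+ 2)).
  have := sqr_ge0 (w x + f x * ps x); lra.
have Ps : P ^+ 2 <= P ^+ 2 * sing x by rewrite ler_peMr// sqr_ge0.
by move: (sing x) (w x) (f x * ps x) Ps f2 wg gP => s w1 u; lra.
Qed.

Lemma admissible_curv_density : admissible r curv_density.
Proof.
have [P P0 HP] := f_psi_bound.
split.
  move=> x Dx; apply: continuousM; last by apply: continuous_expn; apply: Cc_continuous; case: Dx.
  by apply: continuousM; [exact: psi_hrho_continuous|exact: curv_factor_hrho_continuous].
exists (P ^+ 2 * (N%:R + 2)) => [|x Dx]; first by rewrite mulr_ge0 ?sqr_ge0// addr_ge0.
have [fP _ _ _ fp] := HP x Dx; have s1 := sing_ge1 dim_ge2 x; have ks := kappa_sing Dx.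
have [_ /= /andP[x0 _]] := Dx.
have /andP[q0 q1] := curv_factor_itv x0.
rewrite /curv_density (_ : ps x * curv_factor (hrho x) * f x ^+ 2 =
  (f x * ps x) * (curv_factor (hrho x) * f x)); last by ring.
rewrite normrM.
apply: (@le_trans _ _ (P * (kp / hrho x + 1) * P)).
  apply: ler_pM => //; rewrite normrM (ger0_norm q0).
  by apply: (@le_trans _ _ (1 * P)); [apply: ler_pM|rewrite mul1r].
rewrite mulrAC -expr2 -mulrA ler_wpM2l ?sqr_ge0//; move: (kp / hrho x) ks => u ks.
have := sqr_ge0 (u - 1); have := sqr_ge0 u; lra.
Qed.

Lemma admissible_hardy_density : admissible r hardy_density.
Proof.
have [P P0 HP] := f_psi_bound.
split.
  move=> x [bx /= /andP[x0 _]]; apply: continuousM; first exact: cst_continuous.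
  apply: continuousM; first by apply: continuous_expn; exact: Cc_continuous.
  apply: continuousV; first by rewrite expf_neq0// gt_eqF.
  by apply: continuous_expn; exact: hrho_continuous.
exists (P ^+ 2 * N%:R) => [|x Dx]; first by rewrite mulr_ge0 ?sqr_ge0.
have [fP _ _ _ _] := HP x Dx; have [bx /= /andP[x0 _]] := Dx.
have /(hpuncE r0)/andP[e0 _] := Dx; have eh := enorm_le_hrho bx.
have aa := a0; have aaN := aN.
have c0 : 0 <= c.
  by rewrite /c subr_ge0 (_ : _ / 4 = ((N%:R - 2) / 2) ^+ 2); [rewrite ler_pXn2r ?nnegrE//; lra|field].
(* The coefficient is at most [(N - 2) ^ 2 / 4], so it too fits under the singular part of
   [sing]. *)
have c1 : c <= N%:R * (N%:R - 2).
  rewrite /c; have := sqr_ge0 a; have : 0 <= (N%:R - 2 : R) by lra.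
  have : 0 <= (N%:R : R) by [].
  nra.
rewrite /hardy_density normrM (ger0_norm c0) ger0_norm ?divr_ge0 ?sqr_ge0//.
rewrite mulrCA -mulrA.
apply: ler_pM; rewrite ?sqr_ge0 ?mulr_ge0 ?invr_ge0 ?sqr_ge0//.
  by rewrite -[leLHS]real_normK ?num_real// ler_pXn2r ?nnegrE.
apply: (@le_trans _ _ (c / enorm x ^+ 2)).
  by rewrite ler_wpM2l// lef_pV2 ?posrE ?exprn_gt0// ler_pXn2r ?nnegrE// ltW.
rewrite /sing mulrDr mulr1 mulrA -[leLHS]add0r; apply: lerD => //.
by rewrite ler_wpM2r ?invr_ge0 ?sqr_ge0.
Qed.

Definition balance x := radial_density x - hardy_density x - k * mass_density x -
  remainder_density x + (N%:R - 1) * curv_density x.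

Lemma balanceE : balance = fun x => radial_density x + (- 1) * hardy_density x +
  (- k) * mass_density x + (- 1) * remainder_density x + (N%:R - 1) * curv_density x.
Proof. by apply/funext => x; rewrite /balance; ring. Qed.

Lemma admissible_balance : admissible r balance.
Proof.
rewrite balanceE; apply: admissibleD; last exact/admissibleZ/admissible_curv_density.
apply: admissibleD; last exact/admissibleZ/admissible_remainder_density.
apply: admissibleD; last exact/admissibleZ/admissible_mass_density.
apply: admissibleD; last exact/admissibleZ/admissible_hardy_density.
exact: admissible_radial_density.
Qed.

Lemma is_derive_hrho_ray y (t : R) : 1 < enorm y < 2 -> 0 < t < b / enorm y ->
  is_derive t 1 (fun t : R => hrho (t *: y)) (conf (t *: y) * enorm y).
Proof.
move=> ym /andP[t0 tb]; have /andP[m1 m2] := ym; set m := enorm y in m1 m2 tb *.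
have Dx : D (t *: y) by apply/hpunc_ray.
have bx : hball (t *: y) by case: Dx.
have e : enorm (t *: y) = t * m by rewrite enormZ gtr0_norm.
have tm : -1 < t * m < 1.
  by rewrite -e; have := enorm_ge0 (t *: y); have : enorm (t *: y) < 1 := bx; lra.
have HZ : is_derive t 1 (fun t : R => t * m) m.
  have := is_deriveM (is_derive_id t 1) (is_derive_cst m t 1).
  by move=> K; apply: (is_derive_eq K); rewrite /GRing.scale/= mulr0 add0r mulr1.
have H := @is_derive1_comp R (fun e : R => ln ((1 + e) / (1 - e))) (fun t => t * m) t
  _ _ (is_derive_lnratio tm) HZ.
apply: (@near_eq_is_derive _ _ _ ((fun e : R => ln ((1 + e) / (1 - e))) \o (fun t => t * m))); last first.
  by apply: (is_derive_eq H); rewrite confE e.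
near=> s.
have s0 : 0 < s by near: s; exact: lt_nbhsr.
have sb : s < b / m by near: s; exact: lt_nbhsl.
have [bs _] : D (s *: y) by apply/hpunc_ray.
by rewrite /= hrhoE// enormZ gtr0_norm.
Unshelve. all: by end_near. Qed.

Lemma is_derive_f_ray y (t : R) : 0 < t -> y != 0 -> hball (t *: y) ->
  is_derive t 1 (fun t : R => f (t *: y)) (enorm y * rdot f (t *: y)).
Proof.
move=> t0 y0 bx.
have H := is_derive_scalel y (is_derive_id t 1); rewrite scale1r in H.
have K := @is_derive_curve _ _ f (fun t => t *: y) t y (Cc_differentiable bx) H.
apply: (is_derive_eq K); rewrite diff_dot; last exact: Cc_differentiable.
rewrite /rdot enormZ gtr0_norm// dotZr; field.
by rewrite enorm_eq0 y0 gt_eqF.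
Qed.

(* [sinh (hrho (t *: y)) = t * enorm y * conf (t *: y)] relates this to the
   density [conf ^+ N * t ^+ N.-1] of the volume along the ray. *)
Definition ray_flux y (t : R) : R := (enorm y ^+ N)^-1 *
  (f (t *: y) ^+ 2 * ps (t *: y) * sinh (hrho (t *: y)) ^+ N.-1).

(** Differentiating [hrho (t *: y)] yields [conf * |y|]; with [sinh ^ (N - 1)] this makes
    [|y| ^ N * conf ^ N * t ^ (N - 1)]. The prefactor of [ray_flux] removes [|y| ^ N], as [y] is not
    a unit vector. *)
Lemma is_derive_ray_flux y (t : R) : 1 < enorm y < 2 -> 0 < t < b / enorm y ->
  is_derive t 1 (ray_flux y) (balance (t *: y) * conf (t *: y) ^+ N * (t ^+ N / t)).
Proof.
move=> ym tb; have /andP[m1 m2] := ym; have /andP[t0 tb'] := tb.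
have Dx : D (t *: y) by apply/hpunc_ray.
have [bx xr] := Dx; have /= /andP[x0 xr'] := xr.
have y0 : y != 0 by rewrite -enorm_eq0 gt_eqF//; lra.
have Hf := is_derive_f_ray t0 y0 bx.
have Hr := is_derive_hrho_ray ym tb.
have Hp := @is_derive1_comp R (psi N a r z) (fun t => hrho (t *: y)) t _ _ (is_derive_psi N a0 r0 hz xr) Hr.
have Hs := @is_derive1_comp R (@sinh R) (fun t => hrho (t *: y)) t _ _ (is_derive_sinh _) Hr.
have [j nj] : exists j, N = j.+2.
  by have := dim_ge2; case: (N) => [|[|j]]// _; exists j.
have nj1 : N.-1 = j.+1 by rewrite nj.
have expN (u : R) : u ^+ N = u ^+ j.+2 by congr (_ ^+ _).
have Hsp := is_derive_pow j Hs.
have Hf2 := is_derive_pow 1 Hf.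
have H := is_deriveZ (enorm y ^+ N)^-1 (is_deriveM (is_deriveM Hf2 Hp) Hsp).
rewrite (_ : _ \*: _ = ray_flux y) in H; last first.
  by apply/funext => s; rewrite /ray_flux nj1.
apply: (is_derive_eq H).
have N1 : N%:R = j%:R + 2 :> R by rewrite nj -[j.+2%:R]natr1 -natr1; ring.
have m0 : 0 < enorm y by lra.
have sE : sinh (hrho (t *: y)) = t * enorm y * conf (t *: y).
  by rewrite sinh_hrho// enormZ gtr0_norm.
have E := @ray_algebra R (f (t *: y)) (rdot f (t *: y)) (psi N a r z (hrho (t *: y)))
  (conf (t *: y)) (enorm y) t (hrho (t *: y)) (cosh (hrho (t *: y))) c k j
  (conf_gt0 bx) m0 t0 x0.
rewrite -sE -N1 natr1 in E; rewrite /balance /radial_density /hardy_density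
  /mass_density /remainder_density /curv_density /ps /curv_factor /w !expN.
exact: E.
Qed.

(** These are the linear rates asked for by [FTC_vanishing]. One factor [f] tames [psi], so that
    [|f * psi| * sinh ^ (N - 1)] is at most [C0 * |x|]; the other is bounded by [P] near the centre
    and by [P * (b - |x|)] near the sphere. *)
Lemma ray_flux_bound : exists2 C : R, 0 <= C & forall y (t : R), 1 < enorm y < 2 ->
  0 < t < b / enorm y -> `|ray_flux y t| <= C * t /\ `|ray_flux y t| <= C * (b / enorm y - t).
Proof.
have [P P0 HP] := f_psi_bound; have /andP[b0 b1] := tanh_half_itv r0.
have [j nj] : exists j, N = j.+2.
  by have := dim_ge2; case: (N) => [|[|j]]// _; exists j.
have nj1 : N.-1 = j.+1 by rewrite nj.
have k0 : 0 <= kp := kappa_ge0 aN.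
pose q := 2 / (1 - b ^+ 2).
have b2 : b ^+ 2 < 1 by rewrite -[ltRHS](expr1n _ 2) ltr_pXn2r ?nnegrE// ltW.
have q0 : 0 <= q by rewrite divr_ge0//; lra.
pose C0 := P * (kp + 1) * q ^+ j.+1.
have C00 : 0 <= C0 by rewrite mulr_ge0 ?exprn_ge0// mulr_ge0// addr_ge0.
(* The 2 bounds [|y|], in [|x| = t * |y|] and in [b - |x| = |y| * (b / |y| - t)]. *)
exists (2 * P * C0) => [|y t ym tb]; first by rewrite mulr_ge0// mulr_ge0.
have /andP[m1 m2] := ym; have /andP[t0 tb'] := tb.
have Dx : D (t *: y) by apply/hpunc_ray.
have [bx xr] := Dx; have /= /andP[x0 xr'] := xr.
have [fP fb _ _ fp] := HP _ Dx; have /(hpuncE r0)/andP[e0 eb] := Dx.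
have eE : enorm (t *: y) = t * enorm y by rewrite enormZ gtr0_norm.
have eh := enorm_le_hrho bx.
have /andP[c2 cq] := conf_hpunc r0 Dx.
have main : `|ray_flux y t| <= `|f (t *: y)| * (C0 * enorm (t *: y)).
  rewrite /ray_flux nj1 normrM.
  have mN : 1 <= enorm y ^+ N by rewrite exprn_ege1// ltW.
  rewrite (_ : `|(enorm y ^+ N)^-1| = (enorm y ^+ N)^-1); last first.
    by rewrite ger0_norm// invr_ge0; lra.
  rewrite mulrC ler_pdivrMr; last lra.
  apply: (@le_trans _ _ (`|f (t *: y)| * (C0 * enorm (t *: y)))); last first.
    by rewrite ler_peMr// mulr_ge0// mulr_ge0// ltW.
  rewrite expr2 -!mulrA normrM ler_wpM2l// mulrA normrM.
  apply: (@le_trans _ _ (P * (kp / enorm (t *: y) + 1) * (enorm (t *: y) * q) ^+ j.+1)).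
    apply: ler_pM => //.
      apply: (le_trans fp); rewrite ler_wpM2l// lerD2r ler_wpM2l// lef_pV2// posrE.
    have sq : `|sinh (hrho (t *: y))| <= enorm (t *: y) * q.
      rewrite sinh_hrho// ger0_norm; first by rewrite ler_wpM2l ?(ltW e0).
      by apply: mulr_ge0; [exact: ltW|lra].
    by rewrite normrX; apply: lerXn2r; rewrite ?nnegrE//; exact: mulr_ge0 (ltW e0) q0.
  rewrite exprMn mulrA [leRHS]mulrAC /C0 mulrAC [leRHS]mulrAC -!mulrA ler_wpM2l//.
  suff h : (kp / enorm (t *: y) + 1) * enorm (t *: y) ^+ j.+1 <= enorm (t *: y) * (kp + 1).
    by have := ler_wpM2r (exprn_ge0 j.+1 q0) h; rewrite -mulrA [X in _ <= X -> _]mulrC.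
  rewrite [leLHS]mulrDl mul1r [leRHS]mulrDr mulr1 [enorm (t *: y) * kp]mulrC.
  have e1 : enorm (t *: y) <= 1 by lra.
  apply: lerD; last by rewrite exprS ler_piMr ?(ltW e0)// exprn_ile1 ?(ltW e0).
  (* For [N = 2] the term [kp / |x|] is absent; for [N >= 3] the power of [|x|] has exponent at
     least 2 and leaves a factor [|x|] after the division. *)
  case: j nj {nj1 C0 C00} => [|j] nj.
    have aa := a0; have ak := aN; have kz : kp = 0 by move: ak; rewrite /kp /kappa nj; lra.
    by rewrite kz !mul0r.
  rewrite (_ : _ * _ ^+ _ = kp * (enorm (t *: y) * enorm (t *: y) ^+ j)); last first.
    by rewrite !exprS; field; rewrite gt_eqF.
  rewrite ler_wpM2l// ler_piMr ?(ltW e0)//.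
  by rewrite exprn_ile1 ?(ltW e0).
have e2 : enorm (t *: y) <= 2 * t by rewrite eE mulrC ler_wpM2r ?ltW.
have e1 : enorm (t *: y) <= 1 by lra.
split; apply: (le_trans main).
  rewrite (_ : 2 * P * C0 * t = P * (C0 * (2 * t))); last by ring.
  by apply: ler_pM => //; [rewrite mulr_ge0// ltW|rewrite ler_wpM2l].
rewrite (_ : 2 * P * C0 * (b / enorm y - t) = P * (2 * (b / enorm y - t)) * (C0 * 1)); last by ring.
apply: ler_pM => //; [by rewrite mulr_ge0// ltW| |by rewrite ler_wpM2l].
apply: (le_trans fb); rewrite ler_wpM2l// eE.
have m0 : 0 < enorm y by lra.
rewrite (_ : b - t * enorm y = enorm y * (b / enorm y - t)); last by field; rewrite gt_eqF.
by rewrite ler_wpM2r ?subr_ge0 ?(ltW tb')// ltW.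
Qed.

Lemma hpint_balance : \int[leb N]_(t in @rv_of_tuple R N @^-1` D) vol_density balance t = 0.
Proof.
have aE := admissible_balance.
apply: (Rintegral_rays_eq0 r0 dim_ge2 aE) => y ym; have /andP[m1 m2] := ym.
have /andP[b0 b1] := tanh_half_itv r0.
have m0 : 0 < enorm y by lra.
have [C C0 HC] := ray_flux_bound; have [cE [K K0 HK]] := aE.
have [C' C'0 HC'] := ray_bound r0 dim_ge2 K0 HK.
have [] // := @FTC_vanishing R (ray_flux y)
  (fun t => balance (t *: y) * conf (t *: y) ^+ N * (t ^+ N / t)) 0 (b / enorm y) (C + C').
- by rewrite divr_gt0.
- by move=> t tb; exact: is_derive_ray_flux.
- by move=> t tb; exact: (ray_continuous r0 cE ym tb).
- by move=> t tb; apply: (le_trans (HC' _ _ ym tb)); rewrite lerDr.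
- move=> t tb; have [h _] := HC _ _ ym tb; apply: (le_trans h); rewrite subr0 ler_wpM2r ?lerDl//.
  by case/andP: tb => /ltW.
- move=> t tb; have [_ h] := HC _ _ ym tb; apply: (le_trans h); rewrite ler_wpM2r ?lerDl//.
  by case/andP: tb => _ /ltW; rewrite subr_ge0.
Qed.

Notation I := (hpint r).

Lemma radial_identity : I radial_density - I hardy_density =
  k * I mass_density + I remainder_density - (N%:R - 1) * I curv_density.
Proof.
have E := hpint_balance; rewrite balanceE -/(I _) in E.
have n2 := dim_ge2; have IZ := hpintZ r0 n2; have ID := hpintD r0 n2.
have A1 := admissible_radial_density; have A2 := admissible_hardy_density; have A3 := admissible_mass_density.
have A4 := admissible_remainder_density; have A5 := admissible_curv_density.
have B2 := admissibleZ (-1) A2; have B3 := admissibleZ (-k) A3.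
have B4 := admissibleZ (-1) A4; have B5 := admissibleZ (N%:R - 1) A5.
have C2 := admissibleD A1 B2; have C3 := admissibleD C2 B3; have C4 := admissibleD C3 B4.
rewrite (ID _ _ C4 B5) (ID _ _ C3 B4) (ID _ _ C2 B3) (ID _ _ A1 B2) in E.
rewrite (IZ _ _ A2) (IZ _ _ A3) (IZ _ _ A4) (IZ _ _ A5) in E.
move: (I radial_density) (I hardy_density) (I mass_density) (I remainder_density)
  (I curv_density) E => x1 x2 x3 x4 x5; lra.
Qed.

End radial_identity.

(** * The weighted remainders in terms of [psi] *)

Section weighted_remainders.
Context {R : realType}.
Variables (N : nat) (a r z : R) (f : 'rV[R]_N -> R).
Hypotheses (a0 : 0 <= a) (aN : a <= (N%:R - 2) / 2) (r0 : 0 < r)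
  (hz : first_zero (besselJ a) z) (hf : Cc_infty f).
Implicit Types x : 'rV[R]_N.
Let g x := f x / Phi N a r z (hrho x).

Lemma Phi_sqr t : 0 < t < r ->
  besselJ a (z / r * t) ^+ 2 / t `^ (N%:R - 2) = Phi N a r z t ^+ 2.
Proof.
move=> /andP[t0 tr]; rewrite /Phi exprMn mulrC; congr (_ * _).
rewrite -powR_mulrn ?powR_ge0// -powRrM -powRN; by congr (_ `^ _); field.
Qed.

Lemma hradial_sqr x : hpunc r x -> `|hradial f x| ^+ 2 = radial_density f x.
Proof.
move=> Dx; have [bx _] := Dx.
rewrite real_normK ?num_real// /hradial (is_derive1E (is_derive_hradial bx _ _))//.
  exact: hpunc_neq0 Dx.
exact: Cc_differentiable.
Qed.

Lemma radial_remainder x : hpunc r x ->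
  besselJ a (z / r * hrho x) ^+ 2 / hrho x `^ (N%:R - 2) * `|hradial g x| ^+ 2 =
  remainder_density a r z f x.
Proof.
move=> Dx; have [bx xr] := Dx; have x0 := hpunc_neq0 r0 Dx.
have P0 := Phi_gt0 N a0 r0 hz xr.
rewrite Phi_sqr// (hradial_quotient bx x0 (Cc_differentiable hf bx)
  (is_derive_Phi N a0 r0 hz xr)) ?gt_eqF//.
rewrite real_normK ?num_real// /hradial (is_derive1E (is_derive_hradial bx x0 (Cc_differentiable hf bx))).
by rewrite /remainder_density; field; rewrite !gt_eqF ?conf_gt0.
Qed.

(** The correction by [psi] is radial, so it drops out of the tangential part: the two remainders
    differ by [|grad f| ^ 2] minus the squared radial derivative, exactly as the left sides of the
    two identities do. *)
Lemma gradient_remainder x : hpunc r x ->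
  besselJ a (z / r * hrho x) ^+ 2 / hrho x `^ (N%:R - 2) * hnorm x (hgrad g x) ^+ 2 =
  grad_density f x + (-1) * radial_density f x + remainder_density a r z f x.
Proof.
move=> Dx; have [bx xr] := Dx; have x0 := hpunc_neq0 r0 Dx.
have P0 := Phi_gt0 N a0 r0 hz xr; have c0 := conf_gt0 bx.
have e0 : enorm x != 0 by rewrite enorm_eq0.
rewrite Phi_sqr// hnorm_hgrad// (egrad_quotient bx x0 (Cc_differentiable hf bx)
  (is_derive_Phi N a0 r0 hz xr)) ?gt_eqF//.
rewrite dotZl dotZr -scaleNr dotDl !(dotC _ (_ + _)) !dotDl !dotZl (dotC _ (_ *: _)) !dotZl.
rewrite (dotC x (_ *: _)) dotZl (dotC x (egrad f x)) -(enorm_sqr x).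
have -> : dot (egrad f x) x = rdot f x * enorm x by rewrite /rdot divfK.
by rewrite /grad_density /radial_density /remainder_density; field; rewrite e0 !gt_eqF.
Qed.

End weighted_remainders.

Unset Implicit Arguments.
(* [hfr] is the Dirichlet condition on the geodesic sphere of radius [r]; it
   holds in particular when [f] is supported in the open geodesic ball. It is
   implicit in the integrals: if [f] equals 1 on the closed geodesic ball, the
   last two inequalities would give [z ^+ 2 / r ^+ 2 * mass <= 0]. *)
Theorem theorem1p5 (R : realType) (N : nat) (alpha r z : R)
    (f : 'rV[R]_N -> R)
    (halpha : 0 <= alpha <= (N%:R - 2) / 2)
    (hr : 0 < r)
    (hz : first_zero (besselJ alpha) z)
    (hf : Cc_infty f)
    (hfr : forall x, hball x -> hrho x = r -> f x = 0) :
  let B : set 'rV[R]_N := [set x | 0 < hrho x < r] in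
  let J : 'rV[R]_N -> R := fun x => besselJ alpha (z / r * hrho x) in
  let J' : 'rV[R]_N -> R := fun x =>
    derive1 (besselJ alpha) (z / r * hrho x) in
  let g : 'rV[R]_N -> R := fun x =>
    f x / (hrho x `^ ((2 - N%:R) / 2) * J x) in
  let c : R := (N%:R - 2) ^+ 2 / 4 - alpha ^+ 2 in
  let grad : \bar R := hint B (fun x => hnorm x (hgrad f x) ^+ 2) in
  let radial : \bar R := hint B (fun x => `|hradial f x| ^+ 2) in
  let hardy : \bar R := hint B (fun x => `|f x| ^+ 2 / hrho x ^+ 2) in
  let mass : \bar R := hint B (fun x => `|f x| ^+ 2) in
  let rem_grad : \bar R := hint B (fun x =>
    J x ^+ 2 / hrho x `^ (N%:R - 2) * hnorm x (hgrad g x) ^+ 2) in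
  let rem_radial : \bar R := hint B (fun x =>
    J x ^+ 2 / hrho x `^ (N%:R - 2) * `|hradial g x| ^+ 2) in
  let curv : \bar R := hint B (fun x =>
    ((2 - N%:R) / (2 * hrho x) + z / r * (J' x / J x)) *
    ((hrho x * cosh (hrho x) - sinh (hrho x)) / (hrho x * sinh (hrho x))) *
    `|f x| ^+ 2) in
  [/\ (grad - c%:E * hardy =
        (z ^+ 2 / r ^+ 2)%:E * mass + rem_grad - (N%:R - 1)%:E * curv)%E,
      (radial - c%:E * hardy =
        (z ^+ 2 / r ^+ 2)%:E * mass + rem_radial - (N%:R - 1)%:E * curv)%E,
      (grad >= radial)%E,
      (radial >= c%:E * hardy + (z ^+ 2 / r ^+ 2)%:E * mass
                 - (N%:R - 1)%:E * curv)%E &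
      (c%:E * hardy + (z ^+ 2 / r ^+ 2)%:E * mass - (N%:R - 1)%:E * curv
         >= c%:E * hardy + (z ^+ 2 / r ^+ 2)%:E * mass)%E].
Proof.
move=> B J J' g c grad radial hardy mass rem_grad rem_radial curv.
have /andP[a0 aN] := halpha; have n2 := dim_ge2 a0 aN.
pose I := @hpint R N r; pose k := z ^+ 2 / r ^+ 2.
have Agr := admissible_grad_density a0 aN hr hz hf hfr.
have Ara := admissible_radial_density a0 aN hr hz hf hfr.
have Arr := admissible_remainder_density a0 aN hr hz hf hfr.
have Acu := admissible_curv_density a0 aN hr hz hf hfr.
have Acha := admissible_hardy_density a0 aN hr hz hf hfr.
have Ama := admissible_mass_density a0 aN hr hz hf hfr.
have gradE : grad = (I (grad_density f))%:E.
  by apply: hint_hpint => // x [bx _]; exact: hnorm_hgrad.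
have radialE : radial = (I (radial_density f))%:E.
  by apply: hint_hpint => // x; exact: hradial_sqr.
have hardyE : (c%:E * hardy = (I (hardy_density alpha f))%:E)%E.
  (* When [c = 0], [hardy] may be infinite and the convention that 0 times infinity is 0 gives the
     product. Otherwise [hardy] itself is finite, being the integral of [c^-1] times an admissible
     density. *)
  have [c0|c0] := eqVneq c 0.
    rewrite c0 mul0e (_ : hardy_density alpha f = (fun x => 0 * hardy_density alpha f x)).
      by rewrite /I hpintZ// mul0r.
    by apply/funext => x; rewrite /hardy_density -/c c0 !mul0r.
  have -> : hardy = (I (fun x => c^-1 * hardy_density alpha f x))%:E.
    apply: hint_hpint => //; last exact: admissibleZ.
    by move=> x _; rewrite /hardy_density -/c mulKf// real_normK ?num_real.
  by rewrite /I hpintZ// -EFinM mulVKf.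
have massE : mass = (I (mass_density f))%:E.
  by apply: hint_hpint => // x _; rewrite real_normK ?num_real.
have rem_radialE : rem_radial = (I (remainder_density alpha r z f))%:E.
  by apply: hint_hpint => // x; exact: radial_remainder.
have rem_gradE : rem_grad = (I (grad_density f) - I (radial_density f) +
    I (remainder_density alpha r z f))%:E.
  have A1 := admissibleZ (-1) Ara; have A2 := admissibleD Agr A1.
  rewrite -[- I (radial_density f)]mulN1r -hpintZ// -!hpintD//.
  apply: (hint_hpint hr n2); last exact: admissibleD.
  by move=> x; exact: gradient_remainder.
have curvE : curv = (I (curv_density alpha r z f))%:E.
  apply: hint_hpint => // x [_ xr].
  by rewrite /J /J' (psiE N a0 hr hz xr) real_normK ?num_real.
have key := radial_identity a0 aN hr hz hf hfr; rewrite -/I -/k in key.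
have grad_ge : I (radial_density f) <= I (grad_density f).
  apply: le_hpint => // x Dx.
  by have [P _ /(_ x Dx)[]] := f_psi_bound a0 aN hr hz hf hfr.
have rr_ge0 : 0 <= I (remainder_density alpha r z f).
  by apply: hpint_ge0 => x _; exact: sqr_ge0.
have cu_le0 : I (curv_density alpha r z f) <= 0.
  rewrite -oppr_ge0 -mulN1r -hpintZ//; apply: hpint_ge0 => x [_ xr].
  have := xr => /= /andP[x0 _]; have /andP[q0 _] := curv_factor_itv x0.
  have p0 := psi_le0 a0 aN hr hz xr.
  by rewrite mulN1r oppr_ge0; exact: mulr_le0_ge0 (mulr_le0_ge0 p0 q0) (sqr_ge0 _).
have N1 : 0 <= N%:R - 1 :> R by rewrite subr_ge0 ler1n ltnW.
have curv_le0 : (N%:R - 1) * I (curv_density alpha r z f) <= 0 by rewrite mulr_ge0_le0.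
rewrite hardyE gradE radialE massE rem_radialE rem_gradE curvE -/k.
rewrite -!EFinM -!(EFinB, EFinD) !lee_fin.
by split; [congr EFin| congr EFin| | |]; lra.
Qed.
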